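(* Let $0<\beta<\alpha\le1$, let $a,b>0$, let $q_k:[0,\infty)\to\mathbb R$, $k=1,\dots,m$, be continuous, bounded and eventually non-negative, and let $f_k:\mathbb R\to\mathbb R$, $k=1,\dots,m$, be continuous functions such that for each $k$: (F1) $f_k(0)=0$; (F2) $f_k$ is locally Lipschitz continuous at the origin and $\lim_{r\to0}\ell_{f_k}(r)=0$, where $\ell_{f_k}(r)=\sup_{|x|,|\hat x|\le r,\ x\ne\hat x}\frac{|f_k(x)-f_k(\hat x)|}{|x-\hat x|}$; (F3) $x f_k(x)\le0$ for all $x\in\mathbb R$. Then for every sufficiently small $\epsilon>0$ there exist $\delta_1=\delta_1(\epsilon)>0$ and $\delta_2=\delta_2(\epsilon)>0$ such that the following holds. Let $g:[0,\infty)\to\mathbb R$ be a continuous function of the form $g(t)={}^CD^\alpha_{0^+}[(t+1)^\sigma h(t)]$, $t\in[0,\infty)$, where $\alpha-\beta<\sigma<\alpha\le 1$, $h$ is continuously differentiable and bounded on $[0,\infty)$, $\limsup_{t\to\infty}h(t)>0$, $\liminf_{t\to\infty}h(t)<0$, and $h'(t)=O(t^\eta)$ as $t\to\infty$ for some $\eta$ with $-1<\eta<\alpha-\sigma-1$. If $|g(t)|\le\delta_1$ for all $t\ge0$ and $|x_0|<\delta_2$, then the solution $\varphi(\cdot,x_0)$ of $${}^CD^\alpha_{0^+}x(t)+a\,{}^CD^\beta_{0^+}x(t)=-b\,x(t)+\sum_{k=1}^mq_k(t)f_k(x(t))+g(t),\quad t>0,\qquad x(0)=x_0,$$ is oscillatory,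 $|\varphi(t,x_0)|\le\epsilon$ for all $t\ge0$, and $\lim_{t\to\infty}\varphi(t,x_0)=0$.
   Context: For $0<\alpha\le1$ and $f:[0,\infty)\to\mathbb R$: $I^\alpha_{0^+}f(t)=\frac1{\Gamma(\alpha)}\int_0^t(t-s)^{\alpha-1}f(s)\,ds$, $I^0_{0^+}f=f$, and the Caputo derivative is ${}^CD^\alpha_{0^+}f(t)=\frac{d}{dt}I^{1-\alpha}_{0^+}(f-f(0))(t)$ for $t>0$ (its value at $t=0$ understood by continuous extension). A function $f\in C[0,\infty)$ is continuously Caputo $\alpha$-differentiable on $[0,\infty)$ if ${}^CD^\alpha_{0^+}f$ exists and is continuous on $[0,\infty)$. A solution is a continuously Caputo $\alpha$-differentiable function satisfying the equation for $t>0$ and the initial condition; $\varphi(\cdot,x_0)$ denotes the solution with $\varphi(0,x_0)=x_0$. A solution is oscillatory if it exists globally on $[0,\infty)$ and there is a sequence $t_k\in[0,\infty)$ with $t_k\to\infty$ at which it vanishes. A function $q$ is eventually non-negative if there is $T>0$ with $q(t)\ge0$ for all $t\ge T$. *)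

(* Defs.v *)
From HB Require Import structures.
From mathcomp Require Import all_boot all_order all_algebra.
From mathcomp Require Import all_classical all_reals all_analysis.

Set Implicit Arguments.
Unset Strict Implicit.
Unset Printing Implicit Defensive.

Import Order.TTheory GRing.Theory Num.Theory.
Import numFieldNormedType.Exports.

Local Open Scope classical_set_scope.
Local Open Scope ring_scope.

(* A function on [0, +oo[ is represented by a total function R -> R; nothing
   below depends on its values at negative arguments. *)
Definition nonneg_halfline {R : realType} : set R := `[0, +oo[.

Definition Gamma {R : realType} (x : R) : R :=
  \int[lebesgue_measure]_(s in `]0, +oo[) (s `^ (x - 1) * expR (- s)).

Definition frac_int {R : realType} (alpha : R) (f : R -> R) (t : R) : R :=
  if alpha == 0 then f t
  else (Gamma alpha)^-1 *
       \int[lebesgue_measure]_(s in `[0, t]) ((t - s) `^ (alpha - 1) * f s).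

Definition caputo_primitive {R : realType} (alpha : R) (f : R -> R) : R -> R :=
  frac_int (1 - alpha) (fun s => f s - f 0).

(* The derivative at t = 0 would be two-sided, hence the limit there. Values are
   meaningful only together with [caputo_differentiable]. *)
Definition caputo {R : realType} (alpha : R) (f : R -> R) (t : R) : R :=
  if t == 0 then lim (derive1 (caputo_primitive alpha f) s @[s --> 0^'+])
  else derive1 (caputo_primitive alpha f) t.

Definition caputo_differentiable {R : realType} (alpha : R) (f : R -> R) : Prop :=
  forall t : R, 0 < t -> derivable (caputo_primitive alpha f) t 1.

(* Continuity of [caputo alpha f] relative to [0, +oo[ at 0 makes the right-hand
   limit in the definition of [caputo alpha f 0] exist. *)
Definition continuously_caputo_differentiable {R : realType} (alpha : R)
    (f : R -> R) : Prop :=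
  [/\ {within nonneg_halfline, continuous f},
      caputo_differentiable alpha f
    & {within nonneg_halfline, continuous (caputo alpha f)}].

(* [dh] is the derivative of h on [0, +oo[, one-sided at 0. *)
Definition is_derivative_on_halfline {R : realType} (h dh : R -> R) : Prop :=
  forall t : R, 0 <= t ->
    (h s - h t) / (s - t) @[s --> within nonneg_halfline t^'] --> dh t.

Definition eventually_nonneg {R : realType} (q : R -> R) : Prop :=
  exists2 T : R, 0 < T & forall t, T <= t -> 0 <= q t.

Definition locally_lipschitz_at_origin {R : realType} (f : R -> R) : Prop :=
  exists2 r : R, 0 < r & [lipschitz f x | x in `[- r, r]].

Definition lip_modulus {R : realType} (f : R -> R) (r : R) : \bar R :=
  ereal_sup [set (`|f p.1 - f p.2| / `|p.1 - p.2|)%:E |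
             p in [set p : R * R | [/\ `|p.1| <= r, `|p.2| <= r & p.1 != p.2]]].

Definition oscillatory {R : realType} (x : R -> R) : Prop :=
  exists t : nat -> R,
    [/\ forall k, 0 <= t k, t k @[k --> \oo] --> +oo & forall k, x (t k) = 0].

Definition is_solution {R : realType} (alpha beta a b : R) (m : nat)
    (q f : 'I_m -> R -> R) (g : R -> R) (x0 : R) (x : R -> R) : Prop :=
  [/\ continuously_caputo_differentiable alpha x,
      caputo_differentiable beta x,
      forall t, 0 < t ->
        caputo alpha x t + a * caputo beta x t =
          - b * x t + \sum_(k < m) q k t * f k (x t) + g t
    & x 0 = x0].

(* Main.v *)
Require Import Defs.
From HB Require Import structures.
From mathcomp Require Import all_boot all_order all_algebra.
From mathcomp Require Import all_classical all_reals all_analysis.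
From mathcomp Require Import measurable_realfun ring lra.

Set Implicit Arguments.
Unset Strict Implicit.
Unset Printing Implicit Defensive.

Import Order.TTheory GRing.Theory Num.Theory.
Import numFieldNormedType.Exports.

Local Open Scope classical_set_scope.
Local Open Scope ring_scope.

(**
Write I^a for the fractional integral of order a (up to a positive constant),
and let v be the Caputo derivative of order alpha of x.  Then x = x0 + c I^alpha v,
and the equation becomes
    v + A I^(alpha - beta) v = - b x + N + g,    N(t) = sum_k q_k(t) f_k(x(t)),
with v continuous and c, A > 0; [caputo_integral_form] gives both directions.

Everything about the size of x comes from an extremum principle for continuous
functions, [RL_extremum]: if 0 < a <= 1 and I^a v attains at t0 > 0 its maximum
over [0, t0], then v(t0) >= 0.  As I^alpha is I^beta I^(alpha - beta) up to a
constant, the principle of order beta applies to I^(alpha - beta) v too, so that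
the left-hand side of the equation is nonnegative at a point where x is
maximal over the past.  Hence the barrier principle [barrier]: if the left-hand side is
negative whenever e < x(t) <= r, then x, once started below e, stays below e.

Near the origin the nonlinearity N has a Lipschitz constant at most b / 2, so
the term - b x dominates it, and the barrier principle gives
- the bound |x| <= eps, as soon as |x0| <= eps and |g| <= b eps / 8
  ([apriori_bound]);
- uniqueness, applied to the difference of two solutions ([difference_le0]);
- decay, applied to x - M (1 + t)^(- gamma) ([decay_above]).  The fractional
  derivatives of orders alpha and beta of (1 + t)^(- gamma) are of smaller order
  than this function itself ([comparison]), which makes it a supersolution for
  large t provided that g decays like a power.  It does: g is, up to a constant,
  I^(1 - alpha) applied to the derivative of (t + 1)^sigma h, and this derivative
  decays faster than t^(alpha - 1), because sigma < alpha and
  sigma + eta < alpha - 1 ([forcing_decay]).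

Existence follows by Picard iteration in a norm weighted by an exponential,
after freezing the nonlinearity outside a small interval
([volterra_solution], [truncated_existence]); the bound |x| <= eps shows that
the solution never meets the frozen part.

Finally x oscillates.  Applying c I^alpha to the equation expresses
(t + 1)^sigma h(t) through x, I^(alpha - beta) x and - I^alpha (- b x + N).  If x were
eventually nonnegative, then - b x + N would eventually be nonpositive by the
sign condition on f_k, and (t + 1)^sigma h(t) would be bounded below by
- C (t + 1)^(alpha - beta) ([forcing_lower_bound]).  This is impossible, as
sigma > alpha - beta and h takes values below some - d < 0 at arbitrarily large
times.  The case of an eventually nonpositive x is symmetric.
*)

(** * Affine substitution and the power kernel *)

Section Affine.
Context {R : realType}.
Notation mu := (@lebesgue_measure R).

Let aff (c d : R) (x : measurableTypeR R) : measurableTypeR R := c * x + d.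

Let measurable_aff c d : measurable_fun setT (aff c d).
Proof.
apply: (@continuous_measurable_fun R) => x.
apply: cvgD; last exact: cvg_cst.
by apply: cvgM; [exact: cvg_cst|exact: cvg_id].
Qed.

(** Lebesgue measure is characterised by its values on intervals, and the
scaled pushforward by an affine map has the same values. *)
Lemma lebesgue_measure_affine (c d : R) (c0 : 0 < c) (A : set (measurableTypeR R)) :
  measurable A ->
  mu A = (c%:E * mu (aff c d @^-1` A))%E.
Proof.
move=> mA.
pose HM := isMeasurableFun.Build _ _ _ _ _ (measurable_aff c d).
pose phi : {mfun measurableTypeR R >-> measurableTypeR R} := HB.pack (aff c d) HM.
apply: (@lebesgue_measure_unique R
  (mscale (NngNum (ltW c0)) (pushforward mu phi)) _ A mA) => X /ocitvP[->|[[a b] /= ab ->]].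
  by rewrite !measure0.
rewrite /mscale/= /pushforward.
have -> : phi @^-1` `]a, b] = `](a - d) / c, (b - d) / c]%classic.
  apply/seteqP; split => x /=; rewrite !in_itv/= /aff ltr_pdivrMr// ler_pdivlMr//.
    by move=> /andP[h1 h2]; apply/andP; split; lra.
  by move=> /andP[h1 h2]; apply/andP; split; lra.
rewrite !lebesgue_measure_itv/= !lte_fin ltr_pM2r ?invr_gt0// ltrD2r.
case: ifPn => _; last by rewrite mule0.
by rewrite -!EFinB -EFinM; congr (_%:E); field; rewrite gt_eqF.
Qed.

Lemma ge0_integral_affine (c d : R) (c0 : 0 < c) (f : R -> \bar R) :
  measurable_fun setT f -> (forall x, 0 <= f x)%E ->
  (\int[mu]_x f x = c%:E * \int[mu]_x f (c * x + d)%R)%E.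
Proof.
move=> mf f0.
pose HM := isMeasurableFun.Build _ _ _ _ _ (measurable_aff c d).
pose phi : {mfun measurableTypeR R >-> measurableTypeR R} := HB.pack (aff c d) HM.
rewrite (eq_measure_integral (mscale (NngNum (ltW c0)) (pushforward mu phi))); last first.
  by move=> A mA _; exact: (lebesgue_measure_affine d c0 mA).
rewrite ge0_integral_mscale//; congr (_ * _)%E.
by rewrite ge0_integral_pushforward ?preimage_setT//; exact: measurable_funP.
Qed.

(** Transporting every integral to [0, 1] makes the domain independent of the
endpoints, which are then parameters of the integrand only. *)
Lemma ge0_integral_itv01 (p q : R) (pq : p < q) (f : R -> R) :
  measurable_fun setT f -> (forall x, 0 <= f x) ->
  (\int[mu]_(x in `[p, q]) (f x)%:E =
   (q - p)%:E * \int[mu]_(y in `[0%R, 1%R]) (f ((q - p) * y + p)%R)%:E)%E.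
Proof.
move=> mf f0; have qp : 0 < q - p by rewrite subr_gt0.
have mEf : measurable_fun setT (EFin \o f) by exact/measurable_EFinP.
rewrite integral_mkcond [in RHS]integral_mkcond.
rewrite (ge0_integral_affine p qp); last 2 first.
- by apply/(measurable_restrictT (EFin \o f)) => //; exact: measurable_funTS.
- by move=> x; apply: erestrict_ge0 => y _; rewrite lee_fin.
congr (_ * _)%E; apply: eq_integral => x _; rewrite !patchE.
congr (if _ then _ else _).
apply/idP/idP; rewrite !inE/= !in_itv/= => /andP[h1 h2]; apply/andP; split; nra.
Qed.
End Affine.

Section Kernel.
Context {R : realType}.
Notation mu := (@lebesgue_measure R).

Lemma FTC2_cc (f F : R -> R) (a b : R) : a < b ->
  (forall x, a <= x <= b -> is_derive x (1:R) F (f x)) ->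
  {within `[a, b], continuous f} ->
  (\int[mu]_(x in `[a, b]) (f x)%:E = (F b - F a)%:E)%E.
Proof.
move=> ab dF cf.
have cF x : a <= x <= b -> {for x, continuous F}.
  by move=> /dF [d _]; exact/differentiable_continuous/derivable1_diffP.
rewrite (continuous_FTC2 (F := F)) ?EFinB//.
  split.
  - by move=> x; rewrite in_itv/= => /andP[/ltW h1 /ltW h2]; case: (dF x); rewrite ?h1 ?h2.
  - by apply: cvg_at_right_filter; apply: cF; rewrite lexx ltW.
  - by apply: cvg_at_left_filter; apply: cF; rewrite lexx ltW.
move=> x; rewrite in_itv/= => /andP[/ltW h1 /ltW h2]; rewrite derive1E.
by case: (dF x); rewrite ?h1 ?h2.
Qed.

Lemma measurable_ker (a t : R) : measurable_fun setT (fun s : R => (t - s) `^ a).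
Proof.
apply: (@measurableT_comp _ _ _ _ _ _ (fun x : R => x `^ a)).
  exact: measurable_powR.
exact: measurable_funB.
Qed.

Lemma ker_cont (a t s : R) : s < t -> {for s, continuous (fun s : R => (t - s) `^ a)}.
Proof.
move=> st; apply: (@continuous_comp _ _ _ (fun s => t - s) (fun x : R => x `^ a)).
  by apply: cvgB; [exact: cvg_cst|exact: cvg_id].
apply/differentiable_continuous/derivable1_diffP.
by apply: derivable_powR; rewrite in_itv/= subr_gt0 st.
Qed.

Lemma is_derive_ker (a s : R) : s < 1 -> a != 0 ->
  is_derive s (1:R) (fun s : R => - (1 - s) `^ a / a) ((1 - s) `^ (a - 1)).
Proof.
move=> s1 a0; have s10 : 0 < 1 - s by rewrite subr_gt0.
have := is_derive1_powR a s10 => H.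
have H1 : is_derive s (1:R) (fun s : R => 1 - s) (-1).
  by have := is_deriveB (is_derive_cst (1:R) s 1) (is_derive_id s (1:R)); rewrite sub0r.
have := @is_derive1_comp _ (fun x : R => x `^ a) (fun s : R => 1 - s) s _ _ H H1.
rewrite /comp => H2.
have -> : (fun s : R => - (1 - s) `^ a / a) = (- a^-1) *: (fun s : R => (1 - s) `^ a).
  by apply/funext => x; rewrite scalrfctE mulrC mulrN -mulNr.
apply: is_derive_eq; rewrite /GRing.scale/=; field.
exact: a0.
Qed.

(** The kernel is unbounded at s = 1 when a < 1: the explicit primitive is used
on [0, 1 - 1/(n+2)], and monotone convergence does the rest. *)
Lemma ker_lty (a : R) : 0 < a ->
  (\int[mu]_(s in `[0%R, 1%R]) ((1 - s) `^ (a - 1))%:E <= (a^-1)%:E)%E.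
Proof.
move=> a0.
rewrite -integral_itv_bndo_bndc; last first.
  by apply/measurable_EFinP; apply: measurable_funTS; exact: measurable_ker.
pose F (n : nat) := `[0, 1 - n.+2%:R^-1 : R]%classic.
have FE : `[0, 1[%classic = \bigcup_n F n.
  apply/seteqP; split => x /=; rewrite in_itv/=.
    move=> /andP[x0 x1]; have [k hk] := ltr_add_invr x1.
    exists k => //; rewrite /F/= in_itv/= x0/=.
    have : k.+2%:R^-1 <= k.+1%:R^-1 :> R by rewrite lef_pV2 ?posrE// ler_nat.
    by move: hk; move: (k.+2%:R^-1) (k.+1%:R^-1) => u w; lra.
  move=> [n _]; rewrite /F/= in_itv/= => /andP[x0 xn]; rewrite x0/=.
  by apply: (le_lt_trans xn); rewrite ltrBlDr ltrDl invr_gt0.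
rewrite FE.
have h : (\int[mu]_(s in F i) ((1 - s) `^ (a - 1))%:E @[i --> \oo] -->
    \int[mu]_(s in \bigcup_i F i) ((1 - s) `^ (a - 1))%:E)%E.
  apply: ge0_nondecreasing_set_cvg_integral.
  - move=> m n mn; apply/subsetPset => x; rewrite /F/= !in_itv/= => /andP[-> /=] /le_trans; apply.
    by rewrite lerD2l lerN2 lef_pV2 ?posrE// ler_nat.
  - by move=> i; exact: measurable_itv.
  - by move=> i; apply/measurable_EFinP; apply: measurable_funTS; exact: measurable_ker.
  - by move=> i x _; rewrite lee_fin powR_ge0.
apply: (cvge_to_le h).
near=> n; rewrite /F.
have n2 : 0 < n.+2%:R^-1 :> R by rewrite invr_gt0.
have n21 : n.+2%:R^-1 < 1 :> R by rewrite invf_lt1// ltr1n.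
have dF (x : R) : 0 <= x <= 1 - n.+2%:R^-1 ->
    is_derive x (1:R) (fun s : R => - (1 - s) `^ a / a) ((1 - x) `^ (a - 1)).
  move=> /andP[x0 x1]; apply: is_derive_ker; rewrite ?gt_eqF//.
  by apply: (le_lt_trans x1); rewrite ltrBlDr ltrDl.
rewrite (FTC2_cc _ dF); last 2 first.
- by rewrite subr_gt0.
- apply: continuous_in_subspaceT => x; rewrite inE/= in_itv/= => /andP[x0 x1].
  by apply: ker_cont; apply: (le_lt_trans x1); rewrite ltrBlDr ltrDl.
rewrite lee_fin subr0 powR1 mulN1r opprK gerDr mulNr oppr_le0.
by rewrite mulr_ge0 ?powR_ge0// invr_ge0 ltW.
Unshelve. all: by end_near. Qed.
End Kernel.

(** * The fractional integral *)

(** The Riemann-Liouville integral without the factor 1 / Gamma(a), which would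
only rescale constants. *)
HB.lock Definition RL {R : realType} (a : R) (v : R -> R) (t : R) : R :=
  \int[@lebesgue_measure R]_(s in `[0, t]) ((t - s) `^ (a - 1) * v s).

Section RL.
Context {R : realType}.
Notation mu := (@lebesgue_measure R).
Implicit Types (a b t r s : R) (u v w : R -> R).

Lemma RLE a v t : RL a v t = \int[mu]_(s in `[0, t]) ((t - s) `^ (a - 1) * v s).
Proof. by rewrite unlock. Qed.

Definition RLc a : R := RL a (cst 1) 1.

Lemma ker_rescale a t r y : r <= t -> 0 <= y <= 1 ->
  (t - ((t - r) * y + r)) `^ (a - 1) = (t - r) `^ (a - 1) * (1 - y) `^ (a - 1).
Proof.
move=> rt /andP[y0 y1]; rewrite -powRM ?subr_ge0//.
by congr (_ `^ _); ring.
Qed.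

(** The homogeneity of the kernel turns the substitution s = (t - r) y + r into
an overall factor (t - r)^a. *)
Lemma ge0_integral_ker a t r v : 0 < a -> r < t -> measurable_fun setT v ->
  (forall s, 0 <= v s) ->
  (\int[mu]_(s in `[r, t]) ((t - s) `^ (a - 1) * v s)%:E =
   ((t - r) `^ a)%:E *
   \int[mu]_(y in `[0%R, 1%R]) ((1 - y) `^ (a - 1) * v ((t - r) * y + r))%R%:E)%E.
Proof.
move=> a0 rt mv v0; have tr : 0 < t - r by rewrite subr_gt0.
have mker p := @measurable_ker R (a - 1) p.
have mkv : measurable_fun setT (fun s => (t - s) `^ (a - 1) * v s).
  exact: measurable_funM.
have kv0 s : 0 <= (t - s) `^ (a - 1) * v s by rewrite mulr_ge0// powR_ge0.
rewrite (ge0_integral_itv01 rt mkv kv0).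
rewrite -(mulr_powRB1 (ltW tr) a0) [in RHS]EFinM -muleA; congr (_ * _)%E.
have mE : measurable_fun setT
    (EFin \o (fun y => (1 - y) `^ (a - 1) * v ((t - r) * y + r))).
  apply/measurable_EFinP; apply: measurable_funM => //.
  apply: (measurableT_comp mv); apply: continuous_measurable_fun => x.
  by apply: cvgD; [apply: cvgM; [exact: cvg_cst|exact: cvg_id]|exact: cvg_cst].
rewrite -ge0_integralZl//; first last.
- by rewrite lee_fin powR_ge0.
- by move=> x _; rewrite lee_fin mulr_ge0// powR_ge0.
- exact: measurable_funTS mE.
apply: eq_integral => y; rewrite inE/= in_itv/= => y01.
rewrite ker_rescale//; last exact: ltW.
by rewrite -mulrA EFinM.
Qed.

Lemma ker_integrable a t r : 0 < a -> r <= t ->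
  mu.-integrable `[r, t] (EFin \o (fun s => (t - s) `^ (a - 1))).
Proof.
move=> a0; rewrite le_eqVlt => /predU1P[<-|rt].
  rewrite set_itv1; apply: null_set_integrable => //; last exact: lebesgue_measure_set1.
  exact: measurable_fun_set1.
apply/integrableP; split.
  by apply/measurable_EFinP; apply: measurable_funTS; exact: measurable_ker.
have := @ge0_integral_ker a t r (cst 1) a0 rt (measurable_cst _) (fun=> ler01).
under eq_integral do rewrite mulr1.
under [in X in _ = X -> _]eq_integral do rewrite mulr1.
move=> E; under eq_integral do rewrite /= ger0_norm ?powR_ge0//.
rewrite E; apply: le_lt_trans (ltry ((t - r) `^ a * a^-1)).
by rewrite EFinM lee_wpmul2l ?lee_fin ?powR_ge0// ker_lty.
Qed.

Lemma continuous_bounded_itv v r t : continuous v -> [bounded v x | x in `[r, t]].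
Proof.
move=> cv; have cvw : {within `[r, t], continuous v}.
  exact: continuous_subspaceT.
have /compact_bounded[M [_ mrt]] := continuous_compact cvw (@segment_compact _ r t).
by exists M; split; rewrite ?num_real // => ? ? ? ?; exact: mrt.
Qed.

Lemma ker_integrableM a t r v : 0 < a -> continuous v ->
  mu.-integrable `[r, t] (EFin \o (fun s => (t - s) `^ (a - 1) * v s)).
Proof.
move=> a0 cv; have [rt|tr] := leP r t; last first.
  by rewrite set_itv_ge ?bnd_simp -?ltNge//; exact: integrable_set0.
have := @integrableMl _ _ R mu `[r, t] _ _ v (@ker_integrable a t r a0 rt).
apply => //.
- by apply: measurable_funTS; exact: continuous_measurable_fun.
- exact: continuous_bounded_itv.
Qed.

Lemma RLD a u v t : 0 < a -> continuous u -> continuous v ->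
  RL a (fun s => u s + v s) t = RL a u t + RL a v t.
Proof.
move=> a0 cu cv; rewrite !RLE -RintegralD//; [|exact: ker_integrableM..].
by apply: eq_Rintegral => s _; rewrite mulrDr.
Qed.

Lemma RLZ a k v t : 0 < a -> continuous v ->
  RL a (fun s => k * v s) t = k * RL a v t.
Proof.
move=> a0 cv; rewrite !RLE -RintegralZl//; last exact: ker_integrableM.
by apply: eq_Rintegral => s _; rewrite mulrCA.
Qed.

Lemma RL_eq a u v t : (forall s, 0 <= s <= t -> u s = v s) -> RL a u t = RL a v t.
Proof.
by move=> uv; rewrite !RLE; apply: eq_Rintegral => s; rewrite inE/= in_itv/= => /uv ->.
Qed.

Lemma RLN a v t : 0 < a -> continuous v -> RL a (fun s => - v s) t = - RL a v t.
Proof.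
move=> a0 cv; rewrite -mulN1r -RLZ//.
by apply: RL_eq => s _; rewrite mulN1r.
Qed.

Lemma RL_affineN a k v t (x0 : R) : 0 < a -> continuous v ->
  - x0 + k * RL a (fun s => - v s) t = - (x0 + k * RL a v t).
Proof. by move=> a0 cv; rewrite RLN//; ring. Qed.

Lemma RLB a u v t : 0 < a -> continuous u -> continuous v ->
  RL a (fun s => u s - v s) t = RL a u t - RL a v t.
Proof.
move=> a0 cu cv; rewrite RLD// ?RLN// => x.
by apply: cvgN; exact: cv.
Qed.

Lemma RL_le a u v t : 0 < a -> continuous u -> continuous v ->
  (forall s, 0 <= s <= t -> u s <= v s) -> RL a u t <= RL a v t.
Proof.
move=> a0 cu cv uv; rewrite !RLE; apply: le_Rintegral => //; [exact: ker_integrableM..|].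
by move=> s /=; rewrite in_itv/= => /uv h; rewrite ler_wpM2l ?powR_ge0.
Qed.

Lemma RL_le0 a v t : t <= 0 -> RL a v t = 0.
Proof.
rewrite le_eqVlt => /predU1P[->|t0]; first by rewrite RLE set_itv1 Rintegral_set1.
by rewrite RLE set_itv_ge ?bnd_simp -?ltNge// Rintegral_set0.
Qed.

Lemma RL_ge0 a v t : 0 < a -> (forall s, 0 <= s <= t -> 0 <= v s) -> 0 <= RL a v t.
Proof.
move=> a0 v0; rewrite RLE; apply: Rintegral_ge0 => s /=; rewrite in_itv/= => /v0 h.
by rewrite mulr_ge0// powR_ge0.
Qed.

Let RL_scale_ge0 a v t : 0 < a -> 0 < t -> continuous v -> (forall s, 0 <= v s) ->
  RL a v t = t `^ a * RL a (fun y => v (t * y)) 1.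
Proof.
move=> a0 t0 cv v0; rewrite !RLE /Rintegral ge0_integral_ker//; last first.
  exact: continuous_measurable_fun.
rewrite subr0; under [in LHS]eq_integral do rewrite addr0.
rewrite fineM//; apply: integrable_fin_num => //.
apply: ker_integrableM => // x.
apply: (@continuous_comp _ _ _ ( *%R t) v); last exact: cv.
by apply: cvgM; [exact: cvg_cst|exact: cvg_id].
Qed.

Definition pospart v s : R := Num.max (v s) 0.

Lemma pospart_cont v : continuous v -> continuous (pospart v).
Proof. by move=> cv x; apply: (@continuous_max _ _ v (cst 0)); [exact: cv|exact: cvg_cst]. Qed.

Lemma pospart_ge0 v s : 0 <= pospart v s.
Proof. by rewrite /pospart le_max lexx orbT. Qed.

Lemma pospartB v s : pospart v s - pospart (fun s => - v s) s = v s.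
Proof.
rewrite /pospart; case: (leP (v s) 0) => h.
  by rewrite max_l ?oppr_ge0// sub0r opprK.
by rewrite max_r ?oppr_le0 ?ltW// subr0.
Qed.

(** After the substitution s = t y, the endpoint t occurs only inside the
continuous function v, which gives the continuity of the fractional integral in t.
Nonnegative integrands come first, the general case follows by taking positive and
negative parts. *)
Lemma RL_scale a v t : 0 < a -> 0 <= t -> continuous v ->
  RL a v t = t `^ a * RL a (fun y => v (t * y)) 1.
Proof.
move=> a0; rewrite le_eqVlt => /predU1P[<- _|t0 cv].
  by rewrite RL_le0// powR0 ?mul0r// gt_eqF.
have cNv : continuous (fun s => - v s) by move=> x; apply: cvgN; exact: cv.
have cM u : continuous u -> continuous (fun y => u (t * y)).
  move=> cu x; apply: (@continuous_comp _ _ _ ( *%R t) u); last exact: cu.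
  by apply: cvgM; [exact: cvg_cst|exact: cvg_id].
have E s : v s = pospart v s - pospart (fun s => - v s) s by rewrite pospartB.
rewrite (@RL_eq _ _ (fun s => pospart v s - pospart (fun s => - v s) s)) //.
rewrite (RLB _ a0 (pospart_cont cv) (pospart_cont cNv)).
rewrite (@RL_eq _ (fun y => v (t * y))
  (fun y => pospart v (t * y) - pospart (fun s => - v s) (t * y))) //.
rewrite (RLB _ a0 (cM _ (pospart_cont cv)) (cM _ (pospart_cont cNv))) mulrBr.
by rewrite (RL_scale_ge0 a0 t0 (pospart_cont cv) (pospart_ge0 v))
           (RL_scale_ge0 a0 t0 (pospart_cont cNv) (pospart_ge0 _)).
Qed.

Lemma RL_cst a k t : 0 < a -> 0 <= t -> RL a (cst k) t = k * RLc a * t `^ a.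
Proof.
move=> a0 t0; rewrite RL_scale//; last by move=> x; exact: cvg_cst.
rewrite (@RL_eq _ _ (fun s => k * cst 1 s)); last by move=> s _; rewrite /= mulr1.
by rewrite RLZ// 1?mulrC// => x; exact: cvg_cst.
Qed.

End RL.

(** * Elementary estimates *)

Section RLprops.
Context {R : realType}.
Notation mu := (@lebesgue_measure R).
Implicit Types (a b t r s k S : R) (u v w : R -> R).

Lemma cst_cont k : continuous (cst k : R -> R).
Proof. by move=> x; exact: cvg_cst. Qed.

Lemma max0_cont : continuous (fun t : R => Num.max t 0).
Proof.
by move=> t; apply: (@continuous_max _ _ id (cst 0)); [exact: cvg_id|exact: cvg_cst].
Qed.

Lemma max0_ge0 t : 0 <= Num.max t 0.
Proof. by rewrite le_max lexx orbT. Qed.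

(** Separates the memory over [0, r] from the recent contribution; all later
estimates bound the two parts by different means. *)
Lemma RL_split a v r t : 0 < a -> continuous v -> 0 <= r -> r <= t ->
  RL a v t = \int[mu]_(s in `[0, r]) ((t - s) `^ (a - 1) * v s) +
             \int[mu]_(s in `[r, t]) ((t - s) `^ (a - 1) * v s).
Proof.
move=> a0 cv r0 rt; have I p := @ker_integrableM R a t p v a0 cv.
have := @Rintegral_itvB R (fun s => (t - s) `^ (a - 1) * v s) (BLeft 0) (BRight t) r.
rewrite -RLE !bnd_simp => H.
have I' : mu.-integrable `]r, t] (EFin \o (fun s => (t - s) `^ (a - 1) * v s)).
  have IR := I r.
  by apply: integrableS IR => //; apply: subset_itvr; rewrite bnd_simp.
rewrite -(Rintegral_itv_obnd_cbnd I').
rewrite -H//; first by rewrite addrC subrK.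
Qed.

Lemma ker_tail a r t : 0 < a -> r <= t ->
  \int[mu]_(s in `[r, t]) ((t - s) `^ (a - 1) * 1) = RLc a * (t - r) `^ a.
Proof.
move=> a0; rewrite le_eqVlt => /predU1P[->|rt].
  by rewrite set_itv1 Rintegral_set1 subrr powR0 ?mulr0// gt_eqF.
rewrite {1}/Rintegral (@ge0_integral_ker _ _ _ _ (cst 1) a0 rt)//; last first.
rewrite fineM//; first by rewrite mulrC /RLc RLE.
apply: integrable_fin_num => //.
apply: (@ker_integrableM R a 1 0 (cst 1)) => //.
exact: cst_cont.
Qed.

(** The integral over [0, 1/2], away from the singularity, is explicit and
positive. *)
Lemma RLc_gt0 a : 0 < a -> 0 < RLc a.
Proof.
move=> a0; rewrite /RLc.
have h2 : 0 <= 2^-1 :> R by rewrite invr_ge0.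
have h21 : 2^-1 <= 1 :> R by rewrite invf_le1// ler1n.
have -> := @RL_split a (cst 1) 2^-1 1 a0 (@cst_cont _) h2 h21.
rewrite ltr_wpDr//.
  by apply: Rintegral_ge0 => s _; rewrite mulr_ge0// powR_ge0.
have dF (x : R) : 0 <= x <= 2^-1 ->
    is_derive x (1:R) (fun s : R => - (1 - s) `^ a / a) ((1 - x) `^ (a - 1)).
  move=> /andP[x0 x1]; apply: is_derive_ker; rewrite ?gt_eqF//.
  by apply: (le_lt_trans x1); rewrite invf_lt1// ltr1n.
rewrite /Rintegral; under eq_integral do rewrite mulr1.
rewrite (FTC2_cc _ dF) ?invr_gt0//; last first.
  apply: continuous_in_subspaceT => x; rewrite inE/= in_itv/= => /andP[x0 x1].
  by apply: ker_cont; apply: (le_lt_trans x1); rewrite invf_lt1// ltr1n.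
rewrite /= subr0 powR1 -mulrBl mulr_gt0 ?invr_gt0// opprK addrC subr_gt0.
have -> : 1 - 2^-1 = 2^-1 :> R by field.
have := @gt0_ltr_powR R a a0 2^-1 1; rewrite powR1; apply; rewrite ?nnegrE//.
by rewrite invf_lt1// ltr1n.
Qed.

Lemma RL_tail_le a v r t S : 0 < a -> continuous v -> r <= t ->
  (forall s, r <= s <= t -> v s <= S) ->
  \int[mu]_(s in `[r, t]) ((t - s) `^ (a - 1) * v s) <= S * RLc a * (t - r) `^ a.
Proof.
move=> a0 cv rt vS; rewrite -mulrA -(ker_tail a0 rt) -RintegralZl//; last first.
  exact: (@ker_integrableM R a t r (cst 1) a0 (@cst_cont _)).
apply: le_Rintegral => //; first exact: ker_integrableM.
  rewrite (_ : _ \o _ = EFin \o (fun s => (t - s) `^ (a - 1) * cst S s)).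
    exact: ker_integrableM a0 (@cst_cont _).
  by apply/funext => s /=; rewrite mulr1 mulrC.
move=> s /=; rewrite in_itv/= => /vS h.
by rewrite mulr1 mulrC ler_wpM2r// powR_ge0.
Qed.

Lemma RL_tail_ge a v r t S : 0 < a -> continuous v -> r <= t ->
  (forall s, r <= s <= t -> S <= v s) ->
  S * RLc a * (t - r) `^ a <= \int[mu]_(s in `[r, t]) ((t - s) `^ (a - 1) * v s).
Proof.
move=> a0 cv rt vS; rewrite -mulrA -(ker_tail a0 rt) -RintegralZl//; last first.
  exact: (@ker_integrableM R a t r (cst 1) a0 (@cst_cont _)).
apply: le_Rintegral => //; last 2 first.
- exact: ker_integrableM.
- move=> s /=; rewrite in_itv/= => /vS h.
  by rewrite mulr1 mulrC ler_wpM2l// powR_ge0.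
rewrite (_ : _ \o _ = EFin \o (fun s => (t - s) `^ (a - 1) * cst S s)).
  exact: ker_integrableM a0 (@cst_cont _).
by apply/funext => s /=; rewrite mulr1 mulrC.
Qed.

Lemma RL_gt0 a v t : 0 < a -> continuous v -> 0 < t ->
  (forall s, 0 <= s <= t -> 0 <= v s) -> 0 < v t -> 0 < RL a v t.
Proof.
move=> a0 cv t0 v0 vt.
have : \forall s \near t, v t / 2 < v s.
  by apply: (cvgr_gt (v t) (cv t)); rewrite ltr_pdivrMr// ltr_pMr// ltr1n.
move=> [d /= d0 hd].
pose r := Num.max 0 (t - d / 2).
have rt : r < t by rewrite gt_max t0/= ltrBlDr ltrDl divr_gt0.
have r0 : 0 <= r by rewrite le_max lexx.
rewrite (RL_split a0 cv r0 (ltW rt)) ltr_wpDl//.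
  apply: Rintegral_ge0 => s /=; rewrite in_itv/= => /andP[s0 sr].
  by rewrite mulr_ge0 ?powR_ge0// v0// s0 (le_trans sr)// ltW.
apply: lt_le_trans (@RL_tail_ge a v r t (v t / 2) a0 cv (ltW rt) _).
  by apply: mulr_gt0; [rewrite !mulr_gt0 ?invr_gt0 ?RLc_gt0|rewrite powR_gt0// subr_gt0].
move=> s /andP[rs st]; apply/ltW/hd => /=.
have : t - d / 2 <= s by apply: le_trans rs; rewrite le_max lexx orbT.
by move=> h; rewrite ger0_norm ?subr_ge0//; move: h d0; rewrite /=; lra.
Qed.

Lemma powR_anti a (x y : R) : a <= 0 -> 0 < x -> x <= y -> y `^ a <= x `^ a.
Proof.
move=> a0 x0 xy; rewrite -[a]opprK 2!(powRN _ (- a)) lef_pV2 ?posrE ?powR_gt0//.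
- by rewrite ge0_ler_powR// ?oppr_ge0// nnegrE ltW// (lt_le_trans x0).
- exact: (lt_le_trans x0).
Qed.

(** The kernel (t - s)^(a - 1) decreases in t, so a nonnegative past weighs less
at time t than at time r; only the recent contribution can increase the
integral. *)
Lemma RL_incr_le a u r t S : 0 < a -> a <= 1 -> continuous u -> 0 <= r -> r <= t ->
  (forall s, 0 <= s <= r -> 0 <= u s) -> (forall s, r <= s <= t -> u s <= S) ->
  RL a u t <= RL a u r + S * RLc a * (t - r) `^ a.
Proof.
move=> a0 a1 cu r0 rt u0 uS; rewrite (RL_split a0 cu r0 rt) lerD ?RL_tail_le//.
have I p : r <= p -> mu.-integrable `[0, r[ (EFin \o (fun s => (p - s) `^ (a - 1) * u s)).
  move=> rp; have IR := @ker_integrableM R a p 0 u a0 cu.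
  by apply: integrableS IR => //; apply: subset_itvl; rewrite bnd_simp.
rewrite !RLE -!Rintegral_itv_bndo_bndc; [|exact: I..].
apply: le_Rintegral; [by []|exact: I|exact: I|] => s /=; rewrite in_itv/= => /andP[s0 sr].
apply: ler_wpM2r; first by rewrite u0// s0 ltW.
by apply: powR_anti; rewrite ?subr_le0 ?subr_gt0// lerD2r.
Qed.

Lemma RL1E v t : RL 1 v t = \int[mu]_(s in `[0, t]) v s.
Proof. by rewrite RLE; apply: eq_Rintegral => s _; rewrite subrr powRr0 mul1r. Qed.

(** On [0, r] the kernel is at most (t - r)^(a - 1), so the past is
controlled by its ordinary integral. *)
Lemma RL_split_le a u r t S : 0 < a -> a <= 1 -> continuous u -> 0 <= r -> r < t ->
  (forall s, 0 <= s <= r -> 0 <= u s) -> (forall s, r <= s <= t -> u s <= S) ->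
  RL a u t <= (t - r) `^ (a - 1) * RL 1 u r + S * RLc a * (t - r) `^ a.
Proof.
move=> a0 a1 cu r0 rt u0 uS.
have rt' := ltW rt; rewrite (RL_split a0 cu r0 rt') lerD ?RL_tail_le//.
have I1 : mu.-integrable `[0, r] (EFin \o u).
  by apply: continuous_compact_integrable; [exact: segment_compact|exact: continuous_subspaceT].
rewrite RL1E -RintegralZl; [|exact: measurable_itv|exact: I1].
apply: le_Rintegral => //.
- have IR := @ker_integrableM R a t 0 u a0 cu.
  by apply: integrableS IR => //; apply: subset_itvl; rewrite bnd_simp.
- apply: continuous_compact_integrable; first exact: segment_compact.
  by apply: continuous_subspaceT => x; apply: cvgM; [exact: cvg_cst|exact: cu].
move=> s /=; rewrite in_itv/= => /andP[s0 sr].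
apply: ler_wpM2r; first by rewrite u0// s0.
by apply: powR_anti; rewrite ?subr_le0 ?subr_gt0// lerD2l lerN2.
Qed.

Lemma RL1_derive v t : continuous v -> 0 < t -> is_derive t 1 (RL 1 v) (v t).
Proof.
move=> cv t0.
have I1 : mu.-integrable `[0, t + 1] (EFin \o v).
  by apply: continuous_compact_integrable; [exact: segment_compact|exact: continuous_subspaceT].
have tt1 : t < t + 1 by rewrite ltrDl.
have FE : (fun x => \int[mu]_(s in `[0, x]) v s) = RL 1 v.
  by apply/funext => x; rewrite RL1E.
have := @continuous_FTC1_closed R v 0 t (t + 1) tt1 I1 t0 (cv t).
rewrite /= FE => -[d1 d2]; constructor; first exact: d1.
by rewrite -derive1E d2.
Qed.

End RLprops.

(** * Continuity in time *)

Section RLcont.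
Context {R : realType}.
Notation mu := (@lebesgue_measure R).
Implicit Types (a b t r s k S : R) (u v w : R -> R).

Lemma powRmax_cont a : 0 < a -> continuous (fun t : R => (Num.max t 0) `^ a).
Proof.
move=> a0 t; have [t0|t0|t0] := ltgtP t 0.
- rewrite /continuous_at (max_r (ltW t0)).
  apply: (@cvg_trans _ ((fun _ : R => 0 `^ a : R) @ t)); last exact: (@cst_cont R (0 `^ a)).
  apply: near_eq_cvg; near=> s; rewrite max_r//.
  by apply/ltW; near: s; exact: lt_nbhsl.
- rewrite /continuous_at (max_l (ltW t0)).
  apply: (@cvg_trans _ ((fun s : R => s `^ a) @ t)).
    apply: near_eq_cvg; near=> s; rewrite max_l//.
    by apply/ltW; near: s; exact: lt_nbhsr.
  suff h : {for t, continuous (fun s : R => s `^ a)} by exact: h.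
  apply/differentiable_continuous/derivable1_diffP.
  by apply: derivable_powR; rewrite in_itv/= t0.
- rewrite t0 /continuous_at maxxx powR0 ?gt_eqF//.
  apply/cvgrPdist_lt => e e0; have H := powR_cvg0 a0.
  move/cvgrPdist_lt : H => /(_ e e0)[d /= d0 hd].
  exists d => // s /=; rewrite sub0r normrN => sd.
  have [s0|s0] := leP s 0; first by rewrite powR0 ?gt_eqF// subrr normr0.
  by apply: hd => //=; rewrite sub0r normrN.
Unshelve. all: by end_near. Qed.

(** The rescaled integral of [RL_scale], in which the dominated convergence
theorem applies on the fixed domain [0, 1]. *)
Let Phi a v T := RL a (fun y => v (T * y)) 1.

Let Phi_cont a v : 0 < a -> continuous v -> continuous (Phi a v).
Proof.
move=> a0 cv T0.
have cvp (f : R -> R) : continuous f -> continuous (v \o f).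
  by move=> cf x; apply: continuous_comp; [exact: cf|exact: cv].
have cml (T : R) : continuous (fun y => T * y).
  by move=> x; apply: cvgM; [exact: cvg_cst|exact: cvg_id].
have cmr (y : R) : continuous (fun T : R => T * y).
  by move=> x; apply: cvgM; [exact: cvg_id|exact: cvg_cst].
set L := `|T0| + 1.
have [M [_ hM]] := @continuous_bounded_itv R v (- L) L cv.
pose M1 := `|M| + 1.
have MM1 : M < M1 by rewrite /M1 (le_lt_trans (ler_norm _))// ltrDl.
have := @continuity_under_integral R _ _ mu
  (fun T y => (1 - y) `^ (a - 1) * v (T * y)) `[0, 1] (measurable_itv _) (T0 - 1) (T0 + 1).
move=> /(_ _ _ (fun y => (1 - y) `^ (a - 1) * M1)).
have -> : Phi a v = (fun T => \int[mu]_(y in `[0, 1]) ((1 - y) `^ (a - 1) * v (T * y))).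
  by apply/funext => T; rewrite /Phi RLE.
apply.
- move=> T _; exact: (@ker_integrableM R a 1 0 (v \o ( *%R T)) a0 (cvp _ (cml T))).
- apply: aeW => y _ T _; apply: cvgM; first exact: cvg_cst.
  exact: (cvp _ (cmr y)).
- exact: (@ker_integrableM R a 1 0 (cst M1) a0 (@cst_cont R _)).
- move=> T; rewrite /= in_itv/= => /andP[T1 T2].
  apply: aeW => y /=; rewrite in_itv/= => /andP[y0 y1].
  rewrite normrM ger0_norm ?powR_ge0// ler_wpM2l ?powR_ge0//.
  apply: hM => //=; rewrite in_itv/= -ler_norml normrM (ger0_norm y0).
  apply: (@le_trans _ _ (`|T| * 1)); first by rewrite ler_wpM2l.
  rewrite mulr1 ler_norml /L; have := ler_norm T0; have := ler_norm (- T0).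
  by rewrite normrN; lra.
- by rewrite inE/= in_itv/= ltrBlDr ltrDl ltr01.
Qed.

(** The formula of [RL_scale], made valid for every real t so that continuity can
be read off on the whole line. *)
Lemma RL_max a v t : 0 < a -> continuous v ->
  RL a v t = (Num.max t 0) `^ a * Phi a v (Num.max t 0).
Proof.
move=> a0 cv; case: (leP t 0) => t0.
  by rewrite powR0 ?gt_eqF// mul0r RL_le0.
by rewrite -RL_scale// ltW.
Qed.

Lemma RL_cont a v : 0 < a -> continuous v -> continuous (RL a v).
Proof.
move=> a0 cv.
have -> : RL a v = (fun t => (Num.max t 0) `^ a * Phi a v (Num.max t 0)).
  by apply/funext => t; exact: RL_max.
move=> t; apply: cvgM; first exact: powRmax_cont.
apply: (@continuous_comp _ _ _ (fun t => Num.max t 0) (Phi a v)).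
  exact: max0_cont.
exact: Phi_cont.
Qed.

Lemma RL_affine_cont a k v (x0 : R) : 0 < a -> continuous v ->
  continuous (fun t => x0 + k * RL a v t).
Proof.
move=> a0 cv t; apply: cvgD; first exact: cvg_cst.
by apply: cvgM; [exact: cvg_cst|exact: RL_cont].
Qed.

End RLcont.

(** * The semigroup law *)

Section Semigroup.
Context {R : realType}.
Notation mu := (@lebesgue_measure R).
Notation mR := (measurableTypeR R).
Implicit Types (a b t r s k S : R) (u v w : R -> R).

Let beta_int a b : \bar R :=
  (\int[mu]_(y in `[0%R, 1%R]) ((1 - y) `^ (a - 1) * y `^ (b - 1))%:E)%E.

(** The integrand of the double integral I^a I^b v (t), extended by zero outside
the triangle 0 <= r <= s <= t. *)
Let tri a b v t (z : mR * mR) : \bar R :=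
  (if (0 <= z.2) && (z.2 <= z.1) && (z.1 <= t) then
    (t - z.1) `^ (a - 1) * ((z.1 - z.2) `^ (b - 1) * v z.2) else 0)%:E.

Let tri_measurable a b v t : measurable_fun setT v ->
  measurable_fun setT (tri a b v t).
Proof.
move=> mv; apply/measurable_EFinP.
have m1 : measurable_fun setT (fun z : mR * mR => z.1 : R) by exact: measurable_fst.
have m2 : measurable_fun setT (fun z : mR * mR => z.2 : R) by exact: measurable_snd.
apply: measurable_fun_ifT => //.
- apply: measurable_and; first apply: measurable_and.
  + exact: measurable_fun_ler.
  + exact: measurable_fun_ler.
  + exact: measurable_fun_ler.
- apply: measurable_funM.
    apply: (@measurableT_comp _ _ _ _ _ _ (fun x : R => x `^ (a - 1))); first exact: measurable_powR.
    exact: measurable_funB.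
  apply: measurable_funM; last exact: measurableT_comp.
  apply: (@measurableT_comp _ _ _ _ _ _ (fun x : R => x `^ (b - 1))); first exact: measurable_powR.
  exact: measurable_funB.
Qed.

Let tri_ge0 a b v t z : (forall s, 0 <= v s) -> (0 <= tri a b v t z)%E.
Proof.
by move=> v0; rewrite /tri lee_fin; case: ifPn => // _; rewrite !mulr_ge0 ?powR_ge0.
Qed.

Let tri_in1 a b v t s : 0 < b -> continuous v -> (forall s, 0 <= v s) ->
  (\int[mu]_r tri a b v t (s, r))%E =
   ((EFin \o (fun s => (t - s) `^ (a - 1) * RL b v s)) \_ `[0, t]) s.
Proof.
move=> b0 cv v0; rewrite patchE; case: ifPn; rewrite ?inE ?notin_setE/= in_itv/=.
  move=> /andP[s0 st].
  have I := @ker_integrableM R b s 0 v b0 cv.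
  rewrite EFinM RLE /Rintegral fineK; last exact: (integrable_fin_num _ I).
  rewrite -ge0_integralZl//; first last.
  - by rewrite lee_fin powR_ge0.
  - by move=> x _; rewrite lee_fin mulr_ge0// powR_ge0.
  - exact: measurable_int I.
  rewrite [RHS]integral_mkcond; apply: eq_integral => r _.
  rewrite patchE /tri/= mem_setE in_itv/= st andbT.
  by case: ifPn => // _; rewrite EFinM.
move=> hs; apply: integral0_eq => r _; rewrite /tri/=; case: ifPn => // /andP[/andP[r0 rs] st].
by case: hs; rewrite st (le_trans r0 rs).
Qed.

Let tri_in2 a b v t r : 0 < a -> continuous v -> (forall s, 0 <= v s) -> r < t ->
  (\int[mu]_s tri a b v t (s, r))%E =
   ((fun r => beta_int a b * ((t - r) `^ (a + b - 1) * v r)%:E)%E \_ `[0, t]) r.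
Proof.
move=> a0 cv v0 rt; rewrite patchE mem_setE in_itv/= (ltW rt) andbT.
have tr : 0 < t - r by rewrite subr_gt0.
case: ifPn => r0; last first.
  by apply: integral0_eq => s _; rewrite /tri/= (negbTE r0).
transitivity (\int[mu]_(s in `[r, t]) ((t - s) `^ (a - 1) * ((s - r) `^ (b - 1) * v r))%:E)%E.
  rewrite [RHS]integral_mkcond; apply: eq_integral => s _.
  rewrite patchE /tri/= mem_setE in_itv/= r0/=.
  by case: ifPn.
have mw : measurable_fun setT (fun s : R => (s - r) `^ (b - 1) * v r).
  apply: measurable_funM; last exact: measurable_cst.
  apply: (@measurableT_comp _ _ _ _ _ _ (fun x : R => x `^ (b - 1))); first exact: measurable_powR.
  exact: measurable_funB.
rewrite (@ge0_integral_ker _ _ _ _ _ a0 rt mw); last by move=> s; rewrite mulr_ge0 ?powR_ge0.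
have mb : measurable_fun setT (EFin \o (fun y : R => (1 - y) `^ (a - 1) * y `^ (b - 1))).
  apply/measurable_EFinP; apply: measurable_funM; first exact: measurable_ker.
  exact: measurable_powR.
transitivity (((t - r) `^ a)%:E * (((t - r) `^ (b - 1) * v r)%:E * beta_int a b))%E.
  congr (_ * _)%E; rewrite -ge0_integralZl//; first last.
  - by rewrite lee_fin mulr_ge0// powR_ge0.
  - by move=> x _; rewrite lee_fin mulr_ge0// powR_ge0.
  - exact: measurable_funTS mb.
  apply: eq_integral => y; rewrite inE/= in_itv/= => /andP[y0 y1].
  by rewrite addrK powRM ?(ltW tr)// -EFinM; congr (_%:E); ring.
rewrite muleA -EFinM muleC; congr (_ * _%:E)%E.
by rewrite mulrA -powRD ?addrA// (gt_eqF tr) implybT.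
Qed.

Lemma RL_comp_ereal a b v t : 0 < a -> 0 < b -> continuous v -> (forall s, 0 <= v s) ->
  ((RL a (RL b v) t)%:E = beta_int a b * (RL (a + b) v t)%:E)%E.
Proof.
move=> a0 b0 cv v0; have ab0 : 0 < a + b by rewrite addr_gt0.
have cb := RL_cont b0 cv.
have mv : measurable_fun setT v by exact: continuous_measurable_fun.
have I1 := @ker_integrableM R a t 0 _ a0 cb.
have I2 := @ker_integrableM R (a + b) t 0 _ ab0 cv.
have := @fubini_tonelli _ _ mR mR R mu mu (tri a b v t) (tri_measurable a b t mv)
  (fun z => tri_ge0 a b t z v0).
have -> : (\int[mu]_x \int[mu]_y tri a b v t (x, y) = (RL a (RL b v) t)%:E)%E.
  rewrite RLE /Rintegral fineK; last exact: (integrable_fin_num _ I1).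
  by rewrite [RHS]integral_mkcond; apply: eq_integral => s _; exact: tri_in1.
move=> ->.
rewrite RLE /Rintegral fineK; last exact: (integrable_fin_num _ I2).
rewrite -ge0_integralZl//; first last.
- by apply: integral_ge0 => y _; rewrite lee_fin mulr_ge0// powR_ge0.
- by move=> x _; rewrite lee_fin mulr_ge0// powR_ge0.
- exact: measurable_int I2.
have mI : measurable_fun `[0, t] (EFin \o (fun s => (t - s) `^ (a + b - 1) * v s)).
  exact: measurable_int I2.
have sub : `[0, t[ `<=` `[0, t] by apply: subset_itvl; rewrite bnd_simp.
(* the endpoint r = t is dropped, as the inner integral degenerates there *)
rewrite -[RHS]integral_itv_bndo_bndc; last first.
  apply: measurable_funS sub _ => //.
  exact: (emeasurable_funM (measurable_cst _) mI).
have mG := @measurable_fun_fubini_tonelli_G _ _ mR mR R mu (tri a b v t)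
  (tri_measurable a b t mv) (fun z => tri_ge0 a b t z v0).
transitivity (\int[mu]_(r in `[0%R, t]) \int[mu]_s tri a b v t (s, r))%E.
  rewrite [RHS]integral_mkcond; apply: eq_integral => r _.
  rewrite patchE; case: ifPn => //; rewrite notin_setE/= in_itv/= => rt.
  apply: integral0_eq => s _; rewrite /tri/=; case: ifPn => // /andP[/andP[r0 rs] st].
  by case: rt; rewrite r0 (le_trans rs st).
rewrite -integral_itv_bndo_bndc; last exact: measurable_funTS mG.
apply: eq_integral => r; rewrite inE/= in_itv/= => /andP[r0 rt].
by rewrite (tri_in2 b a0 cv v0 rt) patchE mem_setE in_itv/= r0 ltW.
Qed.

Definition RLbeta a b : R := fine (beta_int a b).

Lemma RL_comp_gt0 a b : 0 < a -> 0 < b -> 0 < RL a (RL b (cst 1)) 1.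
Proof.
move=> a0 b0; apply: RL_gt0 => //.
- exact/RL_cont/cst_cont.
- by move=> s /andP[s0 _]; apply: RL_ge0.
- exact: RLc_gt0.
Qed.

(** Finiteness of the Beta integral is read off from [RL_comp_ereal] itself, for
v = 1: both fractional integrals are finite there and the right one is not 0. *)
Let beta_int_fin a b : 0 < a -> 0 < b -> beta_int a b = (RLbeta a b)%:E.
Proof.
move=> a0 b0; rewrite /RLbeta fineK//.
have := @RL_comp_ereal a b (cst 1) 1 a0 b0 (@cst_cont R 1) (fun=> ler01).
have c0 : 0 < RL (a + b) (cst 1) 1 by apply: RLc_gt0; rewrite addr_gt0.
have : (0 <= beta_int a b)%E.
  by apply: integral_ge0 => y _; rewrite lee_fin mulr_ge0// powR_ge0.
case: (beta_int a b) => // _.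
by rewrite mulyr gtr0_sg// mul1e.
Qed.

Lemma RLbeta_gt0 a b : 0 < a -> 0 < b -> 0 < RLbeta a b.
Proof.
move=> a0 b0.
have := @RL_comp_ereal a b (cst 1) 1 a0 b0 (@cst_cont R 1) (fun=> ler01).
have c0 : 0 < RL (a + b) (cst 1) 1 by apply: RLc_gt0; rewrite addr_gt0.
rewrite beta_int_fin// -EFinM => -[E].
by have := RL_comp_gt0 a0 b0; rewrite E pmulr_lgt0.
Qed.

Lemma integral_powR01 b : 0 < b ->
  (\int[mu]_(y in `[0%R, 1%R]) (y `^ (b - 1))%:E = (RLbeta 1 b)%:E)%E.
Proof.
move=> b0; rewrite -beta_int_fin//; apply: eq_integral => y _.
by rewrite subrr powRr0 mul1r.
Qed.

(** Tonelli's theorem for nonnegative v, then positive and negative parts.  The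
constant is a Beta integral, of which only the positivity matters. *)
Lemma RL_comp a b v t : 0 < a -> 0 < b -> continuous v ->
  RL a (RL b v) t = RLbeta a b * RL (a + b) v t.
Proof.
move=> a0 b0 cv; have ab0 : 0 < a + b by rewrite addr_gt0.
have cNv : continuous (fun s => - v s) by move=> x; apply: cvgN; exact: cv.
have P u : continuous u -> (forall s, 0 <= u s) ->
    RL a (RL b u) t = RLbeta a b * RL (a + b) u t.
  move=> cu u0; have := @RL_comp_ereal a b u t a0 b0 cu u0.
  by rewrite beta_int_fin// -EFinM => -[].
have cp := pospart_cont cv; have cn := pospart_cont cNv.
have vE : v = (fun s => pospart v s - pospart (fun s => - v s) s).
  by apply/funext => s; rewrite pospartB.
have E c s : 0 < c -> RL c v s = RL c (pospart v) s - RL c (pospart (fun s => - v s)) s.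
  by move=> c0; rewrite {1}vE RLB.
rewrite (@RL_eq _ a _ (fun s => RL b (pospart v) s - RL b (pospart (fun s => - v s)) s)); last first.
  by move=> s _; exact: E.
rewrite RLB; [|done|exact: RL_cont..].
by rewrite !P ?E ?mulrBr//; exact: pospart_ge0.
Qed.

End Semigroup.

(** * The extremum principle *)

Section Extremum.
Context {R : realType}.
Implicit Types (a b t r s k S : R) (u v w : R -> R).

Lemma RL1_incr_le v r t S : continuous v -> 0 <= r -> r <= t ->
  (forall s, r <= s <= t -> v s <= S) ->
  RL 1 v t <= RL 1 v r + S * RLc 1 * (t - r).
Proof.
move=> cv r0 rt vS.
have H := @RL_tail_le R 1 v r t S ltr01 cv rt vS; rewrite powRr1 ?subr_ge0// in H.
rewrite (RL_split ltr01 cv r0 rt); apply: lerD; last exact: H.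
rewrite RL1E le_eqVlt; apply/orP; left; apply/eqP.
by apply: eq_Rintegral => s _; rewrite subrr powRr0 mul1r.
Qed.

Lemma powR_concave_incr a r t : 0 < a -> a <= 1 -> 0 < r -> r <= t ->
  t `^ a - r `^ a <= t `^ (a - 1) * (t - r).
Proof.
move=> a0 a1 r0 rt; have t0 := lt_le_trans r0 rt.
have := @powR_anti R (a - 1) r t; rewrite subr_le0 => /(_ a1 r0 rt).
rewrite -(mulr_powRB1 (ltW r0) a0) -(mulr_powRB1 (ltW t0) a0).
by move: (r `^ (a - 1)) (t `^ (a - 1)) => x y; nra.
Qed.

Lemma RL_id a t : 0 < a -> 0 <= t -> RL a id t = RL a id 1 * (t `^ a * t).
Proof.
move=> a0 t0; rewrite RL_scale//; last by move=> x; exact: cvg_id.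
by rewrite RLZ//; [ring|move=> x; exact: cvg_id].
Qed.

(** Adding the affine function K - L s makes v nonnegative on [0, t0] and of size
at most 2 (e + L (t0 - r)) on [r, t0], so that [RL_incr_le] bounds the increment of
the integral; the fractional integrals of K and s are explicit, and that of K >= 0
has the favourable sign.  The coefficient of (t0 - r)^a in the bound is made small
through e, at the cost of a large L that affects only higher powers of t0 - r when a < 1:
this is what [RL_extremum] needs. *)
Lemma RL_left_modulus a v t0 e L r : 0 < a -> a <= 1 -> continuous v ->
  0 <= e -> 0 <= L -> 0 < r -> r <= t0 -> v t0 <= 0 ->
  (forall s, 0 <= s <= t0 -> `|v s - v t0| <= e + L * (t0 - s)) ->
  RL a v t0 - RL a v r <= 2 * (e + L * (t0 - r)) * RLc a * (t0 - r) `^ a +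
    2 * L * RL a id 1 * t0 `^ a * (t0 - r).
Proof.
move=> a0 a1 cv e0 L0 r0 rt vt0 hv; have t0_gt0 := lt_le_trans r0 rt.
pose K := - v t0 + e + L * t0.
have cid : continuous (@id R) by move=> x; exact: cvg_id.
have clin (k : R) : continuous (fun s => k * s).
  by move=> x; apply: cvgM; [exact: cvg_cst|exact: cvg_id].
have caff : continuous (fun s => cst K s + - L * s).
  by move=> x; apply: cvgD; [exact: cvg_cst|exact: clin].
pose u s := v s + (cst K s + - L * s).
have cu : continuous u by move=> x; apply: cvgD; [exact: cv|exact: caff].
have uE t : 0 <= t ->
    RL a u t = RL a v t + (K * RLc a * t `^ a - L * (RL a id 1 * (t `^ a * t))).
  move=> t_ge0; rewrite RLD// RLD//; last exact: cst_cont.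
  by rewrite RL_cst// RLZ// RL_id// mulNr.
have := @RL_incr_le R a u r t0 (2 * (e + L * (t0 - r))) a0 a1 cu (ltW r0) rt.
rewrite (uE _ (ltW r0)) (uE _ (ltW t0_gt0)) => H.
have D0 : 0 <= RL a id 1 by apply: RL_ge0 => // s /andP[].
have K0 : 0 <= K.
  by rewrite /K !addr_ge0// ?oppr_ge0// mulr_ge0// ltW.
have c0 := RLc_gt0 a0.
have P1 := powR_concave_incr a0 a1 r0 rt.
have Pr : 0 <= t0 `^ a - r `^ a.
  by rewrite subr_ge0; apply: ge0_ler_powR; rewrite ?nnegrE //; exact: ltW.
have P2 : t0 `^ a * t0 - r `^ a * r <= 2 * t0 `^ a * (t0 - r).
  move: P1 Pr; rewrite -(mulr_powRB1 (ltW t0_gt0) a0).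
  move: (t0 `^ (a - 1)) (r `^ a) (powR_ge0 t0 (a - 1)) => x y x0 h1 h2.
  have h3 : r * (t0 * x - y) <= r * (x * (t0 - r)) by rewrite ler_wpM2l// ltW.
  have h4 : r * (x * (t0 - r)) <= t0 * (x * (t0 - r)).
    by rewrite ler_wpM2r// mulr_ge0// subr_ge0.
  apply: (@le_trans _ _ (t0 * x * (t0 - r) + r * (t0 * x - y))).
    by rewrite le_eqVlt; apply/orP; left; apply/eqP; ring.
  apply: (@le_trans _ _ (t0 * x * (t0 - r) + t0 * (x * (t0 - r)))).
    by rewrite lerD2l (le_trans h3).
  by rewrite le_eqVlt; apply/orP; left; apply/eqP; ring.
have Q1 : K * RLc a * r `^ a <= K * RLc a * t0 `^ a.
  by rewrite ler_wpM2l ?mulr_ge0// ?(ltW c0)// -subr_ge0.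
have Q2 : L * (RL a id 1 * (t0 `^ a * t0)) - L * (RL a id 1 * (r `^ a * r)) <=
    2 * L * RL a id 1 * t0 `^ a * (t0 - r).
  have -> : 2 * L * RL a id 1 * t0 `^ a * (t0 - r) =
    L * (RL a id 1 * (2 * t0 `^ a * (t0 - r))) by ring.
  by rewrite -!mulrBr !ler_wpM2l.
suff : RL a v t0 + (K * RLc a * t0 `^ a - L * (RL a id 1 * (t0 `^ a * t0))) <=
    RL a v r + (K * RLc a * r `^ a - L * (RL a id 1 * (r `^ a * r))) +
    2 * (e + L * (t0 - r)) * RLc a * (t0 - r) `^ a.
  move: Q1 Q2; clear.
  move: (RL a v t0) (RL a v r) (K * RLc a * t0 `^ a) (K * RLc a * r `^ a)
    (L * (RL a id 1 * (t0 `^ a * t0))) (L * (RL a id 1 * (r `^ a * r)))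
    (2 * (e + _) * _ * _) (2 * L * _ * _ * _) => x1 x2 x3 x4 x5 x6 x7 x8; lra.
apply: H => s /andP[s1 s2].
- have := hv s; rewrite s1 (le_trans s2 rt) ler_norml => /(_ isT)/andP[h _].
  by rewrite /u /K /=; move: h; lra.
- have := hv s; rewrite (le_trans (ltW r0) s1) s2 ler_norml => /(_ isT)/andP[_ h].
  have : L * (t0 - s) <= L * (t0 - r) by rewrite ler_wpM2l// lerD2l lerN2.
  by rewrite /u /K /=; move: h; lra.
Qed.

(** Suppose v(t0) < 0, put y = I^a v and k = 1 - a, and compare two estimates of
the increment of I^k y = B I^1 v over the last h units of time.  As v is
negative near t0, this increment is at most - m h with m > 0.  On the other hand
z = y(t0) - y is nonnegative on [0, t0], and by [RL_left_modulus] it is at most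
C e h^a + O(h) on [t0 - h, t0]; hence by [RL_incr_le] the integral I^k z
increases by at most (C e + o(1)) h, and since the fractional integral of the
constant y(t0) >= 0 does not decrease, I^k y decreases by at most this amount.
For e small compared to m the two estimates contradict each other.  *)
Lemma RL_extremum a v t0 : 0 < a -> a <= 1 -> continuous v -> 0 < t0 ->
  (forall s, 0 <= s <= t0 -> RL a v s <= RL a v t0) -> 0 <= v t0.
Proof.
move=> a0 a1 cv t0_gt0 ymax; rewrite leNgt; apply/negP => vt0.
have loc (e : R) : 0 < e -> exists2 d : R, 0 < d & forall s, `|t0 - s| < d -> `|v s - v t0| <= e.
  move=> e0; have /cvgrPdist_le /(_ e e0) [d /= d0 hd] := cv t0.
  by exists d => // s /hd; rewrite distrC.
have RL1_drop (e d r : R) : 0 < e -> (forall s, `|t0 - s| < d -> `|v s - v t0| <= e) ->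
    0 <= r -> r <= t0 -> t0 - r < d ->
    RL 1 v t0 - RL 1 v r <= (v t0 + e) * RLc 1 * (t0 - r).
  move=> e0 hd r0 rt rd; have := @RL1_incr_le v r t0 (v t0 + e) cv r0 rt.
  move=> H; have {}H := H _; rewrite lerBlDl; apply: H => s /andP[s1 s2].
  have : `|t0 - s| < d by rewrite ger0_norm ?subr_ge0//; move: rd s1; lra.
  by move=> /hd; rewrite ler_norml => /andP[_]; lra.
have c1 : 0 < RLc (1:R) by exact: RLc_gt0.
have y0 : 0 <= RL a v t0.
  by have := ymax 0; rewrite lexx ltW// RL_le0// => /(_ isT).
move: a1; rewrite le_eqVlt => /predU1P[aE|a1].
  (* for a = 1 the integral of v decreases strictly just before t0 *)
  rewrite aE in ymax.
  have e0 : 0 < - v t0 / 2 by rewrite divr_gt0// oppr_gt0.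
  have [d d0 hd] := loc _ e0.
  pose r := Num.max 0 (t0 - d / 2).
  have r0 : 0 <= r by rewrite le_max lexx.
  have rt : r < t0 by rewrite gt_max t0_gt0/= ltrBlDr ltrDl divr_gt0.
  have rd : t0 - r < d.
    have : t0 - d / 2 <= r by rewrite le_max lexx orbT.
    by move: d0; lra.
  have := RL1_drop _ d r e0 hd r0 (ltW rt) rd.
  have := ymax r; rewrite r0 (ltW rt) => /(_ isT) h1.
  have : 0 < RLc 1 * (t0 - r) by rewrite mulr_gt0// subr_gt0.
  move=> x0; rewrite -mulrA.
  have : (v t0 + - v t0 / 2) * (RLc 1 * (t0 - r)) < 0.
    by rewrite nmulr_rlt0//; move: vt0; lra.
  move: h1; move: ((v t0 + - v t0 / 2) * _) (RL 1 v t0) (RL 1 v r) => x1 x2 x3; lra.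
set k := 1 - a; have k0 : 0 < k by rewrite subr_gt0.
have k1 : k <= 1 by rewrite /k gerBl ltW.
set B := RLbeta k a; have B0 : 0 < B by exact: RLbeta_gt0.
have ka : k + a = 1 by rewrite subrK.
have cy : continuous (RL a v) by exact: RL_cont.
have comp t : RL k (RL a v) t = B * RL 1 v t by rewrite RL_comp// ka.
have ca : 0 < RLc a by exact: RLc_gt0.
have ck : 0 < RLc k by exact: RLc_gt0.
have D0 : 0 <= RL a id 1 by apply: RL_ge0 => // s /andP[].
set d := - v t0 / 2; have d0 : 0 < d by rewrite /d divr_gt0// oppr_gt0.
set m := B * d * RLc 1; have m0 : 0 < m by apply: mulr_gt0 => //; exact: mulr_gt0.
(* 2 RLc k RLc a e is the coefficient of h in the upper bound for the increment of
   I^k z; it is kept below m / 2, and Q h, the other coefficient, tends to 0 *)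
pose e := Num.min d (m / (4 * RLc k * RLc a)).
have e0 : 0 < e by rewrite lt_min d0/= divr_gt0// !mulr_gt0.
have ed : e <= d by rewrite ge_min lexx.
have em : 4 * RLc k * RLc a * e <= m.
  have : e <= m / (4 * RLc k * RLc a) by rewrite ge_min lexx orbT.
  by rewrite ler_pdivlMr ?mulr_gt0// mulrC.
have [del del0 hdel] := loc _ e0.
have [M [M0 hM]] : exists M, 0 < M /\ forall s, 0 <= s <= t0 -> `|v s - v t0| <= M.
  have [N [_ hN]] := @continuous_bounded_itv R (fun s => v s - v t0) 0 t0
    (fun x => cvgB (cv x) (cvg_cst _)).
  exists (`|N| + 1); split; first by rewrite ltr_wpDl.
  by move=> s s0; apply: hN => //=; rewrite (le_lt_trans (ler_norm _))// ltrDl.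
(* at distance at least del from t0 the linear term alone exceeds the bound M *)
pose L := M / del; have L0 : 0 <= L by rewrite divr_ge0// ltW.
have hv s : 0 <= s <= t0 -> `|v s - v t0| <= e + L * (t0 - s).
  move=> /andP[s0 st]; have ts : 0 <= t0 - s by rewrite subr_ge0.
  have [sd|ds] := ltP (t0 - s) del.
    have := hdel s; rewrite ger0_norm// => /(_ sd) h; apply: (le_trans h).
    by rewrite lerDl mulr_ge0.
  have := hM s; rewrite s0 st => /(_ isT) h; apply: (le_trans h).
  apply: ler_wpDl; first exact: ltW.
  by rewrite /L mulrAC -mulrA ler_pMr// ler_pdivlMr// mul1r.
clearbody L.
pose Q h := RLc k * (2 * L * RLc a * h + 2 * L * RL a id 1 * t0 `^ a * h `^ k).
have Qcvg : Q h @[h --> 0^'+] --> (0 : R).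
  have : Q h @[h --> 0^'+] -->
      RLc k * (2 * L * RLc a * 0 + 2 * L * RL a id 1 * t0 `^ a * 0).
    apply: cvgM; first exact: cvg_cst.
    apply: cvgD; apply: cvgM; try exact: cvg_cst.
      by apply: cvg_at_right_filter; exact: cvg_id.
    exact: powR_cvg0.
  by rewrite !mulr0 addr0 mulr0.
have [h [h0 hd ht hQ]] : exists h : R, [/\ 0 < h, h < del, h < t0 & Q h < m / 2].
  have : \forall h \near 0^'+, [/\ 0 < h, h < del, h < t0 & Q h < m / 2].
    near=> h; split.
    - by near: h; exact: nbhs_right_gt.
    - by near: h; exact: nbhs_right_lt.
    - by near: h; exact: nbhs_right_lt.
    - by near: h; apply: (cvgr_lt 0 Qcvg); rewrite divr_gt0.
  by move=> /filter_ex[h]; exists h.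
pose r := t0 - h.
have r0 : 0 < r by rewrite subr_gt0.
have rt : r <= t0 by rewrite gerBl ltW.
have trh : t0 - r = h by rewrite /r subKr.
pose z s := cst (RL a v t0) s - RL a v s.
have cz : continuous z by move=> x; apply: cvgB; [exact: cvg_cst|exact: cy].
have zE t : 0 <= t -> RL k z t = RL a v t0 * RLc k * t `^ k - B * RL 1 v t.
  by move=> t_ge0; rewrite RLB//; [rewrite RL_cst// comp|exact: cst_cont].
pose Z := 2 * (e + L * h) * RLc a * h `^ a + 2 * L * RL a id 1 * t0 `^ a * h.
have := @RL_incr_le R k z r t0 Z k0 k1 cz (ltW r0) rt.
rewrite (zE _ (ltW r0)) (zE _ (ltW t0_gt0)) trh => H.
have : RL a v t0 * RLc k * t0 `^ k - B * RL 1 v t0 <=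
  RL a v t0 * RLc k * r `^ k - B * RL 1 v r + Z * RLc k * h `^ k.
  apply: H => s /andP[s1 s2].
    by rewrite /z /= subr_ge0 ymax// s1 (le_trans s2 rt).
  have s0 := lt_le_trans r0 s1.
  have := @RL_left_modulus a v t0 e L s a0 (ltW a1) cv (ltW e0) L0 s0 s2 (ltW vt0) hv.
  move=> /le_trans; apply.
  have tsh : t0 - s <= h by rewrite -trh lerD2l lerN2.
  have ts0 : 0 <= t0 - s by rewrite subr_ge0.
  have pp : (t0 - s) `^ a <= h `^ a.
    by apply: ge0_ler_powR; rewrite ?nnegrE//; exact: ltW.
  have w1 : 2 * (e + L * (t0 - s)) * RLc a <= 2 * (e + L * h) * RLc a.
    apply: ler_wpM2r; first exact: ltW.
    by rewrite ler_wpM2l// lerD2l ler_wpM2l.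
  have w0 : 0 <= 2 * (e + L * (t0 - s)) * RLc a.
    apply: mulr_ge0; last exact: ltW.
    by apply: mulr_ge0 => //; apply: addr_ge0; [exact: ltW|exact: mulr_ge0].
  have w2 : 2 * L * RL a id 1 * t0 `^ a * (t0 - s) <= 2 * L * RL a id 1 * t0 `^ a * h.
    by apply: ler_wpM2l => //; rewrite !mulr_ge0 ?powR_ge0.
  exact: lerD (ler_pM w0 (powR_ge0 _ _) w1 pp) w2.
have Mk : 0 <= RL a v t0 * RLc k * (t0 `^ k - r `^ k).
  apply: mulr_ge0; first by apply: mulr_ge0 => //; exact: ltW.
  rewrite subr_ge0.
  by apply: ge0_ler_powR; rewrite ?nnegrE//; exact: ltW.
have := RL1_drop e del r e0 hdel (ltW r0) rt; rewrite trh => /(_ hd) drop.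
have ve : v t0 + e <= - d by move: ed; rewrite /d; lra.
have hh : h `^ k * h `^ a = h by rewrite -powRD ?ka ?powRr1 ?ltW// gt_eqF ?implybT.
move=> E.
have {}drop : RL 1 v t0 - RL 1 v r <= - d * RLc 1 * h.
  by apply: (le_trans drop); rewrite !ler_wpM2r// ltW.
have : B * (RL 1 v t0 - RL 1 v r) <= B * (- d * RLc 1 * h) by rewrite ler_wpM2l// ltW.
have -> : B * (- d * RLc 1 * h) = - (m * h) by rewrite /m; ring.
move=> E2.
have E3 : m * h <= Z * RLc k * h `^ k by move: E Mk E2; lra.
have E4 : Z * RLc k * h `^ k = (2 * RLc k * RLc a * e + Q h) * h.
  transitivity (2 * (e + L * h) * RLc a * RLc k * (h `^ k * h `^ a) +
    2 * L * RL a id 1 * t0 `^ a * h * RLc k * h `^ k); first by rewrite /Z; ring.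
  by rewrite hh /Q; ring.
by move: E3; rewrite E4 ler_pM2r// leNgt => /negP; apply; move: em hQ m0; lra.
Unshelve. all: by end_near. Qed.

End Extremum.

(** * The barrier principle *)

Section Barrier.
Context {R : realType}.
Implicit Types (e t r s : R) (u v w x : R -> R).

Lemma first_hit x c t1 : continuous x -> 0 <= t1 -> x 0 < c -> c <= x t1 ->
  exists t0, [/\ 0 < t0, x t0 = c & forall s, 0 <= s <= t0 -> x s <= c].
Proof.
move=> cx t10 x0 xt1.
pose S : set R := [set t | 0 <= t /\ c <= x t].
have S1 : S t1 by [].
have hS : has_inf S by split; [exists t1 | exists 0 => t -[]].
have T0 : 0 <= inf S by apply: lb_le_inf; [exists t1 | move=> t -[]].
have below s : 0 <= s -> s < inf S -> x s < c.
  move=> s0 sT; rewrite ltNge; apply/negP => cs.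
  by have := ge_inf hS.2 (conj s0 cs : S s); rewrite leNgt sT.
have xT : c <= x (inf S).
  rewrite leNgt; apply/negP => xTc.
  have [d /= d0 hd] : \forall s \near inf S, x s < c by exact: (cvgr_lt (x (inf S)) (cx _)).
  have [s [s0 cs] sd] := inf_adherent d0 hS.
  have : x s < c; last by rewrite ltNge cs.
  apply: hd => /=; rewrite distrC ger0_norm ?subr_ge0 ?(ge_inf hS.2)//.
  by rewrite ltrBlDl.
have T1 : 0 < inf S.
  by rewrite lt_neqAle T0 andbT; apply/eqP => E; move: xT; rewrite -E leNgt x0.
exists (inf S).
have xTc : x (inf S) = c.
  apply/eqP; rewrite eq_le xT andbT leNgt; apply/negP => cxT.
  have [d /= d0 hd] : \forall s \near inf S, c < x s by exact: (cvgr_gt (x (inf S)) (cx _)).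
  pose s := Num.max 0 (inf S - d / 2).
  have s0 : 0 <= s by rewrite le_max lexx.
  have sT : s < inf S by rewrite gt_max T1/= ltrBlDr ltrDl divr_gt0.
  have := below s s0 sT; apply/negP; rewrite -leNgt; apply/ltW/hd => /=.
  have : inf S - d / 2 <= s by rewrite le_max lexx orbT.
  rewrite ger0_norm; last by rewrite subr_ge0 ltW.
  by move: d0; lra.
split => // s /andP[s0]; rewrite le_eqVlt => /predU1P[->|sT]; first by rewrite xTc.
by apply/ltW/below.
Qed.

Variables (al ga c A : R).
Hypotheses (ga0 : 0 < ga) (gal : ga < al) (al1 : al <= 1) (c0 : 0 < c) (A0 : 0 < A).

Let al0 : 0 < al. Proof. exact: lt_trans gal. Qed.

(** The integral I^alpha v is, up to a constant, I^beta applied to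
I^(alpha - beta) v, so [RL_extremum] applies with order alpha to v and with order
beta to I^(alpha - beta) v. *)
Lemma extremum_two_terms v t0 : continuous v -> 0 < t0 ->
  (forall s, 0 <= s <= t0 -> RL al v s <= RL al v t0) ->
  0 <= v t0 + A * RL ga v t0.
Proof.
move=> cv t00 vmax; apply: addr_ge0; first exact: (@RL_extremum _ al).
apply: mulr_ge0; first exact: ltW.
have be0 : 0 < al - ga by rewrite subr_gt0.
have be1 : al - ga <= 1 by rewrite lerBlDr (le_trans al1)// lerDl ltW.
apply: (RL_extremum be0 be1 (RL_cont ga0 cv) t00) => s hs.
rewrite !RL_comp// subrK ler_wpM2l ?vmax//.
by apply: ltW; exact: RLbeta_gt0.
Qed.

(** At the first time x reaches a level in (e, r] it is maximal over the past, and
[extremum_two_terms] contradicts the assumed sign.  The upper limit r allows for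
hypotheses that hold only near the origin. *)
Lemma barrier v (x0 : R) e r : continuous v -> e < r -> x0 <= e ->
  (forall t, 0 < t -> e < x0 + c * RL al v t -> x0 + c * RL al v t <= r ->
     v t + A * RL ga v t < 0) ->
  forall t, 0 <= t -> x0 + c * RL al v t <= e.
Proof.
move=> cv er x0e H t1 t10; rewrite leNgt; apply/negP => xt1.
pose x t := x0 + c * RL al v t.
have cx : continuous x by exact: RL_affine_cont.
pose k := Num.min r (x t1).
have ek : e < k by rewrite lt_min er xt1.
have x00 : x 0 < k by rewrite /x RL_le0// mulr0 addr0 (le_lt_trans x0e).
have kx : k <= x t1 by rewrite ge_min lexx orbT.
have [t0 [t00 xt0 xmax]] := first_hit cx t10 x00 kx.
have kr : k <= r by rewrite ge_min lexx.
have := H t0 t00; rewrite -/(x t0) xt0 => /(_ ek kr).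
rewrite ltNge => /negP; apply; apply: extremum_two_terms => // s hs.
have := xmax s hs; rewrite -xt0 /x lerD2l => h.
by rewrite -(ler_pM2l c0).
Qed.

End Barrier.

(** * Exponential weights *)

Section Picard.
Context {R : realType}.
Implicit Types (a e t r s lam theta : R) (u v w : R -> R).

Lemma expR_lin_cont lam : continuous (fun s : R => expR (lam * s)).
Proof.
move=> s; apply: (@continuous_comp _ _ _ ( *%R lam) expR); last exact: continuous_expR.
by apply: cvgM; [exact: cvg_cst|exact: cvg_id].
Qed.

Lemma RL1_primitive u (U : R -> R) r : continuous u -> 0 <= r ->
  (forall s, 0 <= s <= r -> is_derive s (1:R) U (u s)) -> RL 1 u r = U r - U 0.
Proof.
move=> cu; rewrite le_eqVlt => /predU1P[<- _|r0 dU]; first by rewrite subrr RL_le0.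
rewrite RL1E /Rintegral (FTC2_cc r0 dU)//.
exact: continuous_subspaceT.
Qed.

Lemma RL1_expR lam r : 0 < lam -> 0 <= r ->
  RL 1 (fun s => expR (lam * s)) r <= lam^-1 * expR (lam * r).
Proof.
move=> lam0 r0.
have dU s : 0 <= s <= r ->
    is_derive s (1:R) (fun s => lam^-1 * expR (lam * s)) (expR (lam * s)).
  move=> _.
  have H1 : is_derive s (1:R) (fun s : R => lam * s) lam.
    have := is_deriveZ lam (is_derive_id s (1:R)).
    by rewrite /GRing.scale/= mulr1.
  have H2 := @is_derive1_comp _ (@expR R) (fun s : R => lam * s) s _ _ (is_derive_expR (lam * s)) H1.
  have := is_deriveZ lam^-1 H2.
  by rewrite /GRing.scale/= mulrCA mulVf ?gt_eqF// mulr1.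
rewrite (RL1_primitive (@expR_lin_cont lam) r0 dU).
by rewrite gerBl mulr_ge0 ?invr_ge0 ?expR_ge0 ?ltW.
Qed.

(** The fractional integral is a contraction in the norm weighted by exp(lam t)
for large lam: the contribution of the last d units of time is small because d^a
is, and that of the remaining past because the ordinary integral of exp(lam s)
gains a factor 1 / lam. *)
Lemma RL_expR_small a theta : 0 < a -> a <= 1 -> 0 < theta ->
  exists2 lam0, 0 < lam0 & forall lam, lam0 <= lam -> forall t, 0 <= t ->
    RL a (fun s => expR (lam * s)) t <= theta * expR (lam * t).
Proof.
move=> a0 a1 th0; have ca := RLc_gt0 a0.
have [d [d0 hd]] : exists d : R, 0 < d /\ RLc a * d `^ a <= theta / 2.
  have : RLc a * d `^ a @[d --> 0^'+] --> (RLc a * 0 : R).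
    by apply: cvgM; [exact: cvg_cst|exact: powR_cvg0].
  rewrite mulr0 => H; have : \forall d \near 0^'+, 0 < d /\ RLc a * d `^ a <= theta / 2.
    near=> d; split; first by near: d; exact: nbhs_right_gt.
    by near: d; apply: (cvgr_le 0 H); rewrite divr_gt0.
  by move=> /filter_ex[d]; exists d.
have da := powR_gt0 (a - 1) d0.
exists (2 * d `^ (a - 1) / theta); first by rewrite divr_gt0// mulr_gt0.
move=> lam hlam t t0.
have lam0 : 0 < lam by apply: lt_le_trans hlam; rewrite divr_gt0// mulr_gt0.
have E0 := expR_gt0 (lam * t).
have ce := @expR_lin_cont lam.
have mono s : s <= t -> expR (lam * s) <= expR (lam * t).
  by move=> st; rewrite ler_expR ler_pM2l.
have pos s : 0 <= expR (lam * s) by exact: expR_ge0.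
have [td|dt] := leP t d.
  have := @RL_incr_le R a _ 0 t (expR (lam * t)) a0 a1 ce (lexx _) t0 (fun s _ => pos s).
  rewrite subr0 [RL a _ 0]RL_le0// add0r => H.
  apply: (@le_trans _ _ (expR (lam * t) * RLc a * t `^ a)); first by apply: H => s /andP[_ /mono].
  rewrite -mulrA mulrC ler_pM2r//.
  apply: (@le_trans _ _ (RLc a * d `^ a)).
    by rewrite ler_pM2l//; apply: ge0_ler_powR; rewrite ?nnegrE//; exact: ltW.
  by apply: (le_trans hd); rewrite ler_pdivrMr// ler_peMr ?ltW// ltr1n.
have r0 : 0 <= t - d by rewrite subr_ge0 ltW.
have rt : t - d < t by rewrite ltrBlDr ltrDl.
have := @RL_split_le R a _ (t - d) t (expR (lam * t)) a0 a1 ce r0 rt (fun s _ => pos s).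
rewrite subKr => H.
apply: (le_trans (H _)); first by move=> s /andP[_ /mono].
have h1 : d `^ (a - 1) * RL 1 (fun s => expR (lam * s)) (t - d) <= theta / 2 * expR (lam * t).
  apply: (@le_trans _ _ (d `^ (a - 1) * (lam^-1 * expR (lam * t)))).
    rewrite ler_pM2l//; apply: (le_trans (RL1_expR lam0 r0)).
    by rewrite ler_pM2l ?invr_gt0//; apply: mono; exact: ltW.
  rewrite mulrA ler_pM2r// ler_pdivrMr//.
  move: hlam; rewrite ler_pdivrMr// => hlam.
  by rewrite mulrAC ler_pdivlMr// mulrC (mulrC theta).
have h2 : expR (lam * t) * RLc a * d `^ a <= theta / 2 * expR (lam * t).
  by rewrite -mulrA mulrC ler_pM2r.
have -> : theta * expR (lam * t) = theta / 2 * expR (lam * t) + theta / 2 * expR (lam * t).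
  by field.
exact: lerD.
Unshelve. all: by end_near. Qed.

End Picard.

(** * A fractional Volterra equation with a Lipschitz right-hand side *)

Section PicardLimit.
Context {R : realType}.
Implicit Types (a e t r s : R) (u v w : R -> R).

Lemma RL_abs_le a u w t : 0 < a -> continuous u -> continuous w ->
  (forall s, 0 <= s <= t -> `|u s| <= w s) -> `|RL a u t| <= RL a w t.
Proof.
move=> a0 cu cw uw; rewrite ler_norml; apply/andP; split; last first.
  by apply: RL_le => // s /uw; rewrite ler_norml => /andP[].
rewrite -RLN//; apply: RL_le => //; first by move=> x; apply: cvgN; exact: cw.
by move=> s /uw; rewrite ler_norml => /andP[].
Qed.

Lemma RL_dist_le a u v w (D : R) t : 0 < a -> continuous u -> continuous v -> continuous w ->
  (forall s, 0 <= s <= t -> `|u s - v s| <= D * w s) ->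
  `|RL a u t - RL a v t| <= D * RL a w t.
Proof.
move=> a0 cu cv cw uv; rewrite -RLB// -RLZ//; apply: RL_abs_le => //.
  by move=> x; apply: cvgB; [exact: cu|exact: cv].
by move=> x; apply: cvgM; [exact: cvg_cst|exact: cw].
Qed.

(** The sequences z n - 2 D / 2^n and z n + 2 D / 2^n are monotone and enclose
the limit. *)
Lemma geometric_limit (z : nat -> R) (D : R) : 0 <= D ->
  (forall n, `|z n.+1 - z n| <= D * 2^-1 ^+ n) ->
  exists l, forall n, `|l - z n| <= 2 * D * 2^-1 ^+ n.
Proof.
move=> D0 hz.
pose p n := z n - 2 * D * 2^-1 ^+ n.
pose q n := z n + 2 * D * 2^-1 ^+ n.
have pow n : 2^-1 ^+ n.+1 = 2^-1 * 2^-1 ^+ n :> R by rewrite exprS.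
have pS n : p n <= p n.+1.
  have := hz n; rewrite ler_norml /p pow => /andP[h _].
  by move: h; move: (z n.+1) (z n) (2^-1 ^+ n) => x y w; lra.
have qS n : q n.+1 <= q n.
  have := hz n; rewrite ler_norml /q pow => /andP[_ h].
  by move: h; move: (z n.+1) (z n) (2^-1 ^+ n) => x y w; lra.
have pmono : {homo p : m n / (m <= n)%N >-> m <= n}.
  by apply: (@homo_leq _ p (fun x y => x <= y)) => // x y w; exact: le_trans.
have qmono : {homo q : m n / (m <= n)%N >-> n <= m}.
  apply: (@homo_leq _ q (fun x y => y <= x)) => // x y w h1 h2; exact: le_trans h2 h1.
have pq m n : p m <= q n.
  apply: (@le_trans _ _ (p (maxn m n))); first by apply: pmono; exact: leq_maxl.
  apply: (@le_trans _ _ (q (maxn m n))); last by apply: qmono; exact: leq_maxr.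
  by rewrite /p /q lerD2l ge0_cp// mulr_ge0 ?exprn_ge0 ?invr_ge0// mulr_ge0.
have hs : has_sup (range p).
  by split; [exists (p 0%N), 0%N | exists (q 0%N) => _ [n _ <-]].
exists (sup (range p)) => n.
have h1 : p n <= sup (range p) by apply: ub_le_sup; [exact: hs.2 | exists n].
have h2 : sup (range p) <= q n.
  by apply: ge_sup; [exact: hs.1 | move=> _ [m _ <-]; exact: pq].
move: h1 h2; rewrite ler_norml /p /q; move: (sup _) (2 * D * _) (z n) => x y w; lra.
Qed.

Lemma geometric_small (C e : R) : 0 < e -> exists n, C * 2^-1 ^+ n < e.
Proof.
move=> e0; have : C * 2^-1 ^+ n @[n --> \oo] --> C * 0.
  apply: cvgM; first exact: cvg_cst.
  by apply: cvg_expr; rewrite ger0_norm ?invr_ge0// invf_lt1// ltr1n.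
rewrite mulr0 => /cvgr_lt /(_ _ e0) [N _ hN].
by exists N; apply: hN => /=.
Qed.

Variables (al ga c A x0 Lf K : R) (F : R -> R -> R).
Hypotheses (al0 : 0 < al) (al1 : al <= 1) (ga0 : 0 < ga) (ga1 : ga <= 1).
Hypotheses (c0 : 0 < c) (A0 : 0 < A) (Lf0 : 0 < Lf) (K0 : 0 <= K).
Hypothesis F_cont : forall y, continuous y -> continuous (fun t => F t (y t)).
Hypothesis F_lip : forall t x y, `|F t x - F t y| <= Lf * `|x - y|.
Hypothesis F_bnd : forall t, `|F t x0| <= K.

(** The equation is the fixed point problem v = Psi v. *)
Let Psi v t := F t (x0 + c * RL al v t) - A * RL ga v t.

Let Psi_cont v : continuous v -> continuous (Psi v).
Proof.
move=> cv t; apply: cvgB.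
  by apply: F_cont; exact: RL_affine_cont.
by apply: cvgM; [exact: cvg_cst|exact: RL_cont].
Qed.

(** A weight for which [Psi] contracts by the factor 1/2. *)
Let weight : exists W : R -> R, [/\ continuous W, forall t, 1 <= W t &
  forall t, Lf * c * RL al W t + A * RL ga W t <= 2^-1 * W t].
Proof.
have th1 : 0 < 4^-1 / (Lf * c) by rewrite divr_gt0// mulr_gt0.
have th2 : 0 < 4^-1 / A by rewrite divr_gt0.
have [l1 l10 h1] := RL_expR_small al0 al1 th1.
have [l2 l20 h2] := RL_expR_small ga0 ga1 th2.
pose lam := Num.max l1 l2.
have lam0 : 0 <= lam by rewrite le_max (ltW l10).
exists (fun t => expR (lam * Num.max t 0)); split.
- move=> t; apply: (@continuous_comp _ _ _ (fun t => Num.max t 0) (fun s => expR (lam * s))).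
    exact: max0_cont.
  exact: expR_lin_cont.
- by move=> t; rewrite -expR0 ler_expR mulr_ge0// le_max lexx orbT.
move=> t; have [t0|t0] := leP t 0.
  by rewrite !RL_le0// !mulr0 addr0 mulr_ge0// expR_ge0.
have E a : RL a (fun t => expR (lam * Num.max t 0)) t = RL a (fun t => expR (lam * t)) t.
  by apply: RL_eq => s /andP[s0 _]; rewrite max_l.
have l1l : l1 <= lam by rewrite le_max lexx.
have l2l : l2 <= lam by rewrite le_max lexx orbT.
rewrite !E; have := h1 lam l1l t (ltW t0); have := h2 lam l2l t (ltW t0).
move=> {}h2 {}h1.
have -> : 2^-1 * expR (lam * t) = Lf * c * (4^-1 / (Lf * c) * expR (lam * t)) +
    A * (4^-1 / A * expR (lam * t)).
  field; rewrite !gt_eqF//.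
apply: lerD; first by rewrite ler_wpM2l// ltW// mulr_gt0.
by rewrite ler_wpM2l// ltW.
Qed.

(** The increments of the Picard iterates are bounded by W(t) / 2^n up to a
constant.  Convergence is thus locally uniform, which makes the limit
continuous. *)
Lemma volterra_solution : exists2 v, continuous v &
  forall t, v t + A * RL ga v t = F t (x0 + c * RL al v t).
Proof.
have [W [cW W1 hW]] := weight.
have W0 t : 0 <= W t by apply: le_trans (W1 t).
have contr u v D : continuous u -> continuous v -> 0 <= D ->
    (forall t, `|u t - v t| <= D * W t) ->
    forall t, `|Psi u t - Psi v t| <= D * 2^-1 * W t.
  move=> cu cv D0 uv t.
  have d1 := RL_dist_le al0 cu cv cW (fun s _ => uv s) (t := t).
  have d2 := RL_dist_le ga0 cu cv cW (fun s _ => uv s) (t := t).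
  have -> : Psi u t - Psi v t =
      (F t (x0 + c * RL al u t) - F t (x0 + c * RL al v t)) -
      A * (RL ga u t - RL ga v t) by rewrite /Psi; ring.
  apply: (le_trans (ler_normB _ _)).
  apply: (@le_trans _ _ (D * (Lf * c * RL al W t + A * RL ga W t))); last first.
    by rewrite -[leRHS]mulrA ler_wpM2l.
  have e1 : `|F t (x0 + c * RL al u t) - F t (x0 + c * RL al v t)| <=
      Lf * c * (D * RL al W t).
    apply: (le_trans (F_lip _ _ _)).
    have -> : x0 + c * RL al u t - (x0 + c * RL al v t) = c * (RL al u t - RL al v t) by ring.
    by rewrite normrM (gtr0_norm c0) mulrA ler_wpM2l// ltW// mulr_gt0.
  have e2 : `|A * (RL ga u t - RL ga v t)| <= A * (D * RL ga W t).
    by rewrite normrM (gtr0_norm A0) ler_wpM2l// ltW.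
  apply: (le_trans (lerD e1 e2)).
  by rewrite le_eqVlt; apply/orP; left; apply/eqP; ring.
pose z n := iter n Psi (cst 0).
have cz n : continuous (z n).
  elim: n => [|n IH]; first exact: cst_cont.
  exact: Psi_cont.
have step n t : `|z n.+1 t - z n t| <= K * 2^-1 ^+ n * W t.
  elim: n t => [|n IH] t.
    rewrite expr0 mulr1 /z /= /Psi subr0.
    have RL00 a s : 0 < a -> RL a (cst 0) s = 0.
      move=> a0; have := @RLZ _ a 0 (cst 0) s a0 (@cst_cont R 0).
      by rewrite mul0r; apply: etrans; apply: RL_eq => r _; rewrite mul0r.
    rewrite !RL00// !mulr0 subr0 addr0; apply: (le_trans (F_bnd t)).
    by rewrite ler_peMr.
  rewrite exprSr mulrA; apply: (contr (z n.+1) (z n)); [exact: cz|exact: cz| |exact: IH].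
  by rewrite mulr_ge0// exprn_ge0// invr_ge0.
have lim_ex t : exists l, forall n, `|l - z n t| <= 2 * K * W t * 2^-1 ^+ n.
  have [|n|l hl] := @geometric_limit (fun n => z n t) (K * W t).
  - by rewrite mulr_ge0.
  - by rewrite mulrAC; exact: step.
  - by exists l => n; rewrite -(mulrA 2); exact: hl.
have [v hv] := choice lim_ex.
have cv : continuous v.
  move=> t; apply/cvgrPdist_le => e e0.
  have [d /= d0 hd] : \forall s \near t, W s < W t + 1.
    by apply: (cvgr_lt (W t) (cW t)); rewrite ltrDl.
  have [n hn] : exists n, 2 * K * (W t + 1) * 2^-1 ^+ n < e / 3.
    by apply: geometric_small; rewrite divr_gt0.
  have close s : W s < W t + 1 -> `|v s - z n s| <= e / 3.
    move=> Ws; apply: (le_trans (hv s n)); apply: (le_trans _ (ltW hn)).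
    by rewrite ler_wpM2r ?exprn_ge0 ?invr_ge0// ler_wpM2l ?mulr_ge0// ltW.
  have e30 : 0 < e / 3 by rewrite divr_gt0.
  have /cvgrPdist_le/(_ _ e30) [d' /= d0' hd'] := cz n t.
  exists (Num.min d d'); first by rewrite /= lt_min d0.
  move=> s /=; rewrite lt_min => /andP[sd sd'].
  have h1 := close s (hd s sd).
  have h2 : `|v t - z n t| <= e / 3 by apply: close; rewrite ltrDl.
  have h3 := hd' s sd'.
  have -> : v t - v s = (v t - z n t) + (z n t - z n s) - (v s - z n s) by ring.
  apply: (le_trans (ler_normB _ _)).
  have := ler_normD (v t - z n t) (z n t - z n s).
  by move: h1 h2 h3; lra.
exists v => // t; apply/eqP; rewrite -subr_eq0 -normr_le0; apply/ler_addgt0Pl => e e0.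
rewrite addr0.
have [n hn] : exists n, 4 * K * W t * 2^-1 ^+ n < e.
  exact: geometric_small.
have -> : v t + A * RL ga v t - F t (x0 + c * RL al v t) =
    (v t - z n.+1 t) + (Psi (z n) t - Psi v t).
  by rewrite (_ : z n.+1 t = Psi (z n) t)// /Psi; ring.
apply: (le_trans (ler_normD _ _)).
have h1 := hv t n.+1.
have Dn : 0 <= 2 * K * 2^-1 ^+ n by rewrite !mulr_ge0 ?exprn_ge0 ?invr_ge0.
have h2 : `|Psi (z n) t - Psi v t| <= 2 * K * 2^-1 ^+ n * 2^-1 * W t.
  by apply: contr => // s; rewrite distrC mulrAC; exact: hv.
move: h1 h2 hn; rewrite exprS.
have -> : 2 * K * W t * (2^-1 * 2^-1 ^+ n) = 4 * K * W t * 2^-1 ^+ n / 4 by field.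
have -> : 2 * K * 2^-1 ^+ n * 2^-1 * W t = 4 * K * W t * 2^-1 ^+ n / 4 by field.
have : 0 <= 4 * K * W t * 2^-1 ^+ n by rewrite !mulr_ge0 ?exprn_ge0 ?invr_ge0.
by move: (4 * K * _ * _) (`|v t - _|) (`|Psi _ t - _|) => x1 x2 x3; lra.
Qed.

End PicardLimit.

(** * Fractional integrals of decaying functions *)

Section Decay.
Context {R : realType}.
Implicit Types (a e t r s nu q : R) (u v w : R -> R).

(** The fractional integral extended by the identity at order 0, the case that
occurs in the Caputo derivative of order 1. *)
Definition RL0 a v : R -> R := if a == 0 then v else RL a v.

Lemma RL0_cont a v : 0 <= a -> continuous v -> continuous (RL0 a v).
Proof.
rewrite /RL0 le_eqVlt eq_sym => /predU1P[->|a0 cv]; first by rewrite eqxx.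
by rewrite gt_eqF//; exact: RL_cont.
Qed.

Lemma RL0Z a k v t : 0 <= a -> continuous v ->
  RL0 a (fun s => k * v s) t = k * RL0 a v t.
Proof.
rewrite /RL0 le_eqVlt eq_sym => /predU1P[->|a0 cv]; first by rewrite eqxx.
by rewrite gt_eqF// RLZ.
Qed.

Lemma RL0B a u v t : 0 <= a -> continuous u -> continuous v ->
  RL0 a (fun s => u s - v s) t = RL0 a u t - RL0 a v t.
Proof.
rewrite /RL0 le_eqVlt eq_sym => /predU1P[->|a0 cu cv]; first by rewrite eqxx.
by rewrite gt_eqF// RLB.
Qed.

Lemma RL0_eq a u v t : 0 <= t -> (forall s, 0 <= s <= t -> u s = v s) -> RL0 a u t = RL0 a v t.
Proof.
by move=> t0 uv; rewrite /RL0; case: ifP => _; [apply: uv; rewrite t0 lexx|exact: RL_eq].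
Qed.

Lemma RL0_comp_l a b' : 0 <= a -> 0 < b' -> exists2 C : R, 0 < C &
  forall v t, continuous v -> RL0 a (RL b' v) t = C * RL (a + b') v t.
Proof.
rewrite /RL0 le_eqVlt eq_sym => /predU1P[-> b0|a0 b0].
  by exists 1 => // v t cv; rewrite eqxx add0r mul1r.
exists (RLbeta a b'); first exact: RLbeta_gt0.
by move=> v t cv; rewrite gt_eqF// RL_comp.
Qed.

Lemma RL0_comp_r a b' : 0 <= a -> 0 < b' -> exists2 C : R, 0 < C &
  forall v t, continuous v -> RL b' (RL0 a v) t = C * RL (a + b') v t.
Proof.
rewrite /RL0 le_eqVlt eq_sym => /predU1P[-> b0|a0 b0].
  by exists 1 => // v t cv; rewrite eqxx add0r mul1r.
exists (RLbeta b' a); first exact: RLbeta_gt0.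
by move=> v t cv; rewrite gt_eqF// RL_comp// addrC.
Qed.

(** The function (1 + s)^q, continued constantly to negative s in order to be
continuous on the whole line. *)
Definition powR1p q s : R := (1 + Num.max s 0) `^ q.

Lemma powR_cont_gt0 q s : 0 < s -> {for s, continuous (fun s : R => s `^ q)}.
Proof.
move=> s0; apply/differentiable_continuous/derivable1_diffP.
by apply: derivable_powR; rewrite in_itv/= s0.
Qed.

Lemma powR1p_base_gt0 s : 0 < 1 + Num.max s 0.
Proof. by rewrite ltr_wpDr// le_max lexx orbT. Qed.

Lemma powR1p_cont q : continuous (powR1p q).
Proof.
move=> s; apply: (@continuous_comp _ _ _ (fun s => 1 + Num.max s 0) (fun s => s `^ q)).
  apply: cvgD; first exact: cvg_cst.
  exact: max0_cont.
exact/powR_cont_gt0/powR1p_base_gt0.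
Qed.

Lemma powR1pE q s : 0 <= s -> powR1p q s = (1 + s) `^ q.
Proof. by move=> s0; rewrite /powR1p max_l. Qed.

Lemma is_derive_shift_powR q s : -1 < s ->
  is_derive s (1:R) (fun s => (1 + s) `^ q) (q * (1 + s) `^ (q - 1)).
Proof.
move=> s1; have s10 : 0 < 1 + s by rewrite -ltrBlDl sub0r.
have H1 : is_derive s (1:R) (fun s : R => 1 + s) 1.
  by have := is_deriveD (is_derive_cst (1:R) s 1) (is_derive_id s (1:R)); rewrite add0r.
have := @is_derive1_comp _ (fun x : R => x `^ q) (fun s : R => 1 + s) s _ _
  (is_derive1_powR q s10) H1.
by rewrite mulr1.
Qed.

Lemma RL1_powR1p q r : 0 <= r -> RL 1 (fun s => q * powR1p (q - 1) s) r = (1 + r) `^ q - 1.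
Proof.
move=> r0.
have cu : continuous (fun s => q * powR1p (q - 1) s).
  by move=> s; apply: cvgM; [exact: cvg_cst|exact: powR1p_cont].
have dU s : 0 <= s <= r ->
    is_derive s (1:R) (fun s => (1 + s) `^ q) (q * powR1p (q - 1) s).
  move=> /andP[s0 _]; rewrite powR1pE//; apply: is_derive_shift_powR.
  by rewrite (lt_le_trans _ s0)// oppr_lt0.
by rewrite (RL1_primitive cu r0 dU) addr0 powR1.
Qed.

(** Integrating to order a costs at most a factor t^a.  For a > 0, cut at t / 2: on
the first half the kernel is at most (t/2)^(a - 1), and the ordinary integral of
(1 + s)^(- nu) grows like t^(1 - nu); on the second half the integrand is at
most (t/2)^(- nu). *)
Lemma RL0_decay a nu u (C : R) : 0 <= a -> a < 1 -> 0 < nu -> nu < 1 -> continuous u ->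
  (forall s, 0 <= s -> `|u s| <= C * (1 + s) `^ (- nu)) ->
  exists C' : R, forall t, 1 <= t -> `|RL0 a u t| <= C' * t `^ (a - nu).
Proof.
move=> a0 a1 nu0 nu1 cu hu.
have C0 : 0 <= C.
  by have := hu 0 (lexx _); rewrite addr0 powR1 mulr1; apply: le_trans.
move: a0; rewrite /RL0 le_eqVlt eq_sym => /predU1P[->|a0].
  exists C => t t1; rewrite eqxx sub0r; have t0 : 0 < t by exact: lt_le_trans t1.
  apply: (le_trans (hu t (ltW t0))); rewrite ler_wpM2l//; apply: powR_anti => //.
    by rewrite oppr_le0 ltW.
  by rewrite lerDr.
rewrite gt_eqF//.
have ca := RLc_gt0 a0; have nu10 : 0 < 1 - nu by rewrite subr_gt0.
pose w s := C * powR1p (- nu) s.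
have cw : continuous w by move=> s; apply: cvgM; [exact: cvg_cst|exact: powR1p_cont].
have w0 s : 0 <= w s by rewrite mulr_ge0// powR_ge0.
pose D := C * (3 `^ (1 - nu) / (1 - nu) + RLc a).
exists (D * 2^-1 `^ (a - nu)) => t t1.
have t0 : 0 < t by exact: lt_le_trans t1.
apply: (@le_trans _ _ (RL a w t)).
  by apply: RL_abs_le => // s /andP[s0 _]; rewrite /w powR1pE// hu.
pose r := t * 2^-1.
have r0 : 0 < r by rewrite mulr_gt0.
have tr : t - r = r by rewrite /r; field.
have rt : r < t by rewrite -subr_gt0 tr.
have := @RL_split_le R a w r t (C * r `^ (- nu)) a0 (ltW a1) cw (ltW r0) rt (fun s _ => w0 s).
rewrite tr => H; apply: (le_trans (H _)).
  move=> s /andP[rs _]; rewrite /w ler_wpM2l// powR1pE ?(le_trans (ltW r0))//.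
  by apply: powR_anti => //; [rewrite oppr_le0 ltW|rewrite ler_wpDl].
have E1 : RL 1 w r <= C * (3 `^ (1 - nu) / (1 - nu) * r `^ (1 - nu)).
  have -> : RL 1 w r = C / (1 - nu) * ((1 + r) `^ (1 - nu) - 1).
    rewrite -RL1_powR1p; last exact: ltW.
    rewrite -RLZ//; last first.
      by move=> s; apply: cvgM; [exact: cvg_cst|exact: powR1p_cont].
    apply: RL_eq => s _; rewrite /w (_ : 1 - nu - 1 = - nu); last by ring.
    by field; rewrite gt_eqF.
  rewrite -mulrA ler_wpM2l// mulrC ler_pdivrMr//.
  rewrite (_ : _ * _ * (1 - nu) = 3 `^ (1 - nu) * r `^ (1 - nu)); last first.
    by field; rewrite gt_eqF.
  rewrite -powRM//; last exact: ltW.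
  apply: (@le_trans _ _ ((1 + r) `^ (1 - nu))); first by rewrite gerBl.
  apply: ge0_ler_powR; rewrite ?nnegrE.
  - exact: ltW.
  - by rewrite addr_ge0// ltW.
  - by rewrite mulr_ge0// ltW.
  have : 2^-1 <= r by rewrite /r ler_peMl.
  by move: (r) => z; lra.
have rr p q' : r `^ p * r `^ q' = r `^ (p + q') by rewrite -powRD// (gt_eqF r0) implybT.
have -> : D * 2^-1 `^ (a - nu) * t `^ (a - nu) = D * r `^ (a - nu).
  by rewrite /r powRM ?invr_ge0//; [ring|exact: ltW].
have -> : D * r `^ (a - nu) = r `^ (a - 1) * (C * (3 `^ (1 - nu) / (1 - nu) * r `^ (1 - nu))) +
    C * r `^ (- nu) * RLc a * r `^ a.
  rewrite (_ : a - nu = (a - 1) + (1 - nu)); last by ring.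
  rewrite -rr /D.
  have : r `^ (- nu) * r `^ a = r `^ (a - 1) * r `^ (1 - nu).
    by rewrite !rr; congr (_ `^ _); ring.
  move: (r `^ (-nu)) (r `^ a) (r `^ (a - 1)) (r `^ (1 - nu)) => x1 x2 x3 x4 E.
  transitivity (x3 * x4 * (C * (3 `^ (1 - nu) / (1 - nu))) + C * RLc a * (x3 * x4)); first by ring.
  congr (_ + _); first by ring.
  by rewrite -E; ring.
by rewrite lerD2r ler_wpM2l ?powR_ge0.
Qed.

End Decay.

(** * Decay of solutions *)

Section DecayThm.
Context {R : realType}.
Implicit Types (e t r s p q : R) (u v w : R -> R).

Lemma powR_dominate (C p q : R) : 0 < p -> p < q ->
  exists2 T : R, 1 <= T & forall t, T <= t -> C * t `^ (- q) <= (1 + t) `^ (- p).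
Proof.
move=> p0 pq; pose M := `|C| * 2 `^ p; have M0 : 0 <= M by rewrite mulr_ge0// powR_ge0.
have qp0 : 0 < q - p by rewrite subr_gt0.
exists (Num.max 1 (M `^ (q - p)^-1)); first by rewrite le_max lexx.
move=> t; rewrite ge_max => /andP[t1 tM].
have t0 : 0 < t by exact: lt_le_trans t1.
have MT : M <= t `^ (q - p).
  apply: (@le_trans _ _ ((M `^ (q - p)^-1) `^ (q - p))).
    by rewrite -powRrM mulVf ?gt_eqF// powRr1.
  by apply: ge0_ler_powR; rewrite ?nnegrE ?powR_ge0//; exact: ltW.
have h1 : 2 `^ (- p) * t `^ (- p) <= (1 + t) `^ (- p).
  rewrite -powRM//; last exact: ltW.
  apply: powR_anti; rewrite ?oppr_le0 ?(ltW p0) ?addr_gt0//.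
  by move: t1; lra.
apply: le_trans h1.
have tq : t `^ (- p) = t `^ (q - p) * t `^ (- q).
  by rewrite -powRD ?(gt_eqF t0) ?implybT//; congr (_ `^ _); ring.
rewrite tq mulrA ler_wpM2r ?powR_ge0//.
rewrite powRN mulrC ler_pdivlMr ?powR_gt0//.
apply: le_trans MT; rewrite /M ler_wpM2r ?powR_ge0//.
exact: ler_norm.
Qed.

Lemma powR_eventually_lt (C d p q : R) : 0 < d -> p < q ->
  exists T : R, forall t, T <= t -> 0 < t -> C * (t + 1) `^ p < d * (t + 1) `^ q.
Proof.
move=> d0 pq; have qp0 : 0 < q - p by rewrite subr_gt0.
pose M := `|C| / d + 1; have M0 : 0 < M by rewrite ltr_wpDl// divr_ge0// ltW.
exists (M `^ (q - p)^-1) => t tM t0; have t10 : 0 < t + 1 by rewrite addr_gt0.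
have MT : M <= (t + 1) `^ (q - p).
  apply: (@le_trans _ _ ((M `^ (q - p)^-1) `^ (q - p))).
    by rewrite -powRrM mulVf ?gt_eqF// powRr1// ltW.
  apply: ge0_ler_powR; rewrite ?nnegrE ?powR_ge0//; try exact: ltW.
  by apply: (le_trans tM); rewrite lerDl.
have -> : (t + 1) `^ q = (t + 1) `^ (q - p) * (t + 1) `^ p.
  by rewrite -powRD ?(gt_eqF t10) ?implybT//; congr (_ `^ _); ring.
rewrite mulrA ltr_pM2r ?powR_gt0//.
apply: (@lt_le_trans _ _ (d * M)); last by rewrite ler_pM2l.
apply: (le_lt_trans (ler_norm C)); rewrite /M mulrDr mulr1 mulrCA divff ?gt_eqF// mulr1.
by rewrite ltrDl.
Qed.

Variables (al ga c A b : R).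
Hypotheses (ga0 : 0 < ga) (gal : ga < al) (al1 : al <= 1) (c0 : 0 < c) (A0 : 0 < A) (b0 : 0 < b).

Let al0 : 0 < al. Proof. exact: lt_trans gal. Qed.
(** The order beta of the lower derivative, as ga stands for alpha - beta. *)
Let gap := al - ga.
Let be0 : 0 < gap. Proof. by rewrite subr_gt0. Qed.

(** The function vp is, up to a constant, the Caputo derivative of order alpha
of (1 + t)^(- gam), obtained by applying the integral of order 1 - alpha to the
ordinary derivative.  The latter is O((1 + t)^(- 1)), which is weakened to
O((1 + t)^(- 1 + beta/2)) so that the exponent is strictly between - 1 and 0; then
[RL0_decay] bounds both derivatives by multiples of t^(- beta/2). *)
Lemma comparison gam : 0 < gam -> gam <= gap / 4 ->
  exists2 vp, continuous vp &
  (forall t, 0 <= t -> (1 + t) `^ (- gam) = 1 + c * RL al vp t) /\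
  exists2 T, 1 <= T & forall t, T <= t -> `|vp t + A * RL ga vp t| <= b / 8 * (1 + t) `^ (- gam).
Proof.
move=> gam0 gambe.
have be1 : gap < 1 by rewrite /gap ltrBlDr (le_lt_trans al1)// ltrDl.
pose k := 1 - al; have k0 : 0 <= k by rewrite subr_ge0.
have k1 : k < 1 by rewrite /k gtrBl.
pose u s := - gam * powR1p (- gam - 1) s.
have cu : continuous u by move=> s; apply: cvgM; [exact: cvg_cst|exact: powR1p_cont].
have [B B0 hB] := RL0_comp_r k0 al0.
have [B' B'0 hB'] := RL0_comp_r k0 ga0.
pose vp s := (c * B)^-1 * RL0 k u s.
have cB : 0 < c * B by rewrite mulr_gt0.
have cku := RL0_cont k0 cu.
have cvp : continuous vp by move=> s; apply: cvgM; [exact: cvg_cst|exact: cku].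
have kal : k + al = 1 by rewrite subrK.
have kga : k + ga = 1 - gap by rewrite /k /gap; ring.
exists vp => //; split.
  move=> t t0; rewrite RLZ// hB// kal RL1_powR1p// invfM.
  by field; rewrite !gt_eqF.
pose nu := 1 - gap / 2.
have nu0 : 0 < nu by rewrite /nu; move: be1; lra.
have nu1 : nu < 1 by rewrite /nu; move: be0; lra.
have hu s : 0 <= s -> `|u s| <= 1 * (1 + s) `^ (- nu).
  move=> s0; rewrite /u normrM normrN (gtr0_norm gam0) powR1pE// ger0_norm ?powR_ge0//.
  apply: ler_pM; rewrite ?powR_ge0 ?(ltW gam0)//; first by move: gambe be1; lra.
  by apply: ler_powR; [rewrite lerDl|rewrite /nu; move: gam0 be0; lra].
have [C1 h1] := RL0_decay k0 k1 nu0 nu1 cu hu.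
have ob0 : 0 <= 1 - gap by rewrite subr_ge0 ltW.
have ob1 : 1 - gap < 1 by rewrite gtrBl.
have [C2 h2] := RL0_decay ob0 ob1 nu0 nu1 cu hu.
pose C := (c * B)^-1 * `|C1| + A * ((c * B)^-1 * B' * `|C2|).
have gb : gam < gap / 2 by move: gambe be0; lra.
have [T T1 hT] := @powR_dominate (8 / b * C) gam (gap / 2) gam0 gb.
exists T => // t Tt; have t1 : 1 <= t by exact: le_trans Tt.
have t0 : 0 <= t by exact: le_trans t1.
have cB1 : 0 < (c * B)^-1 by rewrite invr_gt0.
pose P := t `^ (- (gap / 2)); have P0 : 0 <= P by exact: powR_ge0.
have e1 : `|vp t| <= (c * B)^-1 * `|C1| * P.
  rewrite /vp normrM (gtr0_norm cB1) -mulrA ler_wpM2l ?(ltW cB1)//.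
  apply: (le_trans (h1 t t1)); apply: (@le_trans _ _ (`|C1| * t `^ (k - nu))).
    by rewrite ler_wpM2r ?powR_ge0// ler_norm.
  rewrite ler_wpM2l//; apply: ler_powR => //.
  by rewrite /k /nu /gap; move: ga0; lra.
have e2 : `|RL ga vp t| <= (c * B)^-1 * B' * `|C2| * P.
  have -> : RL ga vp t = (c * B)^-1 * B' * RL0 (1 - gap) u t.
    rewrite RLZ// hB'// kga mulrA /RL0 gt_eqF// subr_gt0//.
  have cBB' : 0 < (c * B)^-1 * B' by rewrite mulr_gt0.
  rewrite normrM (gtr0_norm cBB') -[leRHS]mulrA; apply: ler_wpM2l; first exact: ltW.
  apply: (le_trans (h2 t t1)).
  rewrite (_ : 1 - gap - nu = - (gap / 2)); last by rewrite /nu; field.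
  by rewrite ler_wpM2r// ler_norm.
have e3 : `|vp t + A * RL ga vp t| <= C * P.
  apply: (le_trans (ler_normD _ _)); rewrite [`|A * _|]normrM (gtr0_norm A0) /C mulrDl lerD//.
  by rewrite -[leRHS]mulrA ler_wpM2l ?(ltW A0).
apply: (le_trans e3); have := hT t Tt; rewrite -/P => h3.
have : b / 8 * (8 / b * C * P) <= b / 8 * (1 + t) `^ (- gam).
  by rewrite ler_wpM2l// divr_ge0// ltW.
apply: le_trans; rewrite le_eqVlt; apply/orP; left; apply/eqP; field.
by rewrite gt_eqF.
Qed.

(** Barrier argument for w = x - M (1 + t)^(- gam).  Up to a time T the
constant M is so large that w <= 0.  When w > 0 after T, the dissipation - b x
absorbs the nonlinearity (at most b x / 2), the forcing (at most b p / 8, where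
p = (1 + t)^(- gam)) and the derivatives of M p (at most M b p / 8 in absolute
value), because x > M p and M >= 1. *)
Lemma decay_above v (x0 E Cg kap : R) (N g : R -> R) : continuous v -> 0 < kap ->
  (forall t, 0 < t -> v t + A * RL ga v t = - b * (x0 + c * RL al v t) + N t) ->
  (forall t, 0 < t -> `|N t| <= b / 2 * `|x0 + c * RL al v t| + `|g t|) ->
  (forall t, 1 <= t -> `|g t| <= Cg * t `^ (- kap)) ->
  (forall t, 0 <= t -> x0 + c * RL al v t <= E) ->
  exists gam M : R, 0 < gam /\
    forall t, 0 <= t -> x0 + c * RL al v t <= M * (1 + t) `^ (- gam).
Proof.
move=> cv kap0 eqv hN hg hE.
pose gam := Num.min (kap / 2) (gap / 4).
have gam0 : 0 < gam by rewrite lt_min !divr_gt0.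
have gk : gam < kap.
  have : gam <= kap / 2 by rewrite ge_min lexx.
  by move: kap0; lra.
have gb : gam <= gap / 4 by rewrite ge_min lexx orbT.
have [vp cvp [pE [T1 T11 hT1]]] := comparison gam0 gb.
have [T2 T21 hT2] := @powR_dominate (8 / b * Cg) gam kap gam0 gk.
pose T := Num.max T1 T2.
have T0 : 0 <= T by rewrite le_max (le_trans _ T11).
have T1T : T1 <= T by rewrite le_max lexx.
have T2T : T2 <= T by rewrite le_max lexx orbT.
pose M := Num.max 1 (`|E| * (1 + T) `^ gam).
have M1 : 1 <= M by rewrite le_max lexx.
have M0 : 0 <= M by exact: le_trans M1.
have early t : 0 <= t -> t <= T -> x0 + c * RL al v t <= M * (1 + t) `^ (- gam).
  move=> t0 tT; apply: (le_trans (hE t t0)); apply: (le_trans (ler_norm E)).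
  have h1 : (1 + T) `^ (- gam) <= (1 + t) `^ (- gam).
    by apply: powR_anti; rewrite ?oppr_le0 ?(ltW gam0)// ?lerD2l// ltr_wpDr.
  have h2 : `|E| * (1 + T) `^ gam <= M by rewrite le_max lexx orbT.
  apply: (@le_trans _ _ (`|E| * (1 + T) `^ gam * (1 + T) `^ (- gam))).
    by rewrite powRN -mulrA divff ?mulr1// gt_eqF// powR_gt0// ltr_wpDr.
  by apply: ler_pM => //; rewrite ?mulr_ge0 ?powR_ge0.
exists gam, M; split => //.
have cw : continuous (fun t => v t - M * vp t).
  by move=> t; apply: cvgB; [exact: cv|apply: cvgM; [exact: cvg_cst|exact: cvp]].
have cMvp : continuous (fun t => M * vp t).
  by move=> t; apply: cvgM; [exact: cvg_cst|exact: cvp].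
have Rw q t : 0 < q -> RL q (fun t => v t - M * vp t) t = RL q v t - M * RL q vp t.
  by move=> q0; rewrite RLB// RLZ.
have xw t : 0 <= t -> x0 - M + c * RL al (fun t => v t - M * vp t) t =
    x0 + c * RL al v t - M * (1 + t) `^ (- gam).
  by move=> t0; rewrite Rw// pE//; ring.
suff S e : 0 < e -> forall t, 0 <= t -> x0 - M + c * RL al (fun t => v t - M * vp t) t <= e.
  move=> t t0; rewrite -subr_le0; apply/ler_addgt0Pl => e e0.
  by rewrite addr0 -xw//; exact: S.
move=> e0; apply: (@barrier R al ga c A ga0 gal al1 c0 A0 _ (x0 - M) e (e + 1) cw).
- by rewrite ltrDl.
- have := early 0 (lexx _) T0; rewrite RL_le0// mulr0 !addr0 powR1 mulr1 => h.
  by move: h e0; lra.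
move=> t t0 + _; rewrite xw ?ltW// => ex.
have tT : T < t.
  rewrite ltNge; apply/negP => /(early t (ltW t0)).
  by move: ex e0; lra.
rewrite Rw//.
have Tt1 : T1 <= t by rewrite (le_trans T1T)// ltW.
have Tt2 : T2 <= t by rewrite (le_trans T2T)// ltW.
have := hT1 t Tt1; have := hT2 t Tt2; have := hg t (le_trans T11 Tt1).
have := hN t t0; have := eqv t t0.
set x := x0 + c * RL al v t in ex *.
set p := (1 + t) `^ (- gam) in ex *; set tk := t `^ (- kap).
have p0 : 0 < p by rewrite powR_gt0// ltr_wpDr// ltW.
have x_gt0 : 0 < x.
  have : 0 <= M * p by rewrite mulr_ge0// ltW.
  by move: ex e0; lra.
rewrite (gtr0_norm x_gt0) => E1 E2 E3 E4 E5.
have E4' : Cg * tk <= b / 8 * p.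
  have : b / 8 * (8 / b * Cg * tk) <= b / 8 * p by rewrite ler_wpM2l// divr_ge0// ltW.
  by apply: le_trans; rewrite le_eqVlt; apply/orP; left; apply/eqP; field; rewrite gt_eqF.
have E5' : - (vp t + A * RL ga vp t) <= b / 8 * p.
  by apply: le_trans E5; rewrite -normrN ler_norm.
have E6 : M * - (vp t + A * RL ga vp t) <= M * (b / 8 * p) by rewrite ler_wpM2l.
have -> : v t - M * vp t + A * (RL ga v t - M * RL ga vp t) =
    (v t + A * RL ga v t) + M * - (vp t + A * RL ga vp t) by ring.
rewrite E1.
have NE : N t <= b / 2 * x + b / 8 * p.
  by apply: (le_trans (ler_norm _)); apply: (le_trans E2); rewrite lerD2l (le_trans E3).
have bx : b / 2 * (M * p) < b / 2 * x.
  by rewrite ltr_pM2l ?divr_gt0//; move: ex e0; lra.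
have bp : b / 8 * p <= M * (b / 8 * p) by rewrite ler_peMl// mulr_ge0 ?divr_ge0 ?ltW.
have bMp : 0 < M * (b / 8 * p).
  by rewrite !mulr_gt0 ?invr_gt0// (lt_le_trans _ M1).
have -> : - b * x = - (2 * (b / 2 * x)) by field.
have hh : b / 2 * (M * p) = 4 * (M * (b / 8 * p)) by field.
rewrite hh in bx.
move: NE E6 bx bp bMp; clear.
move: (N t) (b / 2 * x) (b / 8 * p) (M * - _) => x1 x2 x3 x4.
by move: (M * x3) => x5; lra.
Qed.

(** [decay_above] applied to x and to - x. *)
Lemma decay_to_zero v (x0 E Cg kap : R) (N g : R -> R) : continuous v -> 0 < kap ->
  (forall t, 0 < t -> v t + A * RL ga v t = - b * (x0 + c * RL al v t) + N t) ->
  (forall t, 0 < t -> `|N t| <= b / 2 * `|x0 + c * RL al v t| + `|g t|) ->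
  (forall t, 1 <= t -> `|g t| <= Cg * t `^ (- kap)) ->
  (forall t, 0 <= t -> `|x0 + c * RL al v t| <= E) ->
  x0 + c * RL al v t @[t --> +oo] --> (0 : R).
Proof.
move=> cv kap0 eqv hN hg hE.
have up t : 0 <= t -> x0 + c * RL al v t <= E.
  by move=> /hE; exact: le_trans (ler_norm _).
have [g1 [M1 [g10 h1]]] := decay_above cv kap0 eqv hN hg up.
have cNv : continuous (fun t => - v t) by move=> t; apply: cvgN; exact: cv.
have eqv' t : 0 < t -> - v t + A * RL ga (fun t => - v t) t =
    - b * (- x0 + c * RL al (fun t => - v t) t) + - N t.
  move=> t0; rewrite (RL_affineN _ _ _ al0 cv) (RLN _ ga0 cv).
  have := eqv t t0; move: (RL ga v t) (x0 + _) (N t) (v t) => x1 x2 x3 x4 E1.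
  by move: E1; rewrite !mulrN !mulNr; move: (A * x1) (b * x2) => y z; lra.
have hN' t : 0 < t ->
    `|- N t| <= b / 2 * `|- x0 + c * RL al (fun t => - v t) t| + `|g t|.
  by move=> t0; rewrite RL_affineN// !normrN; exact: hN.
have up' t : 0 <= t -> - x0 + c * RL al (fun t => - v t) t <= E.
  move=> /hE xE; rewrite RL_affineN// -normrN in xE *.
  exact: le_trans (ler_norm _) xE.
have [g2 [M2 [g20 h2]]] := decay_above cNv kap0 eqv' hN' hg up'.
have vanish (p M e : R) : 0 < p -> 0 < e ->
    \forall t \near +oo, M * (1 + t) `^ (- p) <= e.
  move=> p0 e_gt0; have p_lt0 : - p < 0 by rewrite oppr_lt0.
  have [T hT] := powR_eventually_lt M e_gt0 p_lt0.
  near=> t; have t0 : 0 < t by near: t; exact: nbhs_pinfty_gt.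
  have Tt : T <= t by near: t; apply: nbhs_pinfty_ge; rewrite num_real.
  by have := hT t Tt t0; rewrite powRr0 mulr1 (addrC t) => /ltW.
apply/cvgrPdist_le => e e_gt0; near=> t.
have t0 : 0 <= t by near: t; exact: nbhs_pinfty_ge.
rewrite sub0r normrN ler_norml; apply/andP; split.
  rewrite lerNl; apply: (@le_trans _ _ (M2 * (1 + t) `^ (- g2))).
    by have := h2 t t0; rewrite RL_affineN.
  by near: t; exact: vanish.
apply: (le_trans (h1 t t0)).
by near: t; exact: vanish.
Unshelve. all: by end_near. Qed.

End DecayThm.

(** * A one-sided bound on the forcing *)

Section Oscillation.
Context {R : realType}.
Implicit Types (e t r s p q : R) (u v w N g G : R -> R).

(** Values u <= 0 after time T can only decrease the integral, and the
influence of the past fades. *)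
Lemma RL_eventually_le a u T t : 0 < a -> a <= 1 -> continuous u -> 0 <= T -> T <= t ->
  (forall s, T <= s -> u s <= 0) -> RL a u t <= RL a (pospart u) T.
Proof.
move=> a0 a1 cu T0 Tt hu; have cp := pospart_cont cu.
apply: (@le_trans _ _ (RL a (pospart u) t)).
  by apply: RL_le => // s _; rewrite /pospart le_max lexx.
have := @RL_incr_le R a (pospart u) T t 0 a0 a1 cp T0 Tt (fun s _ => pospart_ge0 u s).
rewrite !mul0r addr0; apply => s /andP[Ts _].
by rewrite /pospart ge_max hu// lexx.
Qed.

Variables (al ga c A x0 : R).
Hypotheses (ga0 : 0 < ga) (gal : ga < al) (al1 : al <= 1) (c0 : 0 < c) (A0 : 0 < A).

Let al0 : 0 < al. Proof. exact: lt_trans gal. Qed.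

(** Integrating the equation to order alpha gives
    G = x - x0 + A' (I^ga x - I^ga x0) - c I^al N + G(0).
Here x >= 0 for large t, - I^ga x and I^al N are bounded above by
[RL_eventually_le], and I^ga x0 grows like t^ga: this term alone determines the
growth of the bound. *)
Lemma forcing_lower_bound v N g G T : continuous v -> continuous N -> continuous g ->
  (forall t, 0 <= t -> v t + A * RL ga v t = N t + g t) ->
  (forall t, 0 <= t -> G t - G 0 = c * RL al g t) ->
  0 <= T ->
  (forall t, T <= t -> 0 <= x0 + c * RL al v t) ->
  (forall t, T <= t -> N t <= 0) ->
  exists C : R, forall t, T <= t -> - (C * (t + 1) `^ ga) <= G t.
Proof.
move=> cv cN cg eqv hG T0 xpos Nneg.
pose x t := x0 + c * RL al v t.
have cRv := RL_cont al0 cv; have cRg := RL_cont ga0 cv.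
have cx : continuous x by exact: RL_affine_cont.
have cNx : continuous (fun t => - x t) by move=> t; apply: cvgN; exact: cx.
have ga1 : ga <= 1 by rewrite (le_trans _ al1)// ltW.
have B1 := RLbeta_gt0 al0 ga0; have B2 := RLbeta_gt0 ga0 al0.
pose A' := A * (RLbeta al ga / RLbeta ga al).
have A'0 : 0 < A' by exact: (mulr_gt0 A0 (divr_gt0 B1 B2)).
pose K1 := RL ga (pospart (fun t => - x t)) T.
pose K2 := RL al (pospart N) T.
have K10 : 0 <= K1 by apply: RL_ge0 => // s _; exact: pospart_ge0.
have K20 : 0 <= K2 by apply: RL_ge0 => // s _; exact: pospart_ge0.
have cga := RLc_gt0 ga0.
pose C := `|x0| + A' * K1 + A' * (`|x0| * RLc ga) + c * K2 + `|G 0|.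
have swap t : RL al (RL ga v) t = RLbeta al ga / RLbeta ga al * RL ga (RL al v) t.
  rewrite !RL_comp// (addrC al).
  by field; rewrite gt_eqF.
have xE t : RL ga (RL al v) t = c^-1 * (RL ga x t - RL ga (cst x0) t).
  rewrite -RLB//; last exact: cst_cont.
  rewrite -RLZ//; last by move=> s; apply: cvgB; [exact: cx|exact: cvg_cst].
  by apply: RL_eq => s _; rewrite /x /= addrAC subrr add0r mulrA mulVf ?gt_eqF// mul1r.
have key t : 0 <= t ->
    G t = x t - x0 + A' * (RL ga x t - x0 * RLc ga * t `^ ga) - c * RL al N t + G 0.
  move=> t0; have := hG t t0.
  have -> : RL al g t = RL al (fun s => (v s + A * RL ga v s) - N s) t.
    by apply: RL_eq => s /andP[s0 _]; rewrite eqv//; ring.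
  have cAR : continuous (fun s => A * RL ga v s).
    by move=> s; apply: cvgM; [exact: cvg_cst|exact: cRg].
  rewrite RLB//; last by move=> s; apply: cvgD; [exact: cv|exact: cAR].
  rewrite RLD// RLZ// swap xE RL_cst// => E.
  rewrite -(subrK (G 0) (G t)) E /A' /x.
  by field; rewrite !gt_eqF.
exists C => t Tt; have t0 : 0 <= t by exact: le_trans Tt.
have h1 : - RL ga x t <= K1.
  rewrite -RLN//; apply: RL_eventually_le => // s Ts.
  by rewrite oppr_le0 xpos.
have h2 : RL al N t <= K2 by apply: RL_eventually_le.
have t11 : 1 <= t + 1 by rewrite lerDr.
have P1 : 1 <= (t + 1) `^ ga.
  by have := @ge0_ler_powR R ga (ltW ga0) 1 (t + 1); rewrite powR1; apply; rewrite ?nnegrE// (le_trans _ t11).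
have P2 : t `^ ga <= (t + 1) `^ ga.
  by apply: ge0_ler_powR; rewrite ?nnegrE; [exact: ltW|exact: t0|exact: addr_ge0|rewrite lerDl].
rewrite key//.
have e1 : x0 * RLc ga * t `^ ga <= `|x0| * RLc ga * (t + 1) `^ ga.
  apply: (@le_trans _ _ (`|x0| * RLc ga * t `^ ga)).
    by rewrite !ler_wpM2r ?powR_ge0 ?(ltW cga)// ler_norm.
  by rewrite ler_wpM2l// mulr_ge0// ltW.
have e2 : A' * (- RL ga x t) <= A' * K1 by rewrite ler_wpM2l// ltW.
have e3 : A' * (x0 * RLc ga * t `^ ga) <= A' * (`|x0| * RLc ga * (t + 1) `^ ga).
  by rewrite ler_wpM2l// ltW.
have e4 : c * RL al N t <= c * K2 by rewrite ler_wpM2l// ltW.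
have e5 : 0 <= x t by exact: xpos.
pose D := `|x0| + A' * K1 + c * K2 + `|G 0|.
have D0 : 0 <= D by rewrite /D !addr_ge0// mulr_ge0// ltW.
have e6 : D <= D * (t + 1) `^ ga by rewrite ler_peMr.
have -> : C * (t + 1) `^ ga = D * (t + 1) `^ ga + A' * (`|x0| * RLc ga * (t + 1) `^ ga).
  by rewrite /C /D; ring.
have -> : A' * (RL ga x t - x0 * RLc ga * t `^ ga) =
  - (A' * - RL ga x t) - A' * (x0 * RLc ga * t `^ ga) by ring.
have n1 := ler_norm x0; have n2 : - `|G 0| <= G 0 by rewrite lerNl -normrN ler_norm.
move: e6; set X := D * _ => e6; clearbody X.
move: e2 e3 e4 e5 e6 n1 n2; rewrite /D; clear.
move: (G 0) (`|G 0|) (`|x0|) (x t) (A' * - _) (A' * K1) (A' * (x0 * _ * _)) (A' * (`|x0| * _ * _))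
  (c * RL al N t) (c * K2) => x1 x2 x3 x4 x5 x6 x7 x8 x9 x10.
lra.
Qed.

End Oscillation.

(** * Positivity of the Gamma function *)

Section GammaPos.
Context {R : realType}.
Notation mu := (@lebesgue_measure R).

Lemma is_derive_expRN (s : R) : is_derive s (1:R) (fun s : R => - expR (- s)) (expR (- s)).
Proof.
have H1 : is_derive s (1:R) (fun s : R => - s) (-1).
  exact: (is_deriveN (is_derive_id s (1:R))).
have H2 := @is_derive1_comp _ (@expR R) (fun s : R => - s) s _ _ (is_derive_expR (- s)) H1.
by have := is_deriveN H2; rewrite mulrN1 opprK.
Qed.

Lemma expRN_cont : continuous (fun s : R => expR (- s)).
Proof.
move=> s; apply: (@continuous_comp _ _ _ (fun s => - s) expR); last exact: continuous_expR.
by apply: cvgN; exact: cvg_id.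
Qed.

Lemma integral_expRN : (\int[mu]_(s in `[1%R, +oo[) (expR (- s))%:E = (expR (- 1))%:E)%E.
Proof.
rewrite (@ge0_continuous_FTC2y _ _ (fun s : R => - expR (- s)) 1 0).
- by rewrite -EFinB sub0r opprK.
- by move=> x _; exact: expR_ge0.
- exact/continuous_subspaceT/expRN_cont.
- rewrite -oppr0; apply: cvgN; exact: cvgr_expR.
- by move=> x _; have [] := is_derive_expRN x.
- apply: cvg_at_right_filter; apply: cvgN; exact: expRN_cont.
- by move=> x _; rewrite derive1E; have [] := is_derive_expRN x.
Qed.

(** The real value of a divergent integral is 0, so the integral has to be
bounded from above as well as from below: by s^(x - 1) on (0, 1] and by exp(- s)
on [1, +oo). *)
Lemma Gamma_gt0 (x : R) : 0 < x -> x <= 1 -> 0 < Gamma x.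
Proof.
move=> x0 x1; rewrite /Gamma /Rintegral.
pose phi (s : R) := s `^ (x - 1) * expR (- s).
have mphi : measurable_fun setT phi.
  apply: measurable_funM; first exact: measurable_powR.
  by apply: continuous_measurable_fun; exact: expRN_cont.
have mE : measurable_fun setT (EFin \o phi) by exact/measurable_EFinP.
have mp : measurable_fun setT (fun s : R => s `^ (x - 1)) by exact: measurable_powR.
have mpE : measurable_fun setT (EFin \o (fun s : R => s `^ (x - 1))) by exact/measurable_EFinP.
have meE : measurable_fun setT (EFin \o (fun s : R => expR (- s))).
  by apply/measurable_EFinP; apply: continuous_measurable_fun; exact: expRN_cont.
have phi0 s : 0 <= phi s by rewrite mulr_ge0 ?powR_ge0 ?expR_ge0.
have I01 : (\int[mu]_(s in `]0%R, 1%R]) (s `^ (x - 1))%:E = (RLbeta 1 x)%:E)%E.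
  rewrite -integral_powR01// integral_itv_obnd_cbnd//.
  exact: measurable_funTS mpE.
have B0 : 0 < RLbeta 1 x by apply: RLbeta_gt0.
have split01 : `]0, +oo[%classic = `]0, 1] `|` `]1, +oo[ :> set R.
  by rewrite -itv_bndbnd_setU// bnd_simp.
have lower : ((expR (- 1) * RLbeta 1 x)%:E <= \int[mu]_(s in `]0%R, +oo[) (phi s)%:E)%E.
  apply: (@le_trans _ _ (\int[mu]_(s in `]0%R, 1%R]) (phi s)%:E)%E); last first.
    apply: ge0_subset_integral => //.
    - exact: measurable_funTS mE.
    - by move=> s _; rewrite lee_fin.
    - by rewrite split01; exact: subsetUl.
  rewrite EFinM -I01 -ge0_integralZl; [|by []|exact: measurable_funTS mpE|
    by move=> s _; rewrite lee_fin powR_ge0|by rewrite lee_fin expR_ge0].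
  apply: ge0_le_integral => //.
  - by move=> s _; rewrite mule_ge0// lee_fin ?expR_ge0 ?powR_ge0.
  - apply: measurable_funTS; exact: (emeasurable_funM (measurable_cst _) mpE).
  - exact: measurable_funTS mE.
  move=> s /=; rewrite in_itv/= => /andP[s0 s1].
  by rewrite -EFinM lee_fin mulrC ler_wpM2l ?powR_ge0// ler_expR lerN2.
have upper : (\int[mu]_(s in `]0%R, +oo[) (phi s)%:E <= (RLbeta 1 x + expR (- 1))%:E)%E.
  have disj : [disjoint (`]0%R, 1%R]%classic : set R) & `]1%R, +oo[%classic].
    apply/disj_setPS => s [/=]; rewrite !in_itv/= andbT => /andP[_ s1].
    by rewrite ltNge s1.
  rewrite split01 ge0_integral_setU; [|by []|by []|exact: measurable_funTS mE|
    by move=> s _; rewrite lee_fin|exact: disj].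
  rewrite EFinD leeD//.
    rewrite -I01; apply: ge0_le_integral => //.
    - by move=> s _; rewrite lee_fin.
    - exact: measurable_funTS mE.
    - exact: measurable_funTS mpE.
    move=> s /=; rewrite in_itv/= => /andP[s0 s1].
    by rewrite lee_fin ler_piMr ?powR_ge0// expR_le1 oppr_le0 ltW.
  rewrite -integral_expRN -integral_itv_obnd_cbnd; last first.
    exact: measurable_funTS meE.
  apply: ge0_le_integral => //.
  - by move=> s _; rewrite lee_fin.
  - exact: measurable_funTS mE.
  - exact: measurable_funTS meE.
  move=> s /=; rewrite in_itv/= andbT => s1.
  rewrite lee_fin ler_piMl ?expR_ge0// -[leRHS](powRr0 s).
  by apply: ler_powR; [exact: ltW|rewrite subr_le0].
move: lower upper; case: (\int[mu]_(s in _) _)%E => [r||]//=.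
rewrite !lee_fin => h _; apply: lt_le_trans h.
by rewrite mulr_gt0// expR_gt0.
Qed.

End GammaPos.

(** * Functions on the half-line *)

Section Halfline.
Context {R : realType}.
Implicit Types (e t r s p q : R) (f u v w g G : R -> R).

(** Functions on the half-line are continued constantly to the left, so that the
estimates above can assume continuity on the whole line. *)
Definition ext f : R -> R := fun t => f (Num.max t 0).

Lemma extE f t : 0 <= t -> ext f t = f t.
Proof. by move=> t0; rewrite /ext max_l. Qed.

Lemma nonneg_halflineE t : nonneg_halfline t <-> 0 <= t.
Proof. by rewrite /nonneg_halfline /= in_itv/= andbT. Qed.

Lemma ext_cont f : {within nonneg_halfline, continuous f} -> continuous (ext f).
Proof.
move=> /subspace_continuousP cf t.
have ht : nonneg_halfline (Num.max t 0) by apply/nonneg_halflineE/max0_ge0.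
apply: (cvg_comp (fun t => Num.max t 0) f _ (cf _ ht)).
move=> P hP.
have H : nbhs t (fun s => nonneg_halfline (Num.max s 0) -> P (Num.max s 0)).
  exact: (@max0_cont R t _ hP).
suff : nbhs t (fun s => P (Num.max s 0)) by [].
apply: filterS H => s h; apply: h; apply/nonneg_halflineE; exact: max0_ge0.
Qed.

Lemma cont_within f g : continuous g -> (forall t, 0 <= t -> f t = g t) ->
  {within nonneg_halfline, continuous f}.
Proof.
move=> cg fg; apply/subspace_continuousP => t /nonneg_halflineE t0.
suff H : f @ within nonneg_halfline (nbhs t) --> g t by rewrite -(fg t t0) in H.
apply: (@cvg_trans _ (g @ within nonneg_halfline (nbhs t))); last first.
  by apply: cvg_within_filter; exact: cg.
apply: near_eq_cvg; rewrite near_withinE; near=> s => /nonneg_halflineE s0.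
exact: (esym (fg s s0)).
Unshelve. all: by end_near. Qed.

Lemma is_derive_near f g t (d : R) : 0 < t -> (forall s, 0 < s -> f s = g s) ->
  is_derive t (1:R) g d -> is_derive t (1:R) f d.
Proof.
move=> t0 fg [dg gd].
have nfg : \forall s \near t, g s = f s.
  by near=> s; apply/esym/fg; near: s; exact: lt_nbhsr.
split; first exact: near_eq_derivable dg.
by rewrite -(near_eq_derive _ nfg).
Unshelve. all: by end_near. Qed.

(** The derivative is required on the open half-line only, since a Caputo derivative
at 0 is a limit and not the derivative of the primitive. *)
Lemma FTC_halfline (F u : R -> R) : continuous F -> continuous u ->
  (forall t, 0 < t -> is_derive t (1:R) F (u t)) ->
  forall t, 0 <= t -> F t = F 0 + RL 1 u t.
Proof.
move=> cF cu dF t t0.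
have cD : continuous (fun t => F t - RL 1 u t).
  by move=> s; apply: cvgB; [exact: cF|exact: RL_cont].
have dD (x : R) : x \in `]0, t[ -> is_derive x (1:R) (fun t => F t - RL 1 u t) 0.
  rewrite in_itv/= => /andP[x0 _].
  have := is_deriveB (dF x x0) (RL1_derive cu x0).
  by rewrite subrr.
have [x _] := @MVT_segment R (fun t => F t - RL 1 u t) (fun=> 0) 0 t t0 dD
  (continuous_subspaceT cD).
rewrite mul0r [RL 1 u 0]RL_le0// subr0 => /eqP; rewrite subr_eq0 subr_eq => /eqP ->.
by rewrite addrC.
Qed.

End Halfline.

(** * The Caputo derivative as an inverse of the fractional integral *)

Section Caputo.
Context {R : realType}.
Implicit Types (e t r s p q : R) (f u v w g G : R -> R).

(** The normalising constant 1 / Gamma(a), with the value 1 at order 0 to match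
[RL0]. *)
Definition gnorm (a : R) : R := if a == 0 then 1 else (Gamma a)^-1.

Lemma gnorm_gt0 (a : R) : 0 <= a -> a <= 1 -> 0 < gnorm a.
Proof.
rewrite /gnorm le_eqVlt eq_sym => /predU1P[->|a0 a1]; first by rewrite eqxx.
by rewrite gt_eqF// invr_gt0 Gamma_gt0.
Qed.

Lemma frac_intE (a : R) f t : 0 <= t -> frac_int a f t = gnorm a * RL0 a (ext f) t.
Proof.
move=> t0; rewrite /frac_int /gnorm /RL0; case: ifP => _; first by rewrite mul1r extE.
congr (_ * _); rewrite RLE; apply: eq_Rintegral => s.
by rewrite inE/= in_itv/= => /andP[s0 _]; rewrite extE.
Qed.

Lemma RL0_at0 (a : R) v : v 0 = 0 -> RL0 a v 0 = 0.
Proof. by move=> v0; rewrite /RL0; case: ifP => // _; rewrite RL_le0. Qed.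

Lemma is_deriveZ1 (k : R) v t (d : R) : is_derive t (1:R) v d ->
  is_derive t (1:R) (fun s => k * v s) (k * d).
Proof. by move=> H; have := is_deriveZ k H. Qed.

Lemma caputo_derivative (a : R) f t (d : R) : 0 < t ->
  is_derive t (1:R) (caputo_primitive a f) d -> caputo a f t = d.
Proof.
by move=> t0 [_ E]; rewrite /caputo (gt_eqF t0) derive1E E.
Qed.

Variables (al be : R).
Hypotheses (be0 : 0 < be) (beal : be < al) (al1 : al <= 1).

Let al0 : 0 < al. Proof. exact: lt_trans beal. Qed.
Let k := 1 - al.
Let k0 : 0 <= k. Proof. by rewrite subr_ge0. Qed.
Let k1 : k <= 1. Proof. by rewrite lerBlDr lerDl ltW. Qed.
Let kal : k + al = 1. Proof. exact: subrK. Qed.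

Let pinc f s : ext (fun s => f s - f 0) s = ext f s - f 0.
Proof. reflexivity. Qed.

(** The constants come from Beta and Gamma integrals and are existentially
quantified, as only their sign matters.  For the first formula, let V be the
continuous Caputo derivative of f and z = f - f(0) - c I^al V.  The integral of
order 1 - al of z vanishes, because both of its parts have the derivative V and
start at 0; applying I^al, the ordinary integral of z vanishes, hence z = 0.
The other two formulas follow from the semigroup law and differentiation of an
ordinary integral. *)
Lemma caputo_integral_form : exists c A : R, [/\ 0 < c, 0 < A,
  forall f, continuously_caputo_differentiable al f -> forall t, 0 <= t ->
    f t = f 0 + c * RL al (ext (caputo al f)) t,
  forall f v, continuous v -> (forall t, 0 <= t -> f t = f 0 + c * RL al v t) ->
    forall t, 0 < t -> is_derive t (1:R) (caputo_primitive al f) (v t) &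
  forall f v, continuous v -> (forall t, 0 <= t -> f t = f 0 + c * RL al v t) ->
    forall t, 0 < t -> is_derive t (1:R) (caputo_primitive be f) (A * RL (al - be) v t)].
Proof.
have [B B0 hB] := RL0_comp_l k0 al0.
have [B' B'0 hB'] := RL0_comp_r k0 al0.
have gk := gnorm_gt0 k0 k1.
pose c := (gnorm k * B)^-1.
have c0 : 0 < c by rewrite invr_gt0 mulr_gt0.
have cK x : gnorm k * (c * (B * x)) = x.
  by rewrite !mulrA (mulrAC _ c) mulfV ?mul1r// lt0r_neq0// mulr_gt0.
have ga0 : 0 < al - be by rewrite subr_gt0.
have kb0 : 0 <= 1 - be by rewrite subr_ge0 (le_trans (ltW beal)).
have kb1 : 1 - be <= 1 by rewrite gerBl ltW.
have gb := gnorm_gt0 kb0 kb1.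
have [B2 B20 hB2] := RL0_comp_l kb0 al0.
have B30 := RLbeta_gt0 (@ltr01 R) ga0.
pose A := gnorm (1 - be) * c * B2 / RLbeta 1 (al - be).
have A0 : 0 < A by rewrite divr_gt0// !mulr_gt0.
have form a f v : 0 <= a -> continuous v -> (forall t, 0 <= t -> f t = f 0 + c * RL al v t) ->
    forall t, 0 <= t -> caputo_primitive (1 - a) f t = gnorm a * (c * RL0 a (RL al v) t).
  move=> a0 cv hf t t0; rewrite /caputo_primitive subKr (frac_intE _ _ t0).
  congr (_ * _); rewrite -RL0Z//; last exact: RL_cont.
  apply: RL0_eq => // s /andP[s0 _].
  by rewrite pinc extE// hf// addrAC subrr add0r.
exists c, A; split => //.
- move=> f [cf df cD] t t0.
  pose V := ext (caputo al f); have cV : continuous V by exact: ext_cont.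
  pose y s := ext f s - f 0.
  have cy : continuous y by move=> s; apply: cvgB; [exact: (ext_cont cf)|exact: cvg_cst].
  have y0 : y 0 = 0 by rewrite /y extE// subrr.
  have ckR u : continuous u -> continuous (fun s => gnorm k * RL0 k u s).
    by move=> cu s; apply: cvgM; [exact: cvg_cst|exact: RL0_cont].
  have dJ s : 0 < s -> is_derive s (1:R) (fun s => gnorm k * RL0 k y s) (V s).
    move=> s0; apply: (@is_derive_near _ _ (caputo_primitive al f) _ _ s0).
      by move=> r r0; rewrite /caputo_primitive (frac_intE _ _ (ltW r0)).
    have d := df s s0; split; first exact: d.
    by rewrite -derive1E /V (extE _ (ltW s0)) /caputo (gt_eqF s0).
  have J1 s : 0 <= s -> gnorm k * RL0 k y s = RL 1 V s.
    move=> s0; rewrite (FTC_halfline (ckR _ cy) cV dJ s0).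
    by rewrite RL0_at0// mulr0 add0r.
  pose z s := y s - c * RL al V s.
  have cRV : continuous (fun s => c * RL al V s).
    by move=> s; apply: cvgM; [exact: cvg_cst|exact: RL_cont].
  have cz : continuous z by move=> s; apply: cvgB; [exact: cy|exact: cRV].
  have z0 s : 0 <= s -> RL0 k z s = 0.
    move=> s0; rewrite RL0B// RL0Z//; last exact: RL_cont.
    by rewrite hB// kal -J1// (mulrCA B) (mulrCA c) cK subrr.
  have z1 s : RL 1 z s = 0.
    have : RL al (RL0 k z) s = 0.
      rewrite (@RL_eq _ _ _ (fun s => 0 * cst 0 s)).
        by rewrite RLZ ?mul0r//; exact: cst_cont.
      by move=> r /andP[r0 _]; rewrite z0// mul0r.
    by rewrite hB'// kal => /eqP; rewrite mulf_eq0 gt_eqF//= => /eqP.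
  have zt : z t = 0.
    move: t0; rewrite le_eqVlt => /predU1P[<-|t0].
      by rewrite /z y0 RL_le0// mulr0 subr0.
    have [_ <-] := RL1_derive cz t0.
    have -> : RL 1 z = cst 0 by apply/funext => s; rewrite z1.
    exact: derive_cst.
  move/eqP: zt; rewrite /z /y extE// subr_eq0 subr_eq => /eqP ->.
  by rewrite addrC.
- move=> f v cv hf t t0.
  apply: (@is_derive_near _ _ (RL 1 v) _ _ t0); last exact: RL1_derive.
  move=> s s0; have := form k f v k0 cv hf s (ltW s0); rewrite /k subKr => ->.
  by rewrite hB// kal cK.
- move=> f v cv hf t t0.
  apply: (@is_derive_near _ _ (fun s => A * RL 1 (RL (al - be) v) s) _ _ t0).
    move=> s s0; have := form (1 - be) f v kb0 cv hf s (ltW s0); rewrite subKr => ->.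
    rewrite (hB2 _ _ cv) (RL_comp _ (@ltr01 R) ga0 cv) /A (_ : 1 - be + al = 1 + (al - be)); last by ring.
    by field; rewrite gt_eqF.
  by apply: is_deriveZ1; apply: RL1_derive => //; exact: RL_cont.
Qed.

(** For a function with a continuous derivative u, the derivative and the integral
of order 1 - alpha commute. *)
Lemma caputo_of_primitive : exists2 C : R, 0 < C &
  forall G u, continuous u -> (forall t, 0 <= t -> G t = G 0 + RL 1 u t) ->
  forall t, 0 < t -> caputo al G t = C * RL0 k u t.
Proof.
have [B B0 hB] := RL0_comp_l k0 (@ltr01 R).
have [B' B'0 hB'] := RL0_comp_r k0 (@ltr01 R).
have gk := gnorm_gt0 k0 k1.
exists (gnorm k * B / B'); first by rewrite divr_gt0// mulr_gt0.
move=> G u cu hG t t0; apply: (caputo_derivative t0).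
apply: (@is_derive_near _ _ (fun s => gnorm k * B / B' * RL 1 (RL0 k u) s) _ _ t0).
  move=> s s0; rewrite /caputo_primitive (frac_intE _ _ (ltW s0)).
  rewrite (@RL0_eq _ _ _ (RL 1 u) _ (ltW s0)); last first.
    by move=> r /andP[r0 _]; rewrite pinc extE// hG// addrAC subrr add0r.
  by rewrite hB// hB'//; field; rewrite gt_eqF.
by apply: is_deriveZ1; apply: RL1_derive => //; exact: RL0_cont.
Qed.

End Caputo.

(** * Consequences of the asymptotic hypotheses *)

Section HypothesisData.
Context {R : realType}.
Implicit Types (e t r s p q : R) (f u v w g G h : R -> R).

Lemma bounded_halfline f : [bounded f t | t in nonneg_halfline] ->
  exists2 M : R, 0 < M & forall t, 0 <= t -> `|f t| <= M.
Proof.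
move=> [N [_ hN]]; exists (`|N| + 1); first by rewrite ltr_wpDl.
move=> t /nonneg_halflineE t0; apply: (hN (`|N| + 1)) => //.
by rewrite (le_lt_trans (ler_norm N))// ltrDl.
Qed.

Lemma limf_esup_frequently h : (0 < limf_esup (fun t => (h t)%:E) (pinfty_nbhs R))%E ->
  exists2 d : R, 0 < d & forall T, exists2 t, T <= t & d < h t.
Proof.
move=> H; have [d d0 hd] : exists2 d : R, 0 < d &
    (d%:E < limf_esup (fun t => (h t)%:E) (pinfty_nbhs R))%E.
  move: H; case: (limf_esup _ _) => [r| _|//].
    rewrite lte_fin => r0; exists (r / 2); first by rewrite divr_gt0.
    by rewrite lte_fin ltr_pdivrMr// ltr_pMr// ltr1n.
  by exists 1 => //; rewrite ltry.
exists d => // T; apply: contrapT => no.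
move: hd; apply/negP; rewrite -leNgt.
apply: ge_ereal_inf; exists (ereal_sup ((fun t => (h t)%:E) @` [set t | T < t])).
  by exists [set t | T < t] => //; exists T; split => //; exact: num_real.
apply: ge_ereal_sup => _ [t /= Tt <-]; rewrite lee_fin leNgt; apply/negP => dt.
by apply: no; exists t => //; exact: ltW.
Qed.

Lemma limf_einf_frequently h : (limf_einf (fun t => (h t)%:E) (pinfty_nbhs R) < 0)%E ->
  exists2 d : R, 0 < d & forall T, exists2 t, T <= t & h t < - d.
Proof.
rewrite /limf_einf oppe_lt0 => H.
have [|d d0 hd] := @limf_esup_frequently (fun t => - h t).
  by move: H; congr (_ < limf_esup _ _)%E; apply/funext => t.
by exists d => // T; have [t Tt ht] := hd T; exists t => //; rewrite ltrNr.
Qed.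

Lemma lip_modulus_bound f (l : R) : 0 < l -> lip_modulus f r @[r --> 0^'+] --> 0%E ->
  \forall r \near (0:R)^'+, forall x y, `|x| <= r -> `|y| <= r -> `|f x - f y| <= l * `|x - y|.
Proof.
move=> l0 H.
have hl : \forall r \near (0:R)^'+, (lip_modulus f r < l%:E)%E.
  have nb : nbhs 0%E [set y : \bar R | (y < l%:E)%E].
    by apply: open_nbhs_nbhs; split; [exact: open_ereal_lt_ereal|rewrite /= lte_fin].
  exact: H nb.
near=> r => x y xr yr.
have [->|xy] := eqVneq x y; first by rewrite !subrr normr0 mulr0.
have := near hl r => /(_ _)/ltW; rewrite /lip_modulus => hr.
rewrite -ler_pdivrMr; last by rewrite normr_gt0 subr_eq0.
rewrite -lee_fin; apply: le_trans (hr _) => //.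
by apply: ereal_sup_ubound; exists (x, y).
Unshelve. all: by end_near. Qed.

Lemma is_derive_of_halfline h dh t : is_derivative_on_halfline h dh -> 0 < t ->
  is_derive t (1:R) h (dh t).
Proof.
move=> H t0; have {}H := H t (ltW t0).
have C : (s^-1 *: (h (s *: (1:R) + t) - h t)) @[s --> 0^'] --> dh t.
  apply/cvgrPdist_lt => e e0; move/cvgrPdist_lt : H => /(_ e e0).
  rewrite near_withinE => -[d /= d0 hd].
  exists (Num.min d t); first by rewrite /= lt_min d0.
  move=> s /=; rewrite sub0r normrN lt_min => /andP[sd st] s0.
  have := hd (s + t); rewrite /ball_/= opprD addrCA subrr addr0 normrN => /(_ sd).
  have st0 : s + t != t by rewrite -subr_eq0 addrK.
  move=> /(_ st0) H; have := H _; rewrite addrK /GRing.scale/= mulr1 mulrC; apply.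
  apply/nonneg_halflineE; rewrite addrC -lerBlDl sub0r.
  by move: st; rewrite ltr_norml => /andP[/ltW].
split; first by apply/cvg_ex; exists (dh t).
by apply: cvg_lim => //; exact: C.
Qed.

End HypothesisData.

(** * Decay of the forcing *)

Section Forcing.
Context {R : realType}.
Variables (al sigma eta : R) (h dh : R -> R).
Hypotheses (al1 : al <= 1) (sigma0 : 0 < sigma) (sigmaal : sigma < al)
  (eta_lt : eta < al - sigma - 1).
Let G t : R := (t + 1) `^ sigma * h t.
Hypotheses (G_cont : {within nonneg_halfline, continuous G})
  (h_deriv : is_derivative_on_halfline h dh)
  (dh_cont : {within nonneg_halfline, continuous dh})
  (h_bnd : [bounded h t | t in nonneg_halfline])
  (dh_bnd : exists C : R, \forall t \near +oo, `|dh t| <= C * t `^ eta).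

(** The derivative of G, by the product rule. *)
Let u s : R := sigma * powR1p (sigma - 1) s * ext h s + powR1p sigma s * ext dh s.

Let exth_cont : continuous (ext h).
Proof.
have -> : ext h = (fun s => ext G s * powR1p (- sigma) s).
  apply/funext => s; rewrite /ext /G /powR1p (addrC (Num.max s 0)) powRN mulrAC divff ?mul1r//.
  by rewrite gt_eqF// powR_gt0// powR1p_base_gt0.
by move=> s; apply: cvgM; [exact: (ext_cont G_cont)|exact: powR1p_cont].
Qed.

Lemma forcing_rate_cont : continuous u.
Proof.
have c1 : continuous (fun s => sigma * powR1p (sigma - 1) s).
  by move=> s; apply: cvgM; [exact: cvg_cst|exact: powR1p_cont].
move=> s; apply: cvgD; apply: cvgM.
- exact: c1.
- exact: exth_cont.
- exact: powR1p_cont.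
- exact: (ext_cont dh_cont).
Qed.

Lemma forcing_primitive t : 0 <= t -> G t = G 0 + RL 1 u t.
Proof.
move=> t0; rewrite -(extE G t0) -(@extE _ G 0)//.
apply: (FTC_halfline (ext_cont G_cont) forcing_rate_cont) => // s s0.
have H1 : is_derive s (1:R) (fun s => (1 + s) `^ sigma) (sigma * (1 + s) `^ (sigma - 1)).
  by apply: is_derive_shift_powR; rewrite (lt_trans _ s0)// oppr_lt0.
have H2 := is_derive_of_halfline h_deriv s0.
apply: (@is_derive_near _ _ (fun s => (1 + s) `^ sigma * h s) _ _ s0).
  by move=> r r0; rewrite extE ?ltW// /G addrC.
have := is_deriveM H1 H2.
rewrite /u !powR1pE ?ltW// !extE ?ltW// /GRing.scale/=.
set d1 := (X in is_derive _ _ _ X -> _) => H3.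
by apply: is_derive_eq; rewrite /d1; ring.
Qed.

(** The bound on the derivative of h holds near infinity only; on a compact interval it
is absorbed into the constant, as (1 + s)^eta is bounded below there. *)
Let dh_global : exists2 C : R, 0 <= C & forall s, 0 <= s -> `|dh s| <= C * (1 + s) `^ eta.
Proof.
have eta0 : eta < 0 by move: eta_lt al1 sigma0; lra.
have [C [S [_ hS]]] := dh_bnd.
pose S0 := `|S| + 1; have S01 : 1 <= S0 by rewrite lerDr.
have [D [_ hD]] := @continuous_bounded_itv R (ext dh) 0 S0 (ext_cont dh_cont).
pose D1 := `|D| + 1.
have hD1 s : 0 <= s <= S0 -> `|dh s| <= D1.
  move=> /andP[s0 s1]; rewrite -(extE dh s0); apply: hD => //=.
    by rewrite (le_lt_trans (ler_norm D))// ltrDl.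
  by rewrite in_itv/= s0.
pose C1 := `|C| * 2^-1 `^ eta; pose C2 := D1 * (1 + S0) `^ (- eta).
have C10 : 0 <= C1 by rewrite mulr_ge0// powR_ge0.
have C20 : 0 <= C2 by rewrite mulr_ge0 ?powR_ge0// addr_ge0.
exists (C1 + C2); first exact: addr_ge0.
move=> s s0; have s10 : 0 < 1 + s by rewrite ltr_wpDr.
rewrite mulrDl; have [sS|Ss] := leP s S0.
  apply: ler_wpDl; first by rewrite mulr_ge0// powR_ge0.
  apply: (@le_trans _ _ D1); first by apply: hD1; rewrite s0.
  rewrite /C2 -mulrA ler_peMr//; first by rewrite addr_ge0.
  have S10 : 0 < 1 + S0 by rewrite addr_gt0// (lt_le_trans _ S01).
  rewrite powRN mulrC ler_pdivlMr ?powR_gt0// mul1r.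
  by apply: powR_anti; [exact: ltW|exact: s10|rewrite lerD2l].
apply: ler_wpDr; first by rewrite mulr_ge0// powR_ge0.
have SS : S < s.
  by apply: le_lt_trans Ss; rewrite (le_trans (ler_norm S))// lerDl.
apply: (le_trans (hS s SS)).
apply: (@le_trans _ _ (`|C| * s `^ eta)); first by rewrite ler_wpM2r ?powR_ge0// ler_norm.
rewrite /C1 -mulrA ler_wpM2l// -powRM ?invr_ge0 ?(ltW s10)//.
have s1 : 1 <= s by rewrite (le_trans S01)// ltW.
by apply: powR_anti; [exact: ltW|rewrite mulr_gt0 ?invr_gt0|move: s1; lra].
Qed.

(** The derivative u of G is O(t^(- nu)) with nu = min(1 - sigma, - sigma - eta),
and nu > 1 - al; the integral of order 1 - al loses only t^(1 - al). *)
Lemma forcing_decay (g : R -> R) :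
  (forall t, 0 <= t -> g t = caputo al G t) ->
  exists kap Cg : R, 0 < kap /\ forall t, 1 <= t -> `|ext g t| <= Cg * t `^ (- kap).
Proof.
move=> hg.
have al0 : 0 < al by exact: lt_trans sigmaal.
have al20 : 0 < al / 2 by rewrite divr_gt0.
have al2al : al / 2 < al by rewrite ltr_pdivrMr// ltr_pMr// ltr1n.
have [C C0 hC] := caputo_of_primitive al20 al2al al1.
have [M M0 hM] := bounded_halfline h_bnd.
have [D D0 hD] := dh_global.
pose nu := Num.min (1 - sigma) (- sigma - eta).
have nu1 : nu < 1.
  by rewrite gt_min; apply/orP; left; rewrite gtrBl.
have nual : 1 - al < nu.
  by rewrite lt_min; apply/andP; split; move: sigmaal eta_lt; lra.
have k0 : 0 <= 1 - al by rewrite subr_ge0.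
have k1 : 1 - al < 1 by rewrite gtrBl.
have nu0 : 0 < nu by exact: le_lt_trans nual.
have nus : sigma - 1 <= - nu.
  have : nu <= 1 - sigma by rewrite ge_min lexx.
  by lra.
have nue : sigma + eta <= - nu.
  have : nu <= - sigma - eta by rewrite ge_min lexx orbT.
  by lra.
have hu s : 0 <= s -> `|u s| <= (sigma * M + D) * (1 + s) `^ (- nu).
  move=> s0; have s11 : 1 <= 1 + s by rewrite lerDl.
  have s10 : 0 < 1 + s by exact: lt_le_trans s11.
  rewrite /u !powR1pE// !extE//; apply: (le_trans (ler_normD _ _)).
  rewrite mulrDl lerD// !normrM ?(ger0_norm (powR_ge0 _ _)).
    rewrite (gtr0_norm sigma0) -!mulrA ler_wpM2l ?(ltW sigma0)// mulrC.
    apply: ler_pM; rewrite ?powR_ge0// ?hM//.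
    exact: ler_powR.
  apply: (@le_trans _ _ ((1 + s) `^ sigma * (D * (1 + s) `^ eta))).
    by rewrite ler_wpM2l ?powR_ge0// hD.
  rewrite mulrCA ler_wpM2l// -powRD ?(gt_eqF s10) ?implybT//.
  exact: ler_powR.
have [C' hC'] := RL0_decay k0 k1 nu0 nu1 forcing_rate_cont hu.
exists (nu - (1 - al)), (C * C'); split; first by rewrite subr_gt0.
move=> t t1; have t0 : 0 < t by exact: lt_le_trans t1.
rewrite (extE _ (ltW t0)) (hg _ (ltW t0)) (hC G u forcing_rate_cont forcing_primitive t t0).
rewrite normrM (gtr0_norm C0) opprB -[leRHS]mulrA; apply: ler_wpM2l; first exact: ltW.
exact: hC'.
Qed.

End Forcing.

(** * Boundedness and uniqueness *)

Section Apriori.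
Context {R : realType}.
Variables (al ga c A b : R).
Hypotheses (ga0 : 0 < ga) (gal : ga < al) (al1 : al <= 1) (c0 : 0 < c) (A0 : 0 < A) (b0 : 0 < b).
Implicit Types (v N g : R -> R) (t e : R).

Let al0 : 0 < al. Proof. exact: lt_trans gal. Qed.

(** When eps < x <= r0, the right-hand side of the equation is at most
- b x + b x / 2 + b eps / 8 < 0, so that eps is a barrier for x, and likewise for
- x.  The smallness of N is assumed only while |x| <= r0. *)
Lemma apriori_bound v N g (x0 eps r0 : R) : continuous v -> eps < r0 -> 0 < eps ->
  `|x0| <= eps ->
  (forall t, 0 < t -> v t + A * RL ga v t = - b * (x0 + c * RL al v t) + N t + g t) ->
  (forall t, 0 < t -> `|x0 + c * RL al v t| <= r0 -> `|N t| <= b / 2 * `|x0 + c * RL al v t|) ->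
  (forall t, 0 < t -> `|g t| <= b * eps / 8) ->
  forall t, 0 <= t -> `|x0 + c * RL al v t| <= eps.
Proof.
move=> cv er e0 x0e eqv hN hg t t0.
have cNv : continuous (fun s => - v s) by move=> s; apply: cvgN; exact: cv.
move: x0e; rewrite !ler_norml => /andP[x0l x0u].
rewrite lerNl; apply/andP; split; last first.
  apply: (@barrier R al ga c A ga0 gal al1 c0 A0 v x0 eps r0 cv er x0u) t0 => s s0 xe xr.
  have xp : 0 < x0 + c * RL al v s by exact: lt_trans xe.
  have := hN s s0; rewrite (gtr0_norm xp) => /(_ xr) n1.
  rewrite eqv//; have g1 := le_trans (ler_norm _) (hg s s0).
  have n2 : N s <= b * (x0 + c * RL al v s) / 2.
    by rewrite mulrAC; exact: le_trans (ler_norm _) n1.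
  have : b * eps < b * (x0 + c * RL al v s) by rewrite ltr_pM2l.
  have : 0 < b * eps by rewrite mulr_gt0.
  move: n2 g1; clear; rewrite mulNr.
  move: (x0 + _) => x; move: (b * x) (b * eps) (N s) (g s) => x1 x2 x3 x4; lra.
rewrite -RL_affineN//.
apply: (@barrier R al ga c A ga0 gal al1 c0 A0 _ (- x0) eps r0 cNv er _) t0.
  by rewrite lerNl.
move=> s s0; rewrite RL_affineN// => xe xr.
have xn : x0 + c * RL al v s < 0 by rewrite -oppr_gt0; exact: lt_trans xe.
have := hN s s0; rewrite (ltr0_norm xn) => /(_ xr) n1.
rewrite RLN// mulrN -opprD eqv//.
have g1 : - g s <= b * eps / 8.
  by apply: le_trans (hg s s0); rewrite -normrN ler_norm.
have n2 : - N s <= - (b * (x0 + c * RL al v s) / 2).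
  have -> : - (b * (x0 + c * RL al v s) / 2) = b / 2 * - (x0 + c * RL al v s) by field.
  by apply: le_trans n1; rewrite -normrN ler_norm.
have : b * eps < b * - (x0 + c * RL al v s) by rewrite ltr_pM2l.
have : 0 < b * eps by rewrite mulr_gt0.
move: n2 g1; clear; rewrite mulNr mulrN.
move: (x0 + _) => x; move: (b * x) (b * eps) (N s) (g s) => x1 x2 x3 x4; lra.
Qed.

(** Each e > 0 is a barrier for the difference, whose equation has the right-hand side
- b d + (N1 - N2) with |N1 - N2| <= b d / 2. *)
Lemma difference_le0 v1 v2 N1 N2 (x0 : R) : continuous v1 -> continuous v2 ->
  (forall t, 0 < t -> v1 t + A * RL ga v1 t = - b * (x0 + c * RL al v1 t) + N1 t) ->
  (forall t, 0 < t -> v2 t + A * RL ga v2 t = - b * (x0 + c * RL al v2 t) + N2 t) ->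
  (forall t, 0 < t -> `|N1 t - N2 t| <=
    b / 2 * `|(x0 + c * RL al v1 t) - (x0 + c * RL al v2 t)|) ->
  forall t, 0 <= t -> x0 + c * RL al v1 t <= x0 + c * RL al v2 t.
Proof.
move=> cv1 cv2 eq1 eq2 hN t t0.
have cw : continuous (fun s => v1 s - v2 s).
  by move=> s; apply: cvgB; [exact: cv1|exact: cv2].
have dE s : 0 + c * RL al (fun s => v1 s - v2 s) s =
  (x0 + c * RL al v1 s) - (x0 + c * RL al v2 s) by rewrite RLB//; ring.
rewrite -subr_le0 -dE; apply/ler_addgt0Pl => e e0; rewrite addr0.
apply: (@barrier R al ga c A ga0 gal al1 c0 A0 _ 0 e (e + 1) cw _ (ltW e0)) t0.
  by rewrite ltrDl.
move=> s s0; rewrite dE => de _.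
have d0 : 0 < (x0 + c * RL al v1 s) - (x0 + c * RL al v2 s) by exact: lt_trans de.
have := hN s s0; rewrite (gtr0_norm d0) => n1.
rewrite RLB//.
have -> : v1 s - v2 s + A * (RL ga v1 s - RL ga v2 s) =
  (v1 s + A * RL ga v1 s) - (v2 s + A * RL ga v2 s) by ring.
rewrite eq1// eq2//.
have n2 : N1 s - N2 s <= b * ((x0 + c * RL al v1 s) - (x0 + c * RL al v2 s)) / 2.
  by rewrite mulrAC; exact: le_trans (ler_norm _) n1.
have bd : 0 < b * ((x0 + c * RL al v1 s) - (x0 + c * RL al v2 s)) by rewrite mulr_gt0.
move: n2 bd; clear; move: (x0 + c * RL al v1 s) (x0 + c * RL al v2 s) => y z.
rewrite mulrBr !mulNr.
by move: (b * y) (b * z) (N1 s) (N2 s) => x1 x2 x3 x4; lra.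
Qed.

End Apriori.

(** * Smallness of the nonlinearity near the origin *)

Section Nonlinearity.
Context {R : realType}.
Variables (m : nat) (q f : 'I_m -> R -> R) (b : R).
Hypotheses (b0 : 0 < b)
  (q_bounded : forall k, [bounded q k t | t in nonneg_halfline])
  (F2_lim : forall k, lip_modulus (f k) r @[r --> 0^'+] --> 0%E).

Lemma small_lipschitz : exists2 r0 : R, 0 < r0 &
  forall t x y, 0 <= t -> `|x| <= r0 -> `|y| <= r0 ->
    `|\sum_(k < m) q k t * f k x - \sum_(k < m) q k t * f k y| <= b / 2 * `|x - y|.
Proof.
have /choice[M hM] : forall k, exists M : R, 0 < M /\ forall t, 0 <= t -> `|q k t| <= M.
  by move=> k; have [M M0 h] := bounded_halfline (q_bounded k); exists M.
(* m + 1 in place of m covers the empty sum *)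
pose l k := b / 2 / (m.+1%:R * M k).
have l0 k : 0 < l k.
  by rewrite divr_gt0 ?divr_gt0// mulr_gt0//; case: (hM k).
have /filter_ex[r0 [r00 hr]] : \forall r \near (0:R)^'+, 0 < r /\
    forall k x y, `|x| <= r -> `|y| <= r -> `|f k x - f k y| <= l k * `|x - y|.
  near=> r; split; first by near: r; exact: nbhs_right_gt.
  by near: r; apply: filter_forall => k; exact: lip_modulus_bound.
exists r0 => // t x y t0 xr yr.
rewrite -sumrB; apply: (le_trans (ler_norm_sum _ _ _)).
apply: (@le_trans _ _ (\sum_(k < m) b / 2 / m.+1%:R * `|x - y|)).
  apply: ler_sum => k _; rewrite -mulrBr normrM.
  have [M0 hq] := hM k.
  have -> : b / 2 / m.+1%:R * `|x - y| = M k * (l k * `|x - y|).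
    by rewrite /l; field; rewrite gt_eqF//= addrC natr1 pnatr_eq0.
  by apply: ler_pM => //; [exact: hq|exact: hr].
rewrite sumr_const card_ord -[leLHS]mulr_natr.
rewrite (_ : _ * _ = b / 2 * `|x - y| * (m%:R / m.+1%:R)); last by ring.
apply: ler_piMr; first by rewrite mulr_ge0// divr_ge0// ltW.
by rewrite ler_pdivrMr// mul1r ler_nat.
Unshelve. all: by end_near. Qed.

End Nonlinearity.

(** * Zeros and sign *)

Section ConstantSign.
Context {R : realType}.
Implicit Types (x : R -> R) (T t : R).

Lemma frequent_zeros_oscillatory x :
  (forall T, exists t, [/\ 0 <= t, T <= t & x t = 0]) -> oscillatory x.
Proof.
move=> H; have /choice[t ht] : forall n : nat, exists t, [/\ 0 <= t, n%:R <= t & x t = 0].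
  by move=> n; exact: H.
exists t; split.
- by move=> k; case: (ht k).
- apply/cvgryPge => M; near=> n.
  apply: (@le_trans _ _ n%:R); last by case: (ht n).
  by near: n; exact: nbhs_infty_ger.
- by move=> k; case: (ht k).
Unshelve. all: by end_near. Qed.

Lemma constant_sign x T : continuous x -> (forall t, T <= t -> x t != 0) ->
  (forall t, T <= t -> 0 <= x t) \/ (forall t, T <= t -> x t <= 0).
Proof.
move=> cx nz.
have ivt t : T <= t -> ~ (Num.min (x T) (x t) <= 0 <= Num.max (x T) (x t)).
  move=> Tt h; have [s] := @IVT R x T t 0 Tt (continuous_subspaceT cx) h.
  by rewrite in_itv/= => /andP[Ts _] xs; move: (nz s Ts); rewrite xs eqxx.
have [xT|xT] := leP 0 (x T); [left|right] => t Tt; rewrite leNgt; apply/negP => xt;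
  apply: (ivt t Tt); rewrite ge_min le_max.
  by rewrite xT (ltW xt) orbT.
by rewrite (ltW xT) (ltW xt) orbT.
Qed.

End ConstantSign.

(** Truncation to [-r, r] makes a nonlinearity that is Lipschitz on this interval
globally Lipschitz. *)
Lemma clampP (R : realType) (r : R) : 0 < r -> exists cl : R -> R, [/\ continuous cl,
  forall x, `|cl x| <= r, forall x y, `|cl x - cl y| <= `|x - y| &
  forall x, `|x| <= r -> cl x = x].
Proof.
move=> r0; exists (fun x => Num.max (Num.min x r) (- r)); split.
- move=> x; apply: (@continuous_max _ _ (fun x => Num.min x r) (cst (- r))); last exact: cvg_cst.
  by apply: (@continuous_min _ _ id (cst r)); [exact: cvg_id|exact: cvg_cst].
- move=> x; rewrite ler_norml le_max lexx orbT/= ge_max ge_min lexx orbT/=.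
  by move: r0; lra.
- move=> x y; wlog xy : x y / x <= y.
    by move=> W; case: (leP x y) => [/W//|/ltW/W]; rewrite distrC (distrC y).
  rewrite (_ : `|x - y| = y - x); last by rewrite distrC ger0_norm// subr_ge0.
  have D (w z : R) : 0 <= z - w -> z - w <= y - x -> `|w - z| <= y - x.
    by move=> h1 h2; rewrite distrC ger0_norm.
  case: (leP x r) => h1; case: (leP y r) => h2; apply: D;
    case: (leP x (- r)) => h3; case: (leP y (- r)) => h4; case: (leP r (- r)) => h5;
    move: xy r0 h1 h2 h3 h4 h5; clear; lra.
- move=> x; rewrite ler_norml => /andP[h1 h2]; rewrite min_l// max_l//.
Qed.

(** * Solutions of the differential and of the integral equation *)

Section Equation.
Context {R : realType}.
Variables (al be a b : R).
Hypotheses (be0 : 0 < be) (beal : be < al) (al1 : al <= 1) (a0 : 0 < a) (b0 : 0 < b).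
Variables (m : nat) (q f : 'I_m -> R -> R).
Hypotheses (q_cont : forall k, {within nonneg_halfline, continuous (q k)})
  (f_cont : forall k, continuous (f k)) (f0 : forall k, f k 0 = 0).
Variables (c A' : R).
Hypotheses (c0 : 0 < c) (A'0 : 0 < A').
(* the three formulas of [caputo_integral_form], for a fixed choice of the constants *)
Hypothesis repr : forall f, continuously_caputo_differentiable al f -> forall t, 0 <= t ->
    f t = f 0 + c * RL al (ext (caputo al f)) t.
Implicit Types (t x y : R) (g psi v : R -> R).
Hypothesis dal : forall (f : R -> R) v, continuous v ->
  (forall t, 0 <= t -> f t = f 0 + c * RL al v t) ->
  forall t : R, 0 < t -> is_derive t (1:R) (caputo_primitive al f) (v t).
Hypothesis dbe : forall (f : R -> R) v, continuous v ->
  (forall t, 0 <= t -> f t = f 0 + c * RL al v t) ->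
  forall t : R, 0 < t -> is_derive t (1:R) (caputo_primitive be f) (A' * RL (al - be) v t).
Variable r0 : R.
Hypothesis r00 : 0 < r0.
(* the conclusion of [small_lipschitz] *)
Hypothesis small : forall t x y, 0 <= t -> `|x| <= r0 -> `|y| <= r0 ->
    `|\sum_(k < m) q k t * f k x - \sum_(k < m) q k t * f k y| <= b / 2 * `|x - y|.

Let ga := al - be.
Let A := a * A'.
Let ga0 : 0 < ga. Proof. by rewrite subr_gt0. Qed.
Let gal : ga < al. Proof. by rewrite gtrBl. Qed.
Let A0 : 0 < A. Proof. exact: mulr_gt0. Qed.
Let al0 : 0 < al. Proof. exact: lt_trans beal. Qed.
Let ga1 : ga <= 1. Proof. by rewrite (le_trans _ al1)// ltW. Qed.
Let Nl t x := \sum_(k < m) q k t * f k x.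

Lemma nonlinear_small t x : 0 <= t -> `|x| <= r0 -> `|Nl t x| <= b / 2 * `|x|.
Proof.
move=> t0 xr; have := @small t x 0 t0 xr; rewrite normr0 (ltW r00) => /(_ isT).
rewrite [X in `|_ - X|]big1 ?subr0// => k _.
by rewrite f0 mulr0.
Qed.

Lemma solution_integral_equation g (x0 : R) psi : is_solution al be a b q f g x0 psi ->
  [/\ continuous (ext (caputo al psi)),
    forall t, 0 <= t -> psi t = x0 + c * RL al (ext (caputo al psi)) t &
    forall t, 0 < t -> ext (caputo al psi) t + A * RL ga (ext (caputo al psi)) t =
      - b * (x0 + c * RL al (ext (caputo al psi)) t) + Nl t (psi t) + g t].
Proof.
move=> [psiC _ eq psi0]; have [_ _ cD] := psiC.
have cV := ext_cont cD; have psiE := repr psiC.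
split => // [t t0|t t0]; first by rewrite -psi0; exact: psiE.
have := eq t t0; rewrite (caputo_derivative t0 (dbe cV psiE t0)).
by rewrite (extE _ (ltW t0)) -psi0 -(psiE _ (ltW t0)) mulrA.
Qed.

Lemma integral_equation_solution g (x0 : R) v : continuous v ->
  (forall t, 0 < t -> v t + A * RL ga v t =
    - b * (x0 + c * RL al v t) + Nl t (x0 + c * RL al v t) + g t) ->
  is_solution al be a b q f g x0 (fun t => x0 + c * RL al v t).
Proof.
move=> cv eqv; set phi := fun t => _.
have phi0 : phi 0 = x0 by rewrite /phi RL_le0// mulr0 addr0.
have phiE t : 0 <= t -> phi t = phi 0 + c * RL al v t by rewrite phi0.
have dphi := dal cv phiE.
have cphi : continuous phi by exact: RL_affine_cont.
have capE t : 0 <= t -> caputo al phi t = v t.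
  rewrite le_eqVlt => /predU1P[<-|t0]; last exact: (caputo_derivative t0 (dphi t t0)).
  rewrite /caputo eqxx; apply: cvg_lim => //.
  apply: (@cvg_trans _ (v s @[s --> 0^'+])); last by apply: cvg_at_right_filter; exact: cv.
  apply: near_eq_cvg; near=> s.
  have s0 : 0 < s by near: s; exact: nbhs_right_gt.
  by have [_ <-] := dphi s s0; rewrite derive1E.
split => //.
- split.
  + exact: (cont_within cphi (fun t _ => erefl (phi t))).
  + by move=> t t0; have [] := dphi t t0.
  + exact: (cont_within cv capE).
- by move=> t t0; have [] := dbe cv phiE t0.
move=> t t0; rewrite (capE _ (ltW t0)) (caputo_derivative t0 (dbe cv phiE t0)).
by rewrite mulrA eqv.
Unshelve. all: by end_near. Qed.

Lemma nonlinear_cont (y : R -> R) : continuous y ->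
  continuous (fun t => Nl (Num.max t 0) (y t)).
Proof.
move=> cy; rewrite /Nl; elim: (index_enum _) => [|k s IH].
  rewrite (_ : (fun t => _) = cst 0); first exact: cst_cont.
  by apply/funext => t; rewrite big_nil.
rewrite (_ : (fun t => _) = (fun t => q k (Num.max t 0) * f k (y t) +
    \sum_(j <- s) q j (Num.max t 0) * f j (y t))); last first.
  by apply/funext => t; rewrite big_cons.
move=> t; apply: cvgD; last exact: IH.
have cq : continuous (fun t => q k (Num.max t 0)) by exact: ext_cont.
have cfy : continuous (fun t => f k (y t)).
  by move=> r; apply: (@continuous_comp _ _ _ y (f k)); [exact: cy|exact: f_cont].
by apply: cvgM; [exact: cq|exact: cfy].
Qed.

(** The nonlinearity is composed with a truncation cl, and extended to negative
times, to meet the global hypotheses of [volterra_solution]. *)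
Lemma truncated_existence g (x0 d : R) : {within nonneg_halfline, continuous g} ->
  (forall t, 0 <= t -> `|g t| <= d) ->
  exists2 v, continuous v & exists2 cl : R -> R, (forall x, `|x| <= r0 -> cl x = x) /\
    (forall x, `|cl x| <= r0) /\ (forall x, `|cl x| <= `|x|) &
  forall t, 0 <= t -> v t + A * RL ga v t =
    - b * (x0 + c * RL al v t) + Nl t (cl (x0 + c * RL al v t)) + g t.
Proof.
move=> cg gd.
have [cl [ccl clr cl1 clid]] := clampP r00.
have cl0 : cl 0 = 0 by apply: clid; rewrite normr0 ltW.
have clx x : `|cl x| <= `|x|.
  by have := cl1 x 0; rewrite cl0 !subr0.
pose F t x := - b * x + Nl (Num.max t 0) (cl x) + ext g t.
have F_cont (y : R -> R) : continuous y -> continuous (fun t => F t (y t)).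
  move=> cy t; apply: cvgD; last exact: (ext_cont cg).
  apply: cvgD; first by apply: cvgM; [exact: cvg_cst|exact: cy].
  apply: (@nonlinear_cont (cl \o y)) => s.
  by apply: (@continuous_comp _ _ _ y cl); [exact: cy|exact: ccl].
have L0 : 0 < 2 * b by rewrite mulr_gt0.
have F_lip t x y : `|F t x - F t y| <= 2 * b * `|x - y|.
  have -> : F t x - F t y = - b * (x - y) + (Nl (Num.max t 0) (cl x) - Nl (Num.max t 0) (cl y)).
    by rewrite /F; ring.
  apply: (le_trans (ler_normD _ _)).
  have h1 : `|- b * (x - y)| = b * `|x - y| by rewrite normrM normrN (gtr0_norm b0).
  have h2 := small (max0_ge0 t) (clr x) (clr y).
  have h3 : b / 2 * `|cl x - cl y| <= b / 2 * `|x - y|.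
    by rewrite ler_wpM2l// divr_ge0// ltW.
  have h4 : 0 <= b * `|x - y| by rewrite mulr_ge0// ltW.
  rewrite h1; apply: (@le_trans _ _ (b * `|x - y| + b / 2 * `|x - y|)).
    by rewrite lerD2l (le_trans h2).
  by rewrite (mulrAC b) -(mulrA 2); move: h4; move: (b * `|x - y|) => z; lra.
pose K := b * `|x0| + b / 2 * `|x0| + d.
have d0 : 0 <= d by apply: le_trans (gd 0 (lexx _)).
have K0 : 0 <= K by rewrite /K !addr_ge0// mulr_ge0// ?divr_ge0// ltW.
have F_bnd t : `|F t x0| <= K.
  rewrite /F /K; apply: (le_trans (ler_normD _ _)); apply: lerD; last exact: (gd _ (max0_ge0 t)).
  apply: (le_trans (ler_normD _ _)); apply: lerD.
    by rewrite normrM normrN (gtr0_norm b0).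
  apply: (le_trans (nonlinear_small (max0_ge0 t) (clr x0))).
  by rewrite ler_wpM2l// divr_ge0// ltW.
have [v cv hv] := volterra_solution al0 al1 ga0 ga1 c0 A0 L0 K0 F_cont F_lip F_bnd.
exists v => //; exists cl => // t t0.
by rewrite hv /F (extE _ t0) max_l.
Qed.

End Equation.

(** * Oscillation and the main result *)

(** A solution without zeros after some time has a constant sign there.  If it is
positive, [forcing_lower_bound] and the growth of (t + 1)^sigma contradict the
negative values of h; if it is negative, the same argument applies to the
opposite functions. *)
Lemma solution_oscillates (R : realType) (al ga c A x0 sigma : R)
    (v N g G h : R -> R) (Tq : R) :
  0 < ga -> ga < al -> al <= 1 -> 0 < c -> 0 < A -> ga < sigma ->
  continuous v -> continuous N -> continuous g ->
  (forall t, 0 <= t -> v t + A * RL ga v t = N t + g t) ->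
  (forall t, 0 <= t -> G t - G 0 = c * RL al g t) ->
  (forall t, 0 <= t -> G t = (t + 1) `^ sigma * h t) ->
  (forall t, Tq <= t -> 0 <= x0 + c * RL al v t -> N t <= 0) ->
  (forall t, Tq <= t -> x0 + c * RL al v t <= 0 -> 0 <= N t) ->
  (exists2 d : R, 0 < d & forall T, exists2 t, T <= t & d < h t) ->
  (exists2 d : R, 0 < d & forall T, exists2 t, T <= t & h t < - d) ->
  oscillatory (fun t => x0 + c * RL al v t).
Proof.
move=> ga0 gal al1 c0 A0 gas cv cN cg eqv hG GE Nneg Npos hp hn.
have al0 : 0 < al by exact: lt_trans gal.
have cx : continuous (fun t => x0 + c * RL al v t) by exact: RL_affine_cont.
apply: frequent_zeros_oscillatory => T; apply: contrapT => no.
pose T1 := Num.max (Num.max 0 T) Tq.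
have T10 : 0 <= T1 by rewrite !le_max lexx.
have TT1 : T <= T1 by rewrite !le_max lexx orbT.
have TqT1 : Tq <= T1 by rewrite le_max lexx orbT.
clearbody T1.
have nz t : T1 <= t -> x0 + c * RL al v t != 0.
  move=> Tt; apply/eqP => xt; apply: no; exists t; split => //.
    exact: le_trans Tt.
  exact: le_trans Tt.
(* as sigma > ga, the value - d (t + 1)^sigma is eventually below - C (t + 1)^ga *)
have absurd (h1 : R -> R) (G1 : R -> R) (C : R) :
    (forall t, 0 <= t -> G1 t = (t + 1) `^ sigma * h1 t) ->
    (exists2 d : R, 0 < d & forall T, exists2 t, T <= t & h1 t < - d) ->
    (forall t, T1 <= t -> - (C * (t + 1) `^ ga) <= G1 t) -> False.
  move=> G1E [d d0 hd] low.
  have [T2 hT2] := powR_eventually_lt C d0 gas.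
  have [t Tt ht] := hd (Num.max (Num.max T1 T2) 1).
  move: Tt; rewrite !ge_max => /andP[/andP[t1 t2] t3].
  have t0 : 0 < t by exact: lt_le_trans t3.
  have := low t t1; rewrite (G1E _ (ltW t0)).
  have := hT2 t t2 t0; have s0 : 0 < (t + 1) `^ sigma by rewrite powR_gt0// addr_gt0.
  have : (t + 1) `^ sigma * h1 t < (t + 1) `^ sigma * - d by rewrite ltr_pM2l.
  rewrite mulrN (mulrC _ d).
  by move: (_ * h1 t) (C * _) (d * _) => x1 x2 x3; lra.
have [xp|xn] := constant_sign cx nz.
  have [C hC] := forcing_lower_bound ga0 gal al1 c0 A0 cv cN cg eqv hG T10 xp
    (fun t Tt => Nneg t (le_trans TqT1 Tt) (xp t Tt)).
  exact: absurd GE hn hC.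
have neg_cont (u : R -> R) : continuous u -> continuous (fun t => - u t).
  by move=> cu t; apply: cvgN; exact: cu.
have eqv' t : 0 <= t -> - v t + A * RL ga (fun t => - v t) t = - N t + - g t.
  by move=> t0; rewrite RLN// mulrN -!opprD eqv.
have hG' t : 0 <= t -> - G t - - G 0 = c * RL al (fun t => - g t) t.
  by move=> t0; rewrite RLN// mulrN -hG// opprB opprK addrC.
have xp t : T1 <= t -> 0 <= - x0 + c * RL al (fun t => - v t) t.
  by move=> Tt; rewrite RL_affineN// oppr_ge0 xn.
have N' t : T1 <= t -> - N t <= 0.
  by move=> Tt; rewrite oppr_le0; apply: Npos (xn t Tt); exact: le_trans Tt.
have [C hC] := forcing_lower_bound ga0 gal al1 c0 A0 (neg_cont _ cv) (neg_cont _ cN)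
  (neg_cont _ cg) eqv' hG' T10 xp N'.
apply: (absurd (fun t => - h t) (fun t => - G t) C) => //.
  by move=> t t0; rewrite mulrN GE.
have [d d0 hd] := hp; exists d => // T'.
by have [t Tt ht] := hd T'; exists t => //; rewrite ltrN2.
Qed.

Theorem theorem4p6 (R : realType) (alpha beta a b : R)
  (hbeta : 0 < beta) (hbeta_alpha : beta < alpha) (halpha : alpha <= 1)
  (ha : 0 < a) (hb : 0 < b)
  (m : nat) (q f : 'I_m -> R -> R)
  (q_cont : forall k, {within nonneg_halfline, continuous (q k)})
  (q_bounded : forall k, [bounded q k t | t in nonneg_halfline])
  (q_nonneg : forall k, eventually_nonneg (q k))
  (f_cont : forall k, continuous (f k))
  (F1 : forall k, f k 0 = 0)
  (F2_lip : forall k, locally_lipschitz_at_origin (f k))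
  (F2_lim : forall k, lip_modulus (f k) r @[r --> 0^'+] --> 0%E)
  (F3 : forall k x, x * f k x <= 0) :
  exists2 eps0 : R, 0 < eps0 &
  forall eps : R, 0 < eps -> eps <= eps0 ->
  exists delta1 delta2 : R, [/\ 0 < delta1, 0 < delta2 &
    forall (g h dh : R -> R) (sigma eta : R),
      {within nonneg_halfline, continuous g} ->
      alpha - beta < sigma -> sigma < alpha ->
      continuously_caputo_differentiable alpha
        (fun t => (t + 1) `^ sigma * h t) ->
      (forall t, 0 <= t -> g t = caputo alpha (fun s => (s + 1) `^ sigma * h s) t) ->
      is_derivative_on_halfline h dh ->
      {within nonneg_halfline, continuous dh} ->
      [bounded h t | t in nonneg_halfline] ->
      (0 < limf_esup (fun t => (h t)%:E) (pinfty_nbhs R))%E ->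
      (limf_einf (fun t => (h t)%:E) (pinfty_nbhs R) < 0)%E ->
      -1 < eta -> eta < alpha - sigma - 1 ->
      (exists C : R, \forall t \near +oo, `|dh t| <= C * t `^ eta) ->
      (forall t, 0 <= t -> `|g t| <= delta1) ->
      forall x0 : R, `|x0| < delta2 ->
      exists phi : R -> R,
        [/\ is_solution alpha beta a b q f g x0 phi,
            (forall psi : R -> R, is_solution alpha beta a b q f g x0 psi ->
               forall t, 0 <= t -> psi t = phi t),
            oscillatory phi,
            (forall t, 0 <= t -> `|phi t| <= eps)
          & phi t @[t --> +oo] --> 0]].
Proof.
have [c [A' [c0 A'0 repr dal dbe]]] := caputo_integral_form hbeta hbeta_alpha halpha.
have [r0 r00 small] := small_lipschitz hb q_bounded F2_lim.
pose ga := alpha - beta; pose A := a * A'.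
have ga0 : 0 < ga by rewrite subr_gt0.
have gal : ga < alpha by rewrite gtrBl.
have al0 : 0 < alpha by exact: lt_trans hbeta_alpha.
have A0 : 0 < A by exact: mulr_gt0.
have nsmall := nonlinear_small F1 r00 small.
(* eps must be strictly below r0 for the barrier argument *)
exists (r0 / 2); first by rewrite divr_gt0.
move=> eps e0 er2.
have er : eps < r0 by move: er2 r00; lra.
exists (b * eps / 8), eps; split => //; first by rewrite divr_gt0// mulr_gt0.
move=> g h dh sigma eta cg gas sal GC gE hd cdh hb' hsup hinf _ hetal hdh gd x0 x0e.
have sigma0 : 0 < sigma by exact: lt_trans gas.
have x0e' := ltW x0e.
have [v cv [cl [clid [clr clx]] eqv]] :=
  truncated_existence hbeta hbeta_alpha halpha ha hb q_cont f_cont F1 c0 A'0 r00 small x0 cg gd.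
pose phi t := x0 + c * RL alpha v t.
have cphi : continuous phi by exact: RL_affine_cont.
have phib t : 0 <= t -> `|phi t| <= eps.
  apply: (@apriori_bound R alpha ga c A b ga0 gal halpha c0 A0 hb v
    (fun t => \sum_(k < m) q k t * f k (cl (phi t))) g x0 eps r0 cv er e0 x0e').
  - by move=> s s0; exact: eqv (ltW s0).
  - move=> s s0 xr; apply: (le_trans (nsmall _ _ (ltW s0) (clr _))).
    by rewrite ler_wpM2l ?divr_ge0 ?(ltW hb).
  - by move=> s s0; exact: gd (ltW s0).
have clphi t : 0 <= t -> cl (phi t) = phi t.
  by move=> t0; apply: clid; rewrite (le_trans (phib t t0))// ltW.
have eqv1 t : 0 <= t -> v t + A * RL ga v t =
    - b * phi t + \sum_(k < m) q k t * f k (phi t) + g t.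
  by move=> t0; have := eqv t t0; rewrite -/(phi t) clphi.
have sol : is_solution alpha beta a b q f g x0 phi.
  by apply: (integral_equation_solution hbeta hbeta_alpha dal dbe cv) => t t0; exact: eqv1 (ltW t0).
exists phi; split => //.
- (* psi solves the same integral equation, and remains in the interval where the
     nonlinearity has a small Lipschitz constant *)
  move=> psi psis.
  have [cV psiE eqV] := solution_integral_equation repr dbe psis.
  set V := ext (caputo alpha psi) in cV psiE eqV.
  pose psi' t := x0 + c * RL alpha V t.
  have psib t : 0 <= t -> `|psi' t| <= eps.
    apply: (@apriori_bound R alpha ga c A b ga0 gal halpha c0 A0 hb V
      (fun t => \sum_(k < m) q k t * f k (psi t)) g x0 eps r0 cV er e0 x0e').
    + by move=> s s0; exact: eqV.
    + by move=> s s0; rewrite -(psiE s (ltW s0)); exact: nsmall (ltW s0).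
    + by move=> s s0; exact: gd (ltW s0).
  have eqV1 t : 0 < t -> V t + A * RL ga V t =
      - b * psi' t + (\sum_(k < m) q k t * f k (psi' t) + g t).
    by move=> t0; rewrite addrA /psi' -(psiE t (ltW t0)) {1}(psiE t (ltW t0)); exact: eqV.
  have eqv2 t : 0 < t -> v t + A * RL ga v t =
      - b * phi t + (\sum_(k < m) q k t * f k (phi t) + g t).
    by move=> t0; rewrite addrA; exact: eqv1 (ltW t0).
  have close s y z : 0 < s -> `|y| <= eps -> `|z| <= eps ->
      `|(\sum_(k < m) q k s * f k y + g s) - (\sum_(k < m) q k s * f k z + g s)| <=
      b / 2 * `|y - z|.
    move=> s0 ye ze; rewrite opprD addrACA subrr addr0; apply: small => //; first exact: ltW.
      by rewrite (le_trans ye)// ltW.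
    by rewrite (le_trans ze)// ltW.
  move=> t t0; rewrite psiE//; apply/eqP; rewrite eq_le; apply/andP; split.
    apply: (difference_le0 ga0 gal halpha c0 A0 hb cV cv eqV1 eqv2) => // s s0.
    by apply: close => //; [exact: psib (ltW s0)|exact: phib (ltW s0)].
  apply: (difference_le0 ga0 gal halpha c0 A0 hb cv cV eqv2 eqV1) => // s s0.
  by apply: close => //; [exact: phib (ltW s0)|exact: psib (ltW s0)].
- pose N t := - b * phi t + \sum_(k < m) q k (Num.max t 0) * f k (phi t).
  have cN : continuous N.
    move=> t; apply: cvgD; last exact: (nonlinear_cont q_cont f_cont cphi).
    by apply: cvgM; [exact: cvg_cst|exact: cphi].
  have /choice[Tk hTk] : forall k, exists T : R, forall t, T <= t -> 0 <= q k t.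
    by move=> k; have [T _ hT] := q_nonneg k; exists T.
  pose Tq := \sum_k `|Tk k|.
  have Tkq k : Tk k <= Tq.
    rewrite /Tq (bigD1 k)//= (le_trans (ler_norm _))// lerDl.
    exact: sumr_ge0.
  have Tq0 : 0 <= Tq by exact: sumr_ge0.
  have qpos t k : Tq <= t -> 0 <= q k (Num.max t 0).
    move=> Tt; rewrite (max_l (le_trans Tq0 Tt)).
    exact: hTk (le_trans (Tkq k) Tt).
  apply: (@solution_oscillates R alpha ga c A x0 sigma v N (ext g)
    (fun t => (t + 1) `^ sigma * h t) h Tq) => //.
  + exact: ext_cont.
  + by move=> t t0; rewrite eqv1// /N (extE _ t0) max_l.
  + move=> t t0; rewrite (repr _ GC t t0) addrAC subrr add0r; congr (_ * _).
    by apply: RL_eq => s /andP[s0 _]; rewrite !extE// gE.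
  + move=> t Tt; rewrite -/(phi t) => x_ge0; rewrite /N mulNr.
    rewrite -[leRHS]addr0; apply: lerD; first by rewrite oppr_le0 mulr_ge0// ltW.
    apply: sumr_le0 => k _; apply: mulr_ge0_le0; first exact: qpos.
    move: x_ge0; rewrite le_eqVlt => /predU1P[<-|xp]; first by rewrite F1.
    by have := F3 k (phi t); rewrite pmulr_rle0.
  + move=> t Tt; rewrite -/(phi t) => x_le0; rewrite /N mulNr.
    apply: addr_ge0; first by rewrite oppr_ge0 mulr_ge0_le0// ltW.
    apply: sumr_ge0 => k _; apply: mulr_ge0; first exact: qpos.
    move: x_le0; rewrite le_eqVlt => /predU1P[->|xn]; first by rewrite F1.
    by have := F3 k (phi t); rewrite nmulr_rle0.
  + exact: limf_esup_frequently.
  + exact: limf_einf_frequently.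
have GCc : {within nonneg_halfline, continuous (fun t => (t + 1) `^ sigma * h t)} by case: GC.
have [kap [Cg [kap0 gdec]]] := forcing_decay halpha sigma0 sal hetal GCc hd cdh hb' hdh gE.
pose N t := \sum_(k < m) q k t * f k (phi t) + g t.
have nphi t : 0 < t -> `|N t| <= b / 2 * `|phi t| + `|ext g t|.
  move=> t0; apply: (le_trans (ler_normD _ _)).
  rewrite (extE _ (ltW t0)) lerD2r; apply: nsmall; first exact: ltW.
  by rewrite (le_trans (phib t (ltW t0)))// ltW.
have eqN t : 0 < t -> v t + A * RL ga v t = - b * phi t + N t.
  by move=> t0; rewrite /N addrA; exact: eqv1 (ltW t0).
exact: (decay_to_zero ga0 gal halpha c0 A0 hb cv kap0 eqN nphi gdec phib).
Qed.
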